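(* Let $g$ be monotone increasing and satisfy hypothesis (H), let $h\ge0$, and assume that $u=\phi(x+c_*t)$, $c_*>c_\#$, is a pushed traveling front of $u_t=u_{xx}-u+g(u(t-h,x))$. Let $\mu>\lambda_1(c_* )$, $A>0$, and fix $\lambda\in(\lambda_1(c_* ),\lambda_2(c_* ))$ with $\lambda<\mu$. Suppose that the functions $w_0(s,x)$ and $w_0(s,-x)$ are not identically zero and both satisfy (IC1): values in $[0,\kappa]$ for all $x\in\mathbb{R}$, $s\in[-h,0]$, and (IC2): bounded by $Ae^{\mu x}$ for all $x\in\mathbb{R}$, $s\in[-h,0]$. Then the solution $u(t,x)$ of $u_t(t,x)=u_{xx}(t,x)-u(t,x)+g(u(t-h,x))$ ($t>0$), $u(s,x)=w_0(s,x)$ ($s\in[-h,0]$), satisfies, for some $s_1,s_2\in\mathbb{R}$, $$\lim_{t\to\infty}\sup_{x\le0}\frac{|u(t,x)-\phi(x+c_*t+s_1)|}{\eta(x+c_*t)}=0,\qquad \lim_{t\to\infty}\sup_{x\ge0}\frac{|u(t,x)-\phi(-x+c_*t+s_2)|}{\eta(-x+c_*t)}=0.$$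
   Context: Hypothesis (H) on $g:\mathbb{R}_+\to\mathbb{R}_+$: $g(x)=x$ has exactly two nonnegative solutions $0$ and $\kappa>0$; $g$ is $C^1$ in a $\delta_0$-neighbourhood of $0$ and of $\kappa$, with $g'(0)>1$, $g'(\kappa)<1$; $|g(u)-g(v)|\le L_g|u-v|$ for $u,v\in[0,\kappa]$; there are $C>0,\theta\in(0,1]$ with $|g'(u)-g'(0)|+|g'(\kappa)-g'(\kappa-u)|\le Cu^\theta$ for $u\in(0,\delta_0]$; $g$ is extended linearly and $C^1$-smoothly to $(-\infty,0]$ and $[\kappa,\infty)$. Characteristic function $\chi(z,c)=z^2-cz-1+g'(0)e^{-zch}$; $c_\#$ is the unique real $c$ for which $\chi(\cdot,c)$ has a positive double zero; for $c>c_\#$ its two positive simple zeros are $\lambda_1(c)<\lambda_2(c)$. A wavefront is a solution $u=\phi(x+ct)$ with $\phi>0$, $\phi(-\infty)=0$, $\phi(+\infty)=\kappa$; $c_*$ is the minimal wavefront speed; the minimal wavefront is pushed if $c_*>c_\#$. $w_0:[-h,0]\times\mathbb{R}\to\mathbb{R}$ is continuous and locally Hölder continuous in $x$ uniformly in $s$. $\eta(x)=\min\{e^{\lambda x},1\}$. *)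

(* Defs.v *)
From Stdlib Require Import Reals.
From Coquelicot Require Import Coquelicot.
Open Scope R_scope.

(* Hypothesis (H) on g (g already extended to all of R). *)
Definition hypH (g : R -> R) (kappa : R) : Prop :=
  0 < kappa /\
  (forall x, 0 <= x -> 0 <= g x) /\
  (forall x, 0 <= x -> (g x = x <-> (x = 0 \/ x = kappa))) /\
  exists delta0 Lg C theta : R,
    0 < delta0 /\
    (forall x, Rabs x < delta0 -> ex_derive g x /\ continuous (Derive g) x) /\
    (forall x, Rabs (x - kappa) < delta0 -> ex_derive g x /\ continuous (Derive g) x) /\
    Derive g 0 > 1 /\ Derive g kappa < 1 /\
    (forall u v, 0 <= u <= kappa -> 0 <= v <= kappa ->
       Rabs (g u - g v) <= Lg * Rabs (u - v)) /\
    0 < C /\ 0 < theta <= 1 /\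
    (forall u, 0 < u <= delta0 ->
       Rabs (Derive g u - Derive g 0) + Rabs (Derive g kappa - Derive g (kappa - u))
       <= C * Rpower u theta) /\
    (* linear C^1 extension to (-oo,0] and [kappa,+oo) *)
    (forall x, x <= 0 -> g x = Derive g 0 * x) /\
    (forall x, kappa <= x -> g x = kappa + Derive g kappa * (x - kappa)).

Definition chi (g : R -> R) (h z c : R) : R :=
  z ^ 2 - c * z - 1 + Derive g 0 * exp (- (z * c * h)).

Definition has_pos_double_zero (g : R -> R) (h c : R) : Prop :=
  exists z, 0 < z /\ chi g h z c = 0 /\ Derive (fun w => chi g h w c) z = 0.

Definition lambda12 (g : R -> R) (h c l1 l2 : R) : Prop :=
  0 < l1 /\ l1 < l2 /\
  chi g h l1 c = 0 /\ chi g h l2 c = 0 /\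
  Derive (fun w => chi g h w c) l1 <> 0 /\ Derive (fun w => chi g h w c) l2 <> 0 /\
  (forall z, 0 < z -> chi g h z c = 0 -> z = l1 \/ z = l2).

Definition solves_at (g : R -> R) (h : R) (u : R -> R -> R) (t x : R) : Prop :=
  ex_derive (fun s => u s x) t /\
  (forall y, ex_derive (u t) y) /\
  ex_derive (Derive (u t)) x /\
  Derive (fun s => u s x) t = Derive (Derive (u t)) x - u t x + g (u (t - h) x).

Definition wavefront (g : R -> R) (h kappa : R) (phi : R -> R) (c : R) : Prop :=
  (forall xi, 0 < phi xi) /\
  is_lim phi m_infty 0 /\
  is_lim phi p_infty kappa /\
  (forall t x, solves_at g h (fun t x => phi (x + c * t)) t x).

Definition min_speed (g : R -> R) (h kappa cs : R) : Prop :=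
  (exists phi, wavefront g h kappa phi cs) /\
  (forall phi c, wavefront g h kappa phi c -> cs <= c).

Definition eta (lam x : R) : R := Rmin (exp (lam * x)) 1.

Definition w0_regular (h : R) (w0 : R -> R -> R) : Prop :=
  (forall s x, -h <= s <= 0 ->
     filterlim (fun p : R * R => w0 (fst p) (snd p))
       (within (fun p : R * R => -h <= fst p <= 0) (locally (s, x)))
       (locally (w0 s x))) /\
  (forall x0, exists delta alpha K, 0 < delta /\ 0 < alpha <= 1 /\
     forall s x y, -h <= s <= 0 -> Rabs (x - x0) < delta -> Rabs (y - x0) < delta ->
       Rabs (w0 s x - w0 s y) <= K * Rpower (Rabs (x - y)) alpha).

Definition ivp_solution (g : R -> R) (h : R) (w0 u : R -> R -> R) : Prop :=
  (forall s x, -h <= s <= 0 -> u s x = w0 s x) /\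
  (forall t x, -h <= t ->
     filterlim (fun p : R * R => u (fst p) (snd p))
       (within (fun p : R * R => -h <= fst p) (locally (t, x)))
       (locally (u t x))) /\
  (forall T, exists M, forall t x, -h <= t <= T -> Rabs (u t x) <= M) /\
  (forall t x, 0 < t -> solves_at g h u t x).

(* Main.v *)
Require Import Defs.
From Stdlib Require Import Reals.
From Coquelicot Require Import Coquelicot.
From Stdlib Require Import Lra Psatz Lia Cantor Classical ClassicalEpsilon.
From Corelib Require Import ssreflect.
Open Scope R_scope.

(* Idea. Write z = x + c t with c the minimal speed. If the front decayed at -oo more slowly than
   e^{l z} for some l between the two roots of chi, then min (phi, B e^{l z}) could be perturbed to a
   strict supersolution of the profile equation, hence to a supersolution at a slightly smaller speed,
   and monotone iteration below it would give a front slower than the minimal one. So the front is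
   o(e^{lam z}); in the weight eta the maximum principle then holds at both ends, and sliding shows
   that phi is strictly increasing. Consequently phi (z + s(t)) + q(t) eta and
   phi (z - s(t)) - q(t) eta, with q exponentially small and s bounded, are super- and subsolutions.
   The subsolution is used on x <= 0 only; the boundary value u(t, 0) converges exponentially to kappa
   because growing and moving bumps invade 0 at linear speed. Thus u is eventually trapped between two
   translates of phi up to any multiple of eta. Let a and b be the best asymptotic translates from
   below and from above; if a < b, then at arbitrarily late times u differs from one of the two
   translates by a fixed amount at z = 0, the strong maximum principle (an explicit moving bump)
   spreads this gain over a long interval, and the stability estimate improves a or b, which is
   impossible. The half line x >= 0 follows by reflection. *)

(** * Compactness and derivative tests *)

(** The time-dependent part works by explicit barriers alone: no semigroup, no compactness of
    orbits, and lower bounds by bumps in place of a strong maximum principle. Since [lam] lies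
    strictly between the roots, [chi g h lam c < 0]. This slack pays at [-oo] for the variation of
    the slope of [g] near 0, for exponential decay in time and for the factor [e^{ga h}] that the
    delay adds; at [+oo] the inequality [k < 1] does the same. The fast decay of the front is needed
    once more at the end: a shift by [e] changes the front by [o(1) e eta] at both ends, so a gain
    on a compact part of the moving frame can be traded for a true shift. For a front decaying like
    [e^{l1 z}] with [l1 < lam] the quotient of [phi'] and [eta] would be unbounded. Monotonicity of
    [g] lets an ordering on the past window pass to the forcing, which is how the delay enters every
    comparison. The kink of the minimum [eta] has the right sign in both uses: [q eta] is added to
    supersolutions and subtracted from subsolutions. *)

Lemma exp_le_mono x y : x <= y -> exp x <= exp y.
Proof. intros [H| ->]. left; apply exp_increasing; auto. right; auto. Qed.

Definition increasing_nat (s : nat -> nat) : Prop := forall n, (s n < s (S n))%nat.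

Lemma increasing_nat_lt s : increasing_nat s -> forall n m, (n < m)%nat -> (s n < s m)%nat.
Proof.
  intros H n m Hnm. induction Hnm as [|m Hnm IH].
  - apply H.
  - apply Nat.lt_trans with (1 := IH). apply H.
Qed.

Lemma increasing_nat_ge s : increasing_nat s -> forall n, (n <= s n)%nat.
Proof.
  intros H n. induction n as [|n IH]. lia. specialize (H n). lia.
Qed.

Lemma increasing_nat_comp s r :
  increasing_nat s -> increasing_nat r -> increasing_nat (fun n => s (r n)).
Proof.
  intros Hs Hr n. apply increasing_nat_lt; auto.
Qed.

Lemma is_lim_seq_increasing u l s :
  increasing_nat s -> is_lim_seq u l -> is_lim_seq (fun n => u (s n)) l.
Proof.
  intros Hs Hu. apply (is_lim_seq_subseq u l s); auto. apply eventually_subseq. exact Hs.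
Qed.

Lemma bounded_subsequence (u : nat -> R) (M : R) :
  (forall n, Rabs (u n) <= M) ->
  exists (s : nat -> nat) (l : R), increasing_nat s /\ is_lim_seq (fun n => u (s n)) l.
Proof.
  intros HM.
  destruct (Bolzano_Weierstrass u (fun x => -M <= x <= M)) as [l Hl].
  - apply compact_P3.
  - intros n. apply Rabs_le_between, HM.
  - assert (H : forall n N : nat, exists p, (N <= p)%nat /\ Rabs (u p - l) < / (INR n + 1)).
    { intros n N.
      assert (Hp : 0 < / (INR n + 1)).
      { apply Rinv_0_lt_compat. generalize (pos_INR n). lra. }
      destruct (Hl (disc l (mkposreal _ Hp)) N) as [p [Hp1 Hp2]].
      - exists (mkposreal _ Hp). intros x Hx; exact Hx.
      - exists p; split; auto. }
    destruct (choice (fun (nN : nat * nat) p =>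
       (snd nN <= p)%nat /\ Rabs (u p - l) < / (INR (fst nN) + 1))) as [F HF].
    { intros [n N]. apply H. }
    set (s := fix s n := match n with O => F (0, 0)%nat | S k => F (S k, S (s k)) end).
    exists s, l. split.
    + intros n. simpl. destruct (HF (S n, S (s n))) as [H1 _]. simpl in H1. lia.
    + apply is_lim_seq_spec. intros eps.
      destruct (nfloor_ex (/ eps)) as [N HN].
      { left. apply Rinv_0_lt_compat, cond_pos. }
      exists N. intros n Hn.
      assert (Hs : Rabs (u (s n) - l) < / (INR n + 1)).
      { destruct n; simpl; [apply (HF (0,0)%nat) | apply (HF (S n, S (s n)))]. }
      apply Rlt_trans with (1 := Hs).
      rewrite <- (Rinv_inv eps). apply Rinv_lt_contravar.
      * apply Rmult_lt_0_compat. apply Rinv_0_lt_compat, cond_pos. generalize (pos_INR n); lra.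
      * apply le_INR in Hn. lra.
Qed.

Lemma is_derive_approx (f : R -> R) (x l : R) : is_derive f x l -> forall eps, 0 < eps ->
  exists d, 0 < d /\ forall y, Rabs (y - x) < d -> Rabs (f y - f x - l * (y - x)) <= eps * Rabs (y - x).
Proof.
  intros H eps He. apply is_derive_Reals in H.
  destruct (H eps He) as [d Hd]. exists d. split. apply cond_pos.
  intros y Hy. destruct (Req_dec y x) as [->|Hn].
  - replace (f x - f x - l * (x - x)) with 0 by ring. rewrite Rabs_R0.
    replace (x - x) with 0 by ring. rewrite Rabs_R0. lra.
  - specialize (Hd (y - x)). replace (x + (y - x)) with y in Hd by ring.
    assert (Hn' : y - x <> 0) by lra.
    specialize (Hd Hn' Hy).
    replace (f y - f x - l * (y - x)) with (((f y - f x) / (y - x) - l) * (y - x)) by (field; lra).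
    rewrite Rabs_mult. apply Rmult_le_compat_r. apply Rabs_pos. lra.
Qed.

Lemma is_derive_eq (f : R -> R) (x : R) (l l' : R) : is_derive f x l -> l = l' -> is_derive f x l'.
Proof. intros H <-. exact H. Qed.

Lemma is_derive_comp_real (f g : R -> R) (x : R) (df dg : R) :
  is_derive f (g x) df -> is_derive g x dg -> is_derive (fun y => f (g y)) x (dg * df).
Proof. intros Hf Hg. exact (is_derive_comp f g x df dg Hf Hg). Qed.

Lemma is_derive_lin (a b x : R) : is_derive (fun y => a * y + b) x a.
Proof. auto_derive; auto. ring. Qed.

Lemma is_derive_comp_lin (f : R -> R) (a b x l : R) :
  is_derive f (a * x + b) l -> is_derive (fun y => f (a * y + b)) x (a * l).
Proof.
  intros H. apply (is_derive_comp_real f (fun y => a * y + b)); auto. apply is_derive_lin.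
Qed.

Lemma is_derive_add (f g : R -> R) (x : R) (df dg : R) :
  is_derive f x df -> is_derive g x dg -> is_derive (fun y => f y + g y) x (df + dg).
Proof. intros Hf Hg. exact (is_derive_plus f g x df dg Hf Hg). Qed.

Lemma is_derive_sub (f g : R -> R) (x : R) (df dg : R) :
  is_derive f x df -> is_derive g x dg -> is_derive (fun y => f y - g y) x (df - dg).
Proof. intros Hf Hg. exact (is_derive_minus f g x df dg Hf Hg). Qed.

Lemma is_derive_neg (f : R -> R) (x : R) (df : R) :
  is_derive f x df -> is_derive (fun y => - f y) x (- df).
Proof. intros Hf. exact (is_derive_opp f x df Hf). Qed.

Lemma is_derive_cmul (f : R -> R) (x : R) (k df : R) :
  is_derive f x df -> is_derive (fun y => k * f y) x (k * df).
Proof. intros Hf. exact (is_derive_scal f x k df Hf). Qed.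

Lemma is_derive_mul (f g : R -> R) (x : R) (df dg : R) :
  is_derive f x df -> is_derive g x dg -> is_derive (fun y => f y * g y) x (df * g x + f x * dg).
Proof.
  intros Hf Hg. apply (is_derive_mult f g x df dg Hf Hg). intros; apply Rmult_comm.
Qed.

(** Only earlier times are compared: a first touching may happen at the final time, where nothing is
    known about later values. *)
Lemma left_max_derive (f : R -> R) (t l d : R) : 0 < d -> is_derive f t l ->
  (forall s, t - d < s < t -> f s <= f t) -> 0 <= l.
Proof.
  intros Hd H Hm. destruct (Rle_lt_dec 0 l) as [|Hl]; auto. exfalso.
  destruct (is_derive_approx f t l H (-l/2)) as [e [He1 He2]]. lra.
  set (s := t - Rmin d e / 2).
  assert (Hmin : 0 < Rmin d e) by (apply Rmin_pos; lra).
  assert (H1 := Rmin_l d e). assert (H2 := Rmin_r d e).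
  specialize (Hm s). specialize (He2 s).
  assert (Hs : t - d < s < t) by (unfold s; lra).
  assert (Hs' : Rabs (s - t) = t - s). { rewrite Rabs_left; lra. }
  rewrite Hs' in He2.
  assert (He3 : Rabs (f s - f t - l * (s - t)) <= -l/2 * (t - s)). { apply He2. unfold s; lra. }
  apply Rabs_le_between in He3. specialize (Hm Hs). nra.
Qed.

Lemma local_max_derive (f : R -> R) (x l d : R) : 0 < d -> is_derive f x l ->
  (forall y, Rabs (y - x) < d -> f y <= f x) -> l = 0.
Proof.
  intros Hd H Hm. apply Rle_antisym.
  - assert (0 <= - l); [|lra].
    apply (left_max_derive (fun s => f (- s)) (- x) (- l) d Hd).
    + apply is_derive_eq with (-1 * l); [|ring].
      apply (is_derive_ext (fun s : R => f (-1 * s + 0))). { intros s; f_equal. ring. }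
      apply is_derive_comp_lin. replace (-1 * - x + 0) with x by ring. exact H.
    + intros s Hs. rewrite Ropp_involutive. apply Hm. apply Rabs_lt_between. lra.
  - apply (left_max_derive f x l d Hd H). intros s Hs. apply Hm. apply Rabs_lt_between. lra.
Qed.

Lemma local_max_derive2 (f f1 : R -> R) (x l d : R) : 0 < d ->
  (forall y, Rabs (y - x) < d -> is_derive f y (f1 y)) -> is_derive f1 x l ->
  (forall y, Rabs (y - x) < d -> f y <= f x) -> l <= 0.
Proof.
  intros Hd H H1 Hm. destruct (Rle_lt_dec l 0) as [|Hl]; auto. exfalso.
  assert (Hx : f1 x = 0).
  { apply (local_max_derive f x _ d Hd); auto. apply H. rewrite Rminus_diag Rabs_R0. lra. }
  destruct (is_derive_approx f1 x l H1 (l/2)) as [e [He1 He2]]. lra.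
  set (y := x + Rmin d e / 2).
  assert (Hmin : 0 < Rmin d e) by (apply Rmin_pos; lra).
  assert (G1 := Rmin_l d e). assert (G2 := Rmin_r d e).
  destruct (MVT_cor2 f f1 x y) as [z [Hz1 Hz2]].
  - unfold y; lra.
  - intros z Hz. apply is_derive_Reals, H. apply Rabs_lt_between. unfold y in Hz; lra.
  - assert (Hzx : 0 < f1 z).
    { specialize (He2 z). rewrite (Rabs_right (z - x)) in He2; [|lra].
      assert (Hq : Rabs (f1 z - f1 x - l * (z - x)) <= l / 2 * (z - x)).
      { apply He2. unfold y in Hz2; lra. }
      apply Rabs_le_between in Hq. rewrite Hx in Hq. nra. }
    assert (f y <= f x). { apply Hm. apply Rabs_lt_between. unfold y; lra. }
    nra.
Qed.

(** The touching time is the infimum of the times at which [W >= 0] somewhere in [Dom]. Negativity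
    outside the radius [Rad] keeps near-minimising points bounded, so a subsequence converges, and
    closedness and continuity put a zero of [W] at the limit. There are two space variables because
    the Lipschitz estimate doubles them; [comparison] pins the second one to 0. *)
Lemma first_touch (W : R -> R -> R -> R) (Dom : R -> R -> Prop) (t0 T Rad : R) :
  (forall (xn yn : nat -> R) (x y : R), (forall n, Dom (xn n) (yn n)) ->
     is_lim_seq xn x -> is_lim_seq yn y -> Dom x y) ->
  (forall (tn xn yn : nat -> R) (t x y : R), (forall n, t0 <= tn n <= T) ->
     t0 <= t <= T -> (forall n, Dom (xn n) (yn n)) -> Dom x y ->
     is_lim_seq tn t -> is_lim_seq xn x -> is_lim_seq yn y ->
     is_lim_seq (fun n => W (tn n) (xn n) (yn n)) (W t x y)) ->
  (forall x y, Dom x y -> W t0 x y < 0) ->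
  (forall t x y, t0 <= t <= T -> Dom x y -> Rad < Rabs x \/ Rad < Rabs y -> W t x y < 0) ->
  (forall t x y, t0 <= t <= T -> Dom x y -> W t x y < 0) \/
  exists t x y, t0 < t <= T /\ Dom x y /\ W t x y = 0 /\
    (forall t' x' y', t0 <= t' < t -> Dom x' y' -> W t' x' y' < 0) /\
    (forall x' y', Dom x' y' -> W t x' y' <= 0).
Proof.
  intros Hcl Hct Hin Hfar.
  destruct (classic (exists t x y, t0 <= t <= T /\ Dom x y /\ 0 <= W t x y)) as [Hex|Hno].
  2:{ left. intros t x y Ht Hxy. apply Rnot_le_lt. intros H. apply Hno. exists t, x, y. auto. }
  right.
  (* Completeness provides suprema only, hence the negated times; [ts] is the infimum. *)
  set (E := fun s => exists t, s = - t /\ t0 <= t <= T /\ exists x y, Dom x y /\ 0 <= W t x y).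
  destruct (completeness E) as [ms [Hub Hlub]].
  { exists (- t0). intros s [t [-> [Ht _]]]. lra. }
  { destruct Hex as [t [x [y [Ht [Hxy HW]]]]]. exists (-t), t. split; auto. split; auto.
    exists x, y; auto. }
  set (ts := - ms).
  assert (Hlow : forall t x y, t0 <= t <= T -> Dom x y -> t < ts -> W t x y < 0).
  { intros t x y Ht Hxy Htt. apply Rnot_le_lt. intros HW.
    assert (-t <= ms). { apply Hub. exists t. split; auto. split; auto. exists x, y; auto. }
    unfold ts in Htt; lra. }
  assert (Hts0 : t0 <= ts).
  { unfold ts. assert (ms <= - t0); [|lra]. apply Hlub. intros s [t [-> [Ht _]]]. lra. }
  assert (HtsT : ts <= T).
  { destruct Hex as [t [x [y [Ht [Hxy HW]]]]]. apply Rnot_lt_le. intros Hlt.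
    assert (W t x y < 0). { apply Hlow; auto. lra. } lra. }
  assert (Hseq : forall n : nat, exists p : R * R * R,
     ts <= fst (fst p) < ts + / (INR n + 1) /\ fst (fst p) <= T /\
     Dom (snd (fst p)) (snd p) /\ 0 <= W (fst (fst p)) (snd (fst p)) (snd p)).
  { intros n. assert (Hp : 0 < / (INR n + 1)).
    { apply Rinv_0_lt_compat. generalize (pos_INR n). lra. }
    apply NNPP. intros Hcon.
    assert (ms <= ms - / (INR n + 1)); [|lra].
    apply Hlub. intros s [t [-> [Ht [x [y [Hxy HW]]]]]].
    apply Rnot_lt_le. intros Hlt. apply Hcon. exists (t, x, y). simpl.
    assert (ts <= t). { apply Rnot_lt_le. intros Hlt'. assert (W t x y < 0); [|lra]. apply Hlow; auto. }
    unfold ts in *. repeat split; auto; lra. }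
  destruct (choice _ Hseq) as [P HP].
  set (tn := fun n => fst (fst (P n))). set (xn := fun n => snd (fst (P n))).
  set (yn := fun n => snd (P n)).
  assert (HP' : forall n, ts <= tn n < ts + / (INR n + 1) /\ tn n <= T /\ Dom (xn n) (yn n) /\
     0 <= W (tn n) (xn n) (yn n)) by exact HP.
  assert (Hb : forall n, Rabs (xn n) <= Rad /\ Rabs (yn n) <= Rad).
  { intros n. destruct (HP' n) as [H1 [H2 [H3 H4]]]. split; apply Rnot_lt_le; intros Hlt;
    assert (W (tn n) (xn n) (yn n) < 0); try lra; apply Hfar; auto; lra. }
  destruct (bounded_subsequence xn Rad) as [s1 [x [Hs1 Hx]]]. { intros n; apply Hb. }
  destruct (bounded_subsequence (fun n => yn (s1 n)) Rad) as [s2 [y [Hs2 Hy]]]. { intros n; apply Hb. }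
  set (s := fun n => s1 (s2 n)).
  assert (Hs : increasing_nat s) by (apply (increasing_nat_comp s1 s2); assumption).
  assert (Hx' : is_lim_seq (fun n => xn (s n)) x).
  { apply (is_lim_seq_increasing (fun n => xn (s1 n))); auto. }
  assert (Hy' : is_lim_seq (fun n => yn (s n)) y) by exact Hy.
  assert (Ht : is_lim_seq tn ts).
  { apply is_lim_seq_le_le with (u := fun _ => ts) (w := fun n => ts + / (INR n + 1)).
    - intros n. destruct (HP' n) as [? _]; lra.
    - apply is_lim_seq_const.
    - replace (Finite ts) with (Finite (ts + 0)) by (f_equal; ring).
      apply is_lim_seq_plus'. apply is_lim_seq_const.
      replace (Finite 0) with (Rbar_inv p_infty) by reflexivity.
      apply is_lim_seq_inv; [|discriminate].
      apply is_lim_seq_ext with (u := fun n => INR (S n)).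
      { intros n. apply S_INR. }
      apply (is_lim_seq_incr_1 INR). apply is_lim_seq_INR. }
  assert (Ht' : is_lim_seq (fun n => tn (s n)) ts) by (apply is_lim_seq_increasing; auto).
  assert (Hd : Dom x y).
  { apply (Hcl (fun n => xn (s n)) (fun n => yn (s n))); auto. intros n; apply HP'. }
  assert (HW0 : 0 <= W ts x y).
  { apply (is_lim_seq_le (fun _ => 0) (fun n => W (tn (s n)) (xn (s n)) (yn (s n))) 0 (W ts x y)).
    - intros n; apply HP'.
    - apply is_lim_seq_const.
    - apply Hct; auto. intros n. destruct (HP' (s n)) as [? [? _]]; lra. intros n; apply HP'. }
  assert (Htpos : t0 < ts).
  { destruct (Rle_lt_or_eq_dec _ _ Hts0) as [|Heq]; auto. exfalso.
    rewrite <- Heq in HW0. specialize (Hin x y Hd). lra. }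
  assert (Hle : forall x' y', Dom x' y' -> W ts x' y' <= 0).
  { intros x' y' Hd'.
    set (tm := fun n => ts - (ts - t0) * / (INR n + 1)).
    assert (Htm : forall n, t0 <= tm n < ts).
    { intros n. unfold tm. assert (0 < / (INR n + 1) <= 1).
      { generalize (pos_INR n); intros. split. apply Rinv_0_lt_compat. lra.
        rewrite <- Rinv_1. apply Rinv_le_contravar; lra. }
      nra. }
    apply (is_lim_seq_le (fun n => W (tm n) x' y') (fun _ => 0) (W ts x' y') 0).
    - intros n. left. apply Hlow; auto; generalize (Htm n); lra.
    - apply (Hct tm (fun _ => x') (fun _ => y') ts x' y'); auto; try apply is_lim_seq_const.
      + intros n. generalize (Htm n); lra.
      + unfold tm. replace (Finite ts) with (Finite (ts - (ts - t0) * 0)) by (f_equal; ring).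
        apply is_lim_seq_minus'. apply is_lim_seq_const.
        apply is_lim_seq_mult'. apply is_lim_seq_const.
        replace (Finite 0) with (Rbar_inv p_infty) by reflexivity.
        apply is_lim_seq_inv; [|discriminate].
        apply is_lim_seq_ext with (u := fun n => INR (S n)).
        { intros n. apply S_INR. }
        apply (is_lim_seq_incr_1 INR). apply is_lim_seq_INR.
    - apply is_lim_seq_const. }
  exists ts, x, y. repeat split; auto.
  - apply Rle_antisym; auto.
  - intros t' x' y' Ht1 Hd'. apply Hlow; auto; lra.
Qed.

(** * Parabolic comparison *)

(** The equation [w_t = w_xx - w + f] at one point. The term [- w] belongs to the operator, so in
    the applications to [u] the forcing [f] is just the delayed reaction. *)
Definition heat_at (w : R -> R -> R) (f t x : R) : Prop :=
  exists (w1 : R -> R) (wt wxx : R),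
    is_derive (fun s => w s x) t wt /\ (forall y : R, is_derive (w t) y (w1 y)) /\
    is_derive w1 x wxx /\ wt = wxx - w t x + f.

(* [v_t - v_xx + v >= F] in the viscosity sense, with separate test functions in time and in space;
   the one in time only has to dominate [v] in the past. *)
Definition supersol_at (v : R -> R -> R) (F t x : R) : Prop :=
  exists (p q q1 : R -> R) (dp d2q d : R), 0 < d /\ p t = v t x /\ q x = v t x /\
    (forall s, t - d < s <= t -> v s x <= p s) /\
    (forall y, Rabs (y - x) < d -> v t y <= q y) /\
    is_derive p t dp /\ (forall y, Rabs (y - x) < d -> is_derive q y (q1 y)) /\
    is_derive q1 x d2q /\ F <= dp - d2q + v t x.

Definition subsol_at (v : R -> R -> R) (F t x : R) : Prop :=
  exists (p q q1 : R -> R) (dp d2q d : R), 0 < d /\ p t = v t x /\ q x = v t x /\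
    (forall s, t - d < s <= t -> p s <= v s x) /\
    (forall y, Rabs (y - x) < d -> q y <= v t y) /\
    is_derive p t dp /\ (forall y, Rabs (y - x) < d -> is_derive q y (q1 y)) /\
    is_derive q1 x d2q /\ dp - d2q + v t x <= F.

(** Joint continuity restricted to times [>= t0], hence one-sided at [t0]: the solution is only
    known from time [- h] on. *)
Definition seq_cont (t0 : R) (v : R -> R -> R) : Prop :=
  forall (tn xn : nat -> R) (t x : R), (forall n, t0 <= tn n) -> t0 <= t ->
    is_lim_seq tn t -> is_lim_seq xn x -> is_lim_seq (fun n => v (tn n) (xn n)) (v t x).

Lemma seq_cont_le t0 t1 v : t0 <= t1 -> seq_cont t0 v -> seq_cont t1 v.
Proof.
  intros H Hv tn xn t x H1 H2. apply Hv; [|lra]. intros n; specialize (H1 n); lra.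
Qed.

Lemma seq_cont_opp t0 v : seq_cont t0 v -> seq_cont t0 (fun t x => - v t x).
Proof.
  intros H tn xn t x H1 H2 H3 H4. apply (is_lim_seq_opp _ (v t x)). auto.
Qed.

Lemma seq_cont_minus t0 v w : seq_cont t0 v -> seq_cont t0 w -> seq_cont t0 (fun t x => v t x - w t x).
Proof.
  intros Hv Hw tn xn t x H1 H2 H3 H4. apply is_lim_seq_minus'; auto.
Qed.

Lemma is_lim_seq_continuous_at (f : R -> R) (u : nat -> R) (l : R) :
  continuous f l -> is_lim_seq u l -> is_lim_seq (fun n => f (u n)) (f l).
Proof. intros Hf Hu. exact (filterlim_comp _ _ _ u f _ _ _ Hu Hf). Qed.

Lemma is_lim_seq_ex_derive (f : R -> R) (u : nat -> R) (l : R) :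
  ex_derive f l -> is_lim_seq u l -> is_lim_seq (fun n => f (u n)) (f l).
Proof.
  intros Hf. apply is_lim_seq_continuous_at. exact (ex_derive_continuous f l Hf).
Qed.

Definition closed_dom (Dom : R -> Prop) : Prop :=
  forall (xn : nat -> R) (x : R), (forall n, Dom (xn n)) -> is_lim_seq xn x -> Dom x.

(** The difference is tested against [Phi = del e^{K (t - t0)} (1 + x^2)]. Growth in [x] confines
    touching points to a bounded set, and [K = L + 2] gives [Phi_t - Phi_xx + Phi > L Phi], which
    beats the link inequality for the delayed terms. The left alternative in the pointwise
    hypothesis serves boundary points and regions where a barrier is trivially on the correct
    side. *)
Lemma comparison (u v f F : R -> R -> R) (Dom : R -> Prop) (h L t0 T M : R) :
  0 <= h -> 0 <= L -> closed_dom Dom -> seq_cont t0 u -> seq_cont t0 v ->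
  (forall t x, t0 <= t <= T -> Dom x -> u t x - v t x <= M) ->
  (forall t x, t0 - h <= t <= t0 -> Dom x -> u t x <= v t x) ->
  (forall t x, t0 < t <= T -> Dom x -> u t x <= v t x \/
     (exists d, 0 < d /\ forall y, Rabs (y - x) < d -> Dom y) /\
     heat_at u (f t x) t x /\ supersol_at v (F t x) t x /\
     (forall e, 0 <= e -> u (t - h) x <= v (t - h) x + e -> f t x <= F t x + L * e)) ->
  forall t x, t0 <= t <= T -> Dom x -> u t x <= v t x.
Proof.
  intros Hh HL Hcl Hcu Hcv HM Hinit Hstep t1 x1 Ht1 Hx1.
  apply Rnot_lt_le. intros Hlt.
  set (K := L + 2).
  (* Normalised so that [Phi t1 x1 = u t1 x1 - v t1 x1]: then [W] vanishes at the offending point,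
     which excludes the case without touching. *)
  set (del := (u t1 x1 - v t1 x1) / (exp (K * (t1 - t0)) * (1 + x1 * x1))).
  assert (Hpos1 : 0 < exp (K * (t1 - t0)) * (1 + x1 * x1)).
  { apply Rmult_lt_0_compat. apply exp_pos. nra. }
  assert (Hdel : 0 < del) by (unfold del; apply Rdiv_lt_0_compat; lra).
  set (Phi := fun t x => del * exp (K * (t - t0)) * (1 + x * x)).
  assert (HPhi_pos : forall t x, 0 < Phi t x).
  { intros t x. unfold Phi. apply Rmult_lt_0_compat; [|nra]. apply Rmult_lt_0_compat; auto. apply exp_pos. }
  assert (Hcphi : seq_cont t0 Phi).
  { intros tn xn t x _ _ Ht Hx. unfold Phi.
    apply is_lim_seq_mult'.
    - apply is_lim_seq_mult'. apply is_lim_seq_const.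
      apply (is_lim_seq_ex_derive (fun t => exp (K * (t - t0)))); auto.
      auto_derive; auto.
    - apply (is_lim_seq_ex_derive (fun x => 1 + x * x)); auto.
      auto_derive; auto. }
  set (W := fun t x (_ : R) => u t x - v t x - Phi t x).
  set (Rad := Rmax 0 M / del + 1).
  assert (HRad : 0 < Rad).
  { unfold Rad. assert (0 <= Rmax 0 M / del); [|lra].
    apply Rmult_le_pos. apply Rmax_l. left; apply Rinv_0_lt_compat; auto. }
  destruct (first_touch W (fun x y => Dom x /\ y = 0) t0 T Rad) as [Hneg|Hc].
  - intros xn yn x y Hn Hx Hy. split.
    + apply (Hcl xn); auto. intros n; apply Hn.
    + assert (Hy0 : is_lim_seq yn 0).
      { apply is_lim_seq_ext with (u := fun _ => 0). intros n; symmetry; apply Hn.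
        apply is_lim_seq_const. }
      apply is_lim_seq_unique in Hy. apply is_lim_seq_unique in Hy0. congruence.
  - intros tn xn yn t x y Htn Ht _ _ Lt Lx _. unfold W.
    apply is_lim_seq_minus'.
    + apply is_lim_seq_minus'. apply Hcu; auto. intros n; apply Htn. apply Ht.
      apply Hcv; auto. intros n; apply Htn. apply Ht.
    + apply Hcphi; auto. intros n; apply Htn. apply Ht.
  - intros x y [Hx _]. unfold W. generalize (HPhi_pos t0 x) (Hinit t0 x). intros H1 H2.
    assert (u t0 x <= v t0 x); [|lra]. apply H2; auto. lra.
  - intros t x y Ht [Hx ->] Hr. unfold W.
    assert (Hr' : Rad < Rabs x). { destruct Hr as [|Hr]; auto. rewrite Rabs_R0 in Hr. lra. }
    assert (M < Phi t x); [|specialize (HM t x Ht Hx); lra].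
    assert (He : 1 <= exp (K * (t - t0))).
    { rewrite <- exp_0. apply exp_le_mono. unfold K. nra. }
    assert (Hxx : x * x = Rabs x * Rabs x). { rewrite <- Rabs_mult. rewrite Rabs_pos_eq; nra. }
    assert (HR1 : Rad <= 1 + x * x) by (rewrite Hxx; nra).
    assert (HMR : M < del * Rad).
    { unfold Rad. replace (del * (Rmax 0 M / del + 1)) with (Rmax 0 M + del) by (field; lra).
      generalize (Rmax_r 0 M); lra. }
    unfold Phi. assert (del * 1 <= del * exp (K * (t - t0))) by (apply Rmult_le_compat_l; lra).
    nra.
  - specialize (Hneg t1 x1 0 Ht1 (conj Hx1 eq_refl)). unfold W, Phi in Hneg.
    assert (E : del * exp (K * (t1 - t0)) * (1 + x1 * x1) = u t1 x1 - v t1 x1).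
    { unfold del. field. split. nra. apply Rgt_not_eq, exp_pos. }
    lra.
  - destruct Hc as [t [x [y [Ht [[Hx ->] [HW [Hpast Hnow]]]]]]].
    unfold W in HW. generalize (HPhi_pos t x). intros HP.
    destruct (Hstep t x Ht Hx) as [Hk|[[d0 [Hd0 Hint]] [Hheat [Hsup Hlink]]]]; [lra|].
    destruct Hheat as [u1 [ut [uxx [Hut [Hu1 [Huxx Heq]]]]]].
    destruct Hsup as [p [q [q1 [dp [d2q [d [Hd [Hp [Hq [Hps [Hqs [Hdp [Hdq [Hd2q HF]]]]]]]]]]]]]].
    set (E := exp (K * (t - t0))).
    assert (HE : 0 < E) by apply exp_pos.
    assert (Ht_le : 0 <= ut - dp - K * Phi t x).
    { apply (left_max_derive (fun s => u s x - p s - Phi s x) t _ (Rmin d (t - t0))).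
      - apply Rmin_pos; lra.
      - apply is_derive_sub. apply is_derive_sub; auto.
        unfold Phi. auto_derive; auto. unfold Rminus; ring.
      - intros s Hs. assert (G1 := Rmin_l d (t - t0)). assert (G2 := Rmin_r d (t - t0)).
        rewrite Hp. assert (HWs : W s x 0 < 0) by (apply Hpast; auto; lra). unfold W in HWs.
        assert (v s x <= p s) by (apply Hps; lra). lra. }
    assert (Hx_le : uxx - d2q - 2 * del * E <= 0).
    { apply (local_max_derive2 (fun y => u t y - q y - Phi t y)
               (fun y => u1 y - q1 y - del * E * (2 * y)) x _ (Rmin d d0)).
      - apply Rmin_pos; auto.
      - intros y Hy. assert (G1 := Rmin_l d d0).
        apply is_derive_sub. apply is_derive_sub; auto. apply Hdq; lra.
        unfold Phi. auto_derive; auto. unfold E, Rminus. ring.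
      - apply is_derive_sub. apply is_derive_sub; auto.
        auto_derive; auto. ring.
      - intros y Hy. assert (G1 := Rmin_l d d0). assert (G2 := Rmin_r d d0).
        rewrite Hq. assert (HWy : W t y 0 <= 0). { apply Hnow. split; auto. apply Hint; lra. }
        unfold W in HWy. assert (v t y <= q y) by (apply Hqs; lra). lra. }
    (* The delayed point lies in the strict past, or is the touching point itself when [h = 0], or
       lies in the initial window; in each case the excess of [u] over [v] there is at most
       [Phi t x]. *)
    assert (Hf : f t x <= F t x + L * Phi t x).
    { apply Hlink; [lra|]. destruct (Rle_lt_dec t0 (t - h)) as [Hth|Hth].
      - assert (Hm : Phi (t - h) x <= Phi t x).
        { unfold Phi. apply Rmult_le_compat_r. nra. apply Rmult_le_compat_l. lra.
          apply exp_le_mono. unfold K. nra. }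
        destruct (Rle_lt_or_eq_dec 0 h Hh) as [Hh0|Hh0].
        + assert (HWs : W (t - h) x 0 < 0) by (apply Hpast; auto; lra). unfold W in HWs. lra.
        + rewrite <- Hh0. rewrite Rminus_0_r. lra.
      - assert (u (t - h) x <= v (t - h) x); [|lra]. apply Hinit; auto. lra. }
    assert (HPE : del * E <= Phi t x).
    { unfold Phi. fold E. assert (0 < del * E) by nra. nra. }
    unfold K in Ht_le. nra.
Qed.

Lemma heat_at_opp w f t x : heat_at w f t x -> heat_at (fun t x => - w t x) (- f) t x.
Proof.
  intros [w1 [wt [wxx [H1 [H2 [H3 H4]]]]]].
  exists (fun y => - w1 y), (- wt), (- wxx). split; [|split; [|split]].
  - apply is_derive_neg; auto.
  - intros y. apply is_derive_neg; auto.
  - apply is_derive_neg; auto.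
  - lra.
Qed.

Lemma subsol_at_opp v F t x : subsol_at v F t x -> supersol_at (fun t x => - v t x) (- F) t x.
Proof.
  intros [p [q [q1 [dp [d2q [d [Hd [Hp [Hq [Hps [Hqs [Hdp [Hdq [Hd2q HF]]]]]]]]]]]]]].
  exists (fun s => - p s), (fun y => - q y), (fun y => - q1 y), (- dp), (- d2q), d.
  split; [auto|split; [lra|split; [lra|split; [|split; [|split; [|split; [|split; [|lra]]]]]]]].
  - intros s Hs. specialize (Hps s Hs). lra.
  - intros y Hy. specialize (Hqs y Hy). lra.
  - apply is_derive_neg; auto.
  - intros y Hy. apply is_derive_neg; auto.
  - apply is_derive_neg; auto.
Qed.

Lemma comparison_below (u v f F : R -> R -> R) (Dom : R -> Prop) (h L t0 T M : R) :
  0 <= h -> 0 <= L -> closed_dom Dom -> seq_cont t0 u -> seq_cont t0 v ->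
  (forall t x, t0 <= t <= T -> Dom x -> v t x - u t x <= M) ->
  (forall t x, t0 - h <= t <= t0 -> Dom x -> v t x <= u t x) ->
  (forall t x, t0 < t <= T -> Dom x -> v t x <= u t x \/
     (exists d, 0 < d /\ forall y, Rabs (y - x) < d -> Dom y) /\
     heat_at u (f t x) t x /\ subsol_at v (F t x) t x /\
     (forall e, 0 <= e -> v (t - h) x - e <= u (t - h) x -> F t x - L * e <= f t x)) ->
  forall t x, t0 <= t <= T -> Dom x -> v t x <= u t x.
Proof.
  intros Hh HL Hcl Hcu Hcv HM Hinit Hstep t x Ht Hx.
  apply Ropp_le_cancel.
  apply (comparison (fun t x => - u t x) (fun t x => - v t x) (fun t x => - f t x)
           (fun t x => - F t x) Dom h L t0 T M); auto using seq_cont_opp.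
  - intros s y Hs Hy. specialize (HM s y Hs Hy). lra.
  - intros s y Hs Hy. specialize (Hinit s y Hs Hy). lra.
  - intros s y Hs Hy. destruct (Hstep s y Hs Hy) as [H|[H1 [H2 [H3 H4]]]].
    + left; lra.
    + right. repeat split; auto using heat_at_opp, subsol_at_opp.
      intros e He Hle. specialize (H4 e He). lra.
Qed.

(** * The nonlinearity *)

(** Bounds on difference quotients rather than on a derivative: they glue across 0 and [kappa],
    where the linear extensions meet [g], and they make sense where [g] is only Lipschitz. *)
Definition slopes_in (g : R -> R) (a b : R) (lo hi : R) : Prop :=
  forall x y, a <= x -> x <= y -> y <= b -> lo * (y - x) <= g y - g x <= hi * (y - x).

Lemma slopes_glue g a m b lo hi :
  slopes_in g a m lo hi -> slopes_in g m b lo hi -> slopes_in g a b lo hi.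
Proof.
  intros H1 H2 x y Hx Hxy Hy.
  destruct (Rle_lt_dec y m) as [Hym|Hym]. apply H1; auto.
  destruct (Rle_lt_dec m x) as [Hmx|Hmx]. apply H2; auto.
  assert (lo * (m - x) <= g m - g x <= hi * (m - x)) by (apply H1; lra).
  assert (lo * (y - m) <= g y - g m <= hi * (y - m)) by (apply H2; lra).
  nra.
Qed.

Lemma slopes_derive g a b lo hi :
  (forall x, a <= x <= b -> ex_derive g x) -> (forall x, a <= x <= b -> lo <= Derive g x <= hi) ->
  slopes_in g a b lo hi.
Proof.
  intros H1 H2 x y Hx Hxy Hy. destruct (Req_dec x y) as [->|Hn].
  { rewrite !Rminus_diag !Rmult_0_r. lra. }
  destruct (MVT_cor2 g (Derive g) x y) as [z [Hz1 Hz2]]. lra.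
  - intros z Hz. apply is_derive_Reals, Derive_correct, H1. lra.
  - rewrite Hz1. assert (lo <= Derive g z <= hi) by (apply H2; lra). nra.
Qed.

Lemma continuous_near (f : R -> R) (x eps : R) : continuous f x -> 0 < eps ->
  exists d, 0 < d /\ forall y, Rabs (y - x) < d -> Rabs (f y - f x) < eps.
Proof.
  intros H He. specialize (H (ball (f x) (mkposreal _ He)) (locally_ball (f x) (mkposreal _ He))).
  destruct H as [d Hd]. exists d. split. apply cond_pos. intros y Hy. apply (Hd y Hy).
Qed.

Lemma continuous_of_near (f : R -> R) (x : R) :
  (forall eps, 0 < eps -> exists d, 0 < d /\ forall y, Rabs (y - x) < d -> Rabs (f y - f x) < eps) ->
  continuous f x.
Proof.
  intros H P [eps He]. destruct (H eps (cond_pos eps)) as [d [Hd Hy]].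
  exists (mkposreal d Hd). intros y Hb. apply He. apply Hy. exact Hb.
Qed.

Lemma slopes_continuous g L : 0 <= L -> (forall a b, slopes_in g a b 0 L) -> forall x, continuous g x.
Proof.
  intros HL H x. apply continuous_of_near. intros eps He.
  exists (eps / (L + 1)). split. apply Rdiv_lt_0_compat; lra.
  intros y Hy.
  assert (Hb : Rabs (g y - g x) <= L * Rabs (y - x)).
  { destruct (Rle_lt_dec x y) as [Hxy|Hxy].
    - specialize (H x y x y (Rle_refl _) Hxy (Rle_refl _)).
      rewrite !Rabs_pos_eq; lra.
    - specialize (H y x y x (Rle_refl _) (Rlt_le _ _ Hxy) (Rle_refl _)).
      rewrite !Rabs_left1; lra. }
  assert (Hm : (L + 1) * Rabs (y - x) < eps).
  { apply Rmult_lt_reg_r with (/ (L + 1)). apply Rinv_0_lt_compat; lra.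
    replace ((L + 1) * Rabs (y - x) * / (L + 1)) with (Rabs (y - x)) by (field; lra). exact Hy. }
  generalize (Rabs_pos (y - x)). lra.
Qed.

(* [L] bounds all slopes of [g], the slopes near 0 (including those of the linear extension to negative
   arguments) are close to [G0], and those above [kappa - dk] are at most [k < 1]. *)
Record monostable (g : R -> R) (kappa L G0 k dk : R) : Prop := {
  ms_kappa : 0 < kappa;
  ms_0 : g 0 = 0;
  ms_k : g kappa = kappa;
  ms_L : 1 <= L;
  ms_slopes : forall a b, slopes_in g a b 0 L;
  ms_G0 : 1 < G0;
  ms_near0 : forall eps, 0 < eps -> exists d, 0 < d /\ forall a, slopes_in g a d (G0 - eps) (G0 + eps);
  ms_kbd : 0 <= k < 1;
  ms_dk : 0 < dk;
  ms_neark : forall b, slopes_in g (kappa - dk) b 0 k;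
  ms_above : forall x, 0 < x < kappa -> x < g x }.

Arguments ms_kappa {g kappa L G0 k dk}.
Arguments ms_0 {g kappa L G0 k dk}.
Arguments ms_k {g kappa L G0 k dk}.
Arguments ms_L {g kappa L G0 k dk}.
Arguments ms_slopes {g kappa L G0 k dk}.
Arguments ms_G0 {g kappa L G0 k dk}.
Arguments ms_near0 {g kappa L G0 k dk}.
Arguments ms_kbd {g kappa L G0 k dk}.
Arguments ms_dk {g kappa L G0 k dk}.
Arguments ms_neark {g kappa L G0 k dk}.
Arguments ms_above {g kappa L G0 k dk}.

Lemma slopes_weaken g a b lo hi lo' hi' :
  lo' <= lo -> hi <= hi' -> slopes_in g a b lo hi -> slopes_in g a b lo' hi'.
Proof. intros H1 H2 H x y Hx Hxy Hy. specialize (H x y Hx Hxy Hy). nra. Qed.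

(** [k] is the midpoint between [g'(kappa)] and 1, and [g'(kappa) >= 0] by monotonicity; [L] also
    dominates 1 and [g'(0)], the slope of the extension to negative arguments. The inequality
    [x < g x] holds near 0 because [g'(0) > 1], and a later change of sign would produce a third
    fixed point. *)
Lemma hypH_monostable (g : R -> R) (kappa : R) : hypH g kappa ->
  (forall x y, 0 <= x <= y -> g x <= g y) ->
  exists L k dk, monostable g kappa L (Derive g 0) k dk.
Proof.
  intros [Hk [Hpos [Hfix [d0 [Lg [C [th [Hd0 [Hc0 [Hck [HG0 [Hk1 [Hlip [HC [Hth [Hhol [Hlin0 Hlink]]]]]]]]]]]]]]]]] Hmono.
  set (G0 := Derive g 0) in *. set (k0 := Derive g kappa) in *.
  assert (Hg0 : g 0 = 0). { apply Hfix. lra. left; auto. }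
  assert (Hgk : g kappa = kappa). { apply Hfix. lra. right; auto. }
  assert (Hk0 : 0 <= k0).
  { assert (g kappa <= g (kappa + 1)) by (apply Hmono; lra).
    rewrite (Hlink (kappa + 1)) in H; [|lra]. rewrite Hgk in H.
    replace (kappa + k0 * (kappa + 1 - kappa)) with (kappa + k0) in H by ring. lra. }
  assert (Hlow : forall a, slopes_in g a 0 G0 G0).
  { intros a x y Hx Hxy Hy. rewrite !Hlin0; lra. }
  assert (Hhigh : forall b, slopes_in g kappa b k0 k0).
  { intros a x y Hx Hxy Hy. rewrite (Hlink x) ?(Hlink y); lra. }
  set (L := Rmax (Rmax Lg 1) G0).
  assert (HL1 : 1 <= L /\ Lg <= L /\ G0 <= L).
  { unfold L. generalize (Rmax_l (Rmax Lg 1) G0) (Rmax_r (Rmax Lg 1) G0) (Rmax_l Lg 1) (Rmax_r Lg 1). lra. }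
  assert (Hsl : forall a b, slopes_in g a b 0 L).
  { intros a b. apply slopes_glue with 0.
    - apply slopes_weaken with (3 := Hlow a); lra.
    - apply slopes_glue with kappa.
      + intros x y Hx Hxy Hy. assert (g x <= g y) by (apply Hmono; lra).
        assert (HH : Rabs (g y - g x) <= Lg * Rabs (y - x)) by (apply Hlip; lra).
        rewrite (Rabs_pos_eq (y - x)) in HH; [|lra].
        generalize (Rle_abs (g y - g x)). nra.
      + apply slopes_weaken with (3 := Hhigh b); lra. }
  assert (Hnear0 : forall eps, 0 < eps -> exists d, 0 < d /\ forall a, slopes_in g a d (G0 - eps) (G0 + eps)).
  { intros eps He.
    destruct (Hc0 0) as [_ Hc]. { rewrite Rabs_R0; auto. }
    destruct (continuous_near _ _ _ Hc He) as [d [Hd Hy]].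
    assert (Hm : 0 < Rmin d d0) by (apply Rmin_pos; auto).
    exists (Rmin d d0 / 2). split. lra. intros a.
    assert (G1 := Rmin_l d d0). assert (G2 := Rmin_r d d0).
    apply slopes_glue with 0.
    - apply slopes_weaken with (3 := Hlow a); lra.
    - apply slopes_derive.
      + intros x Hx. apply Hc0. rewrite Rabs_pos_eq; lra.
      + intros x Hx. specialize (Hy x). rewrite Rminus_0_r in Hy.
        assert (HH : Rabs (Derive g x - Derive g 0) < eps). { apply Hy. rewrite Rabs_pos_eq; lra. }
        apply Rabs_lt_between in HH. fold G0 in HH. lra. }
  destruct (Hck kappa) as [_ Hc]. { rewrite Rminus_diag Rabs_R0; auto. }
  destruct (continuous_near _ _ ((1 - k0) / 2) Hc) as [dk [Hdk Hyk]]. lra.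
  assert (Hm : 0 < Rmin dk d0) by (apply Rmin_pos; auto).
  assert (G1 := Rmin_l dk d0). assert (G2 := Rmin_r dk d0).
  exists L, ((1 + k0) / 2), (Rmin (Rmin dk d0 / 2) kappa).
  assert (G3 := Rmin_l (Rmin dk d0 / 2) kappa). assert (G4 := Rmin_r (Rmin dk d0 / 2) kappa).
  constructor; auto; try lra.
  - apply Rmin_pos; lra.
  - intros b. apply slopes_glue with kappa.
    + apply slopes_weaken with 0 ((1 + k0) / 2); try lra.
      intros x y Hx Hxy Hy. assert (g x <= g y) by (apply Hmono; lra).
      assert (HH : slopes_in g (kappa - Rmin (Rmin dk d0 / 2) kappa) kappa (-1) ((1 + k0) / 2)).
      { apply slopes_derive.
        - intros z Hz. apply Hck. rewrite Rabs_left1; lra.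
        - intros z Hz. specialize (Hyk z).
          assert (HH : Rabs (Derive g z - Derive g kappa) < (1 - k0) / 2).
          { apply Hyk. rewrite Rabs_left1; lra. }
          apply Rabs_lt_between in HH. fold k0 in HH. lra. }
      specialize (HH x y Hx Hxy Hy). lra.
    + apply slopes_weaken with (3 := Hhigh b); lra.
  - intros x Hx. destruct (Rlt_le_dec x (g x)) as [|Hle]; auto. exfalso.
    destruct (Rle_lt_or_eq_dec _ _ Hle) as [Hlt|Heq].
    2:{ apply Hfix in Heq; lra. }
    destruct (Hnear0 ((G0 - 1) / 2)) as [d [Hd Hs]]. lra.
    set (y := Rmin d x / 2).
    assert (0 < Rmin d x) by (apply Rmin_pos; lra).
    assert (G5 := Rmin_l d x). assert (G6 := Rmin_r d x).
    assert (Hy : y < g y).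
    { specialize (Hs 0 0 y (Rle_refl 0)). rewrite Hg0 in Hs. unfold y in *. nra. }
    destruct (IVT_gen (fun z => g z - z) y x 0) as [z [Hz1 Hz2]].
    + intros z. apply continuity_pt_minus.
      * apply continuity_pt_filterlim. apply (slopes_continuous g L); auto. lra.
      * apply derivable_continuous_pt, derivable_pt_id.
    + rewrite Rmin_right; [|lra]. rewrite Rmax_left; lra.
    + assert (Hyx : y < x) by (unfold y; lra).
      rewrite Rmin_left in Hz1; [|lra]. rewrite Rmax_right in Hz1; [|lra].
      assert (HH : g z = z) by lra. apply Hfix in HH; unfold y in *; lra.
Qed.

(** * Interior estimates *)

(* Doubling of variables: [kappa (2 r - r^2) + kappa (1 - t)] with [r = x - y] is a barrier for
   [u t x - u t y] on [0 <= r <= 1]. *)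
Lemma lipschitz_one_sided (u : R -> R -> R) (kappa T0 : R) :
  0 < kappa -> seq_cont T0 u ->
  (forall t x, T0 <= t -> 0 <= u t x <= kappa) ->
  (forall t x, T0 < t <= T0 + 1 -> exists f, 0 <= f <= kappa /\ heat_at u f t x) ->
  forall x y, 0 <= x - y <= 1 -> u (T0 + 1) x - u (T0 + 1) y <= 2 * kappa * (x - y).
Proof.
  intros Hk Hc Hb Hheat x1 y1 Hr1.
  apply Rnot_lt_le. intros Hlt.
  set (diff := u (T0 + 1) x1 - u (T0 + 1) y1 - 2 * kappa * (x1 - y1)).
  (* The first bound makes the penalty at [x1] no larger than the assumed violation. The second
     closes the final balance: concavity in [r] contributes [- 4 kappa] to the difference of the
     second derivatives, against [kappa] from the time term, [kappa] from the forcings and [2 del]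
     from the penalty. *)
  set (del := Rmin (diff / (1 + x1 * x1)) (kappa / 2)).
  assert (Hdiff : 0 < diff) by (unfold diff; lra).
  assert (Hx1 : 0 < 1 + x1 * x1) by nra.
  assert (Hdel : 0 < del).
  { unfold del. apply Rmin_pos; [|lra]. apply Rdiv_lt_0_compat; lra. }
  assert (Hdel1 : del * (1 + x1 * x1) <= diff).
  { unfold del. apply Rle_trans with (diff / (1 + x1 * x1) * (1 + x1 * x1)).
    apply Rmult_le_compat_r. lra. apply Rmin_l. right. field. lra. }
  assert (Hdel2 : del <= kappa / 2) by apply Rmin_r.
  set (Psi := fun t x y : R => kappa * (2 * (x - y) - (x - y) * (x - y)) + kappa * (1 - (t - T0))
                               + del * (1 + x * x)).
  set (W := fun t x y => u t x - u t y - Psi t x y).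
  destruct (first_touch W (fun x y => 0 <= x - y <= 1) T0 (T0 + 1) (kappa / del + 2)) as [Hneg|Hcon].
  - intros xn yn x y Hn Hx Hy.
    assert (Hxy : is_lim_seq (fun n => xn n - yn n) (x - y)) by (apply is_lim_seq_minus'; auto).
    split.
    + apply (is_lim_seq_le (fun _ => 0) (fun n => xn n - yn n) 0 (x - y)); auto.
      intros n; apply Hn. apply is_lim_seq_const.
    + apply (is_lim_seq_le (fun n => xn n - yn n) (fun _ => 1) (x - y) 1); auto.
      intros n; apply Hn. apply is_lim_seq_const.
  - intros tn xn yn t x y Htn Ht _ _ Lt Lx Ly. unfold W.
    apply is_lim_seq_minus'.
    + apply is_lim_seq_minus'; apply Hc; auto; try (intros n; apply Htn); apply Ht.
    + unfold Psi.
      assert (Lxy : is_lim_seq (fun n => xn n - yn n) (x - y)) by (apply is_lim_seq_minus'; auto).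
      apply is_lim_seq_plus'. apply is_lim_seq_plus'.
      * apply (is_lim_seq_ex_derive (fun r => kappa * (2 * r - r * r)) _ (x - y)); auto.
        auto_derive; auto.
      * apply (is_lim_seq_ex_derive (fun t => kappa * (1 - (t - T0)))); auto. auto_derive; auto.
      * apply (is_lim_seq_ex_derive (fun x => del * (1 + x * x))); auto. auto_derive; auto.
  - intros x y Hxy. unfold W, Psi.
    assert (H1 := Hb T0 x (Rle_refl _)). assert (H2 := Hb T0 y (Rle_refl _)).
    assert (0 <= kappa * (2 * (x - y) - (x - y) * (x - y))) by (apply Rmult_le_pos; nra).
    assert (0 < del * (1 + x * x)) by (apply Rmult_lt_0_compat; nra).
    rewrite Rminus_diag. lra.
  - intros t x y Ht Hxy Hfar. unfold W, Psi.
    assert (H1 := Hb t x (proj1 Ht)). assert (H2 := Hb t y (proj1 Ht)).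
    assert (0 <= kappa * (2 * (x - y) - (x - y) * (x - y))) by (apply Rmult_le_pos; nra).
    assert (0 <= kappa * (1 - (t - T0))) by (apply Rmult_le_pos; lra).
    assert (Hkd : 0 < kappa / del) by (apply Rdiv_lt_0_compat; auto).
    assert (HX : kappa / del + 1 < Rabs x).
    { destruct Hfar as [Hf|Hf]. lra.
      assert (Rabs y <= Rabs x + 1); [|lra].
      replace y with (x + - (x - y)) by ring.
      apply Rle_trans with (1 := Rabs_triang _ _). rewrite Rabs_Ropp (Rabs_pos_eq (x - y)); lra. }
    assert (Hxx : x * x = Rabs x * Rabs x). { rewrite <- Rabs_mult. rewrite Rabs_pos_eq; nra. }
    assert (kappa < del * (1 + x * x)); [|lra].
    assert (kappa = del * (kappa / del)) by (field; lra).
    assert (kappa / del < Rabs x * Rabs x) by nra.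
    assert (del * (kappa / del) < del * (1 + x * x)); [|lra].
    apply Rmult_lt_compat_l; lra.
  - specialize (Hneg (T0 + 1) x1 y1). unfold W, Psi in Hneg.
    assert (HH := Hneg ltac:(lra) Hr1). unfold diff in Hdel1.
    assert (0 <= kappa * ((x1 - y1) * (x1 - y1))) by (apply Rmult_le_pos; nra). lra.
  - destruct Hcon as [t [x [y [Ht [Hxy [HW [Hpast Hnow]]]]]]].
    unfold W, Psi in HW.
    assert (Ht' : T0 <= t) by lra.
    assert (H1 := Hb t x Ht'). assert (H2 := Hb t y Ht').
    assert (Hp1 : 0 <= kappa * (1 - (t - T0))) by (apply Rmult_le_pos; lra).
    assert (Hp2 : 0 < del * (1 + x * x)) by (apply Rmult_lt_0_compat; nra).
    assert (Hr0 : x - y <> 0).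
    { intros E. assert (x = y) by lra. subst y. rewrite E in HW. lra. }
    assert (Hr1' : x - y <> 1). { intros E. rewrite E in HW. lra. }
    destruct (Hheat t x Ht) as [f1 [Hf1 [u1 [ut [uxx [Hut [Hu1 [Huxx Heq]]]]]]]].
    destruct (Hheat t y Ht) as [f2 [Hf2 [v1 [vt [vxx [Hvt [Hv1 [Hvxx Heq2]]]]]]]].
    assert (Et : 0 <= ut - vt - (- kappa)).
    { apply (left_max_derive (fun s => u s x - u s y - Psi s x y) t _ (t - T0)). lra.
      - apply is_derive_sub. apply is_derive_sub; auto. unfold Psi. auto_derive; auto. ring.
      - intros s Hs. assert (HWs : W s x y < 0) by (apply Hpast; lra). unfold W in HWs.
        unfold Psi at 2. lra. }
    set (d := Rmin (x - y) (1 - (x - y))).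
    assert (Hd : 0 < d) by (apply Rmin_pos; lra).
    assert (D1 : d <= x - y) by apply Rmin_l. assert (D2 : d <= 1 - (x - y)) by apply Rmin_r.
    assert (Ex : uxx - 0 - (- 2 * kappa + 2 * del) <= 0).
    { apply (local_max_derive2 (fun z => u t z - u t y - Psi t z y)
         (fun z => u1 z - 0 - (kappa * (2 - 2 * (z - y)) + del * (2 * z))) x _ d Hd).
      - intros z Hz. apply is_derive_sub. apply is_derive_sub; auto.
        apply (is_derive_const (u t y) z).
        unfold Psi. auto_derive; auto. ring.
      - apply is_derive_sub. apply is_derive_sub; auto. apply (is_derive_const 0 x).
        auto_derive; auto. ring.
      - intros z Hz. apply Rabs_lt_between in Hz.
        assert (HWs : W t z y <= 0) by (apply Hnow; lra). unfold W in HWs. unfold Psi at 2. lra. }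
    assert (Ey : 0 - vxx - (- 2 * kappa) <= 0).
    { apply (local_max_derive2 (fun z => u t x - u t z - Psi t x z)
         (fun z => 0 - v1 z - (kappa * (- 2 + 2 * (x - z)))) y _ d Hd).
      - intros z Hz. apply is_derive_sub. apply is_derive_sub; auto.
        apply (is_derive_const (u t x) z).
        unfold Psi. auto_derive; auto. ring.
      - apply is_derive_sub. apply is_derive_sub; auto. apply (is_derive_const 0 y).
        auto_derive; auto. ring.
      - intros z Hz. apply Rabs_lt_between in Hz.
        assert (HWs : W t x z <= 0) by (apply Hnow; lra). unfold W in HWs. unfold Psi at 2. lra. }
    assert (0 <= kappa * (2 * (x - y) - (x - y) * (x - y))) by (apply Rmult_le_pos; nra).
    lra.
Qed.

Lemma heat_at_const_minus w f t x k : heat_at w f t x -> heat_at (fun t x => k - w t x) (k - f) t x.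
Proof.
  intros [w1 [wt [wxx [H1 [H2 [H3 H4]]]]]].
  exists (fun y => 0 - w1 y), (0 - wt), (0 - wxx). split; [|split; [|split]].
  - apply is_derive_sub; auto. apply (is_derive_const k t).
  - intros y. apply is_derive_sub; auto. apply (is_derive_const k y).
  - apply is_derive_sub; auto. apply (is_derive_const 0 x).
  - lra.
Qed.

Lemma seq_cont_const t0 k : seq_cont t0 (fun _ _ => k).
Proof. intros tn xn t x _ _ _ _. apply is_lim_seq_const. Qed.

(** The opposite sign is the one-sided estimate for [kappa - u], which solves an equation of the
    same type with forcing [kappa - f], again in [[0, kappa]]. *)
Lemma lipschitz_in_space (u : R -> R -> R) (kappa T0 : R) :
  0 < kappa -> seq_cont T0 u ->
  (forall t x, T0 <= t -> 0 <= u t x <= kappa) ->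
  (forall t x, T0 < t <= T0 + 1 -> exists f, 0 <= f <= kappa /\ heat_at u f t x) ->
  forall x y, Rabs (x - y) <= 1 -> Rabs (u (T0 + 1) x - u (T0 + 1) y) <= 2 * kappa * Rabs (x - y).
Proof.
  intros Hk Hc Hb Hheat.
  assert (Hw : forall x y, 0 <= x - y <= 1 -> Rabs (u (T0 + 1) x - u (T0 + 1) y) <= 2 * kappa * Rabs (x - y)).
  { intros x y Hxy. rewrite (Rabs_pos_eq (x - y)); [|lra]. apply Rabs_le. split.
    - assert (HH := lipschitz_one_sided (fun t x => kappa - u t x) kappa T0 Hk).
      assert (HH1 : kappa - u (T0 + 1) x - (kappa - u (T0 + 1) y) <= 2 * kappa * (x - y)); [|lra].
      apply HH; auto.
      + apply seq_cont_minus; auto. apply seq_cont_const.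
      + intros t z Ht. specialize (Hb t z Ht). lra.
      + intros t z Ht. destruct (Hheat t z Ht) as [f [Hf1 Hf2]]. exists (kappa - f).
        split. lra. apply heat_at_const_minus; auto.
    - apply lipschitz_one_sided; auto. }
  intros x y Hxy. destruct (Rle_lt_dec y x).
  - apply Hw. rewrite Rabs_pos_eq in Hxy; lra.
  - rewrite (Rabs_minus_sym x y) (Rabs_minus_sym (u (T0 + 1) x)). apply Hw.
    rewrite Rabs_left in Hxy; lra.
Qed.

(** * Moving bumps: a quantitative strong maximum principle *)

(** With [tau = 1 - xi^2] the second derivative inside the support is [8 - 12 tau], positive near
    the edge thanks to the square. There it absorbs the drift term, which is of order [tau] and out
    of reach for the amplitude decay, of order [tau^2]. At the edge itself no derivative is ever
    taken. *)
Definition bump (xi : R) : R := (Rmax 0 (1 - xi * xi)) ^ 2.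

Lemma bump_in xi : Rabs xi <= 1 -> bump xi = (1 - xi * xi) ^ 2.
Proof.
  intros H. unfold bump. rewrite Rmax_right; auto.
  apply Rabs_le_between in H. nra.
Qed.

Lemma bump_out xi : 1 <= Rabs xi -> bump xi = 0.
Proof.
  intros H. unfold bump. rewrite Rmax_left. ring.
  assert (xi * xi = Rabs xi * Rabs xi). { rewrite <- Rabs_mult. rewrite Rabs_pos_eq; nra. }
  nra.
Qed.

Lemma bump_bounds xi : 0 <= bump xi <= 1.
Proof.
  unfold bump. assert (0 <= Rmax 0 (1 - xi * xi)) by apply Rmax_l.
  assert (Rmax 0 (1 - xi * xi) <= 1). { apply Rmax_lub; nra. }
  simpl. nra.
Qed.

Lemma Rmax0_continuous x : continuous (fun y => Rmax 0 y) x.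
Proof.
  apply continuous_of_near. intros eps He. exists eps. split; auto.
  intros y Hy. apply Rle_lt_trans with (2 := Hy). unfold Rmax.
  destruct (Rle_dec 0 y); destruct (Rle_dec 0 x); unfold Rabs; repeat destruct Rcase_abs; lra.
Qed.

Lemma bump_continuous xi : continuous bump xi.
Proof.
  unfold bump.
  apply (continuous_comp (fun xi => Rmax 0 (1 - xi * xi)) (fun y => y ^ 2)).
  - apply (continuous_comp (fun xi => 1 - xi * xi) (fun y => Rmax 0 y)).
    + apply (ex_derive_continuous (fun xi => 1 - xi * xi)). auto_derive; auto.
    + apply Rmax0_continuous.
  - apply (ex_derive_continuous (fun y => y ^ 2)). auto_derive; auto.
Qed.

(** The left side is [e^{K t} (P_t - P_xx + P)] for [P = e^{- K t} bump], where the bump has radius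
    [r] and moves with speed [s]. It is at most [- (K - 1) tau^2 + b tau - a], and
    [K - 1 = b^2 / (4 a)] turns this into minus a square. *)
Lemma spread_rate (r S : R) : 0 < r -> 0 <= S -> exists K, 0 <= K /\
  forall s xi, Rabs s <= S -> Rabs xi <= 1 ->
  - K * (1 - xi * xi) ^ 2 + s / r * (4 * xi * (1 - xi * xi)) - (8 - 12 * (1 - xi * xi)) / (r * r)
  + (1 - xi * xi) ^ 2 <= 0.
Proof.
  intros Hr HS.
  set (a := 8 / (r * r)). set (b := 4 * S / r + 12 / (r * r)).
  assert (Ha : 0 < a). { unfold a. apply Rdiv_lt_0_compat; nra. }
  exists (1 + b * b / (4 * a)). split.
  { assert (0 <= b * b / (4 * a)); [|lra]. apply Rmult_le_pos. nra. left; apply Rinv_0_lt_compat; lra. }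
  intros s xi Hs Hxi.
  set (tau := 1 - xi * xi).
  assert (Htau : 0 <= tau) by (unfold tau; apply Rabs_le_between in Hxi; nra).
  assert (H1 : s / r * (4 * xi * tau) <= 4 * S / r * tau).
  { replace (s / r * (4 * xi * tau)) with (4 * / r * tau * (s * xi)) by (field; lra).
    replace (4 * S / r * tau) with (4 * / r * tau * S) by (field; lra).
    apply Rmult_le_compat_l.
    - apply Rmult_le_pos; auto. assert (0 < / r) by (apply Rinv_0_lt_compat; auto). lra.
    - apply Rle_trans with (1 := Rle_abs _). rewrite Rabs_mult.
      generalize (Rabs_pos s) (Rabs_pos xi). nra. }
  assert (H2 : (8 - 12 * tau) / (r * r) = a - 12 / (r * r) * tau) by (unfold a; field; lra).
  rewrite H2.
  assert (H3 : b * b / (4 * a) * tau ^ 2 - b * tau + a = (b * tau / 2 - a) ^ 2 / a) by (field; lra).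
  assert (H4 : 0 <= (b * tau / 2 - a) ^ 2 / a).
  { apply Rmult_le_pos. apply pow2_ge_0. left; apply Rinv_0_lt_compat; auto. }
  assert (H5 : b * tau = 4 * S / r * tau + 12 / (r * r) * tau) by (unfold b; ring).
  set (B := b * b / (4 * a)) in *. clearbody B b a. lra.
Qed.

(* Barrier: [m e^{-K (t - t0)} bump ((y - x0 - s (t - t0)) / r) - N], a bump moving with the constant speed
   [s] that takes it from [x0] to [x]. *)
Lemma spread (r S : R) : 0 < r -> 0 <= S -> exists K, 0 <= K /\
  forall (w F : R -> R -> R) (t0 t1 x0 m N : R), 0 <= m -> 0 <= N -> seq_cont t0 w ->
  (forall t x, t0 <= t <= t1 -> Rabs (x - x0) <= r + S * (t1 - t0) -> - N <= w t x) ->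
  (forall t x, t0 < t <= t1 -> Rabs (x - x0) <= r + S * (t1 - t0) ->
     heat_at w (F t x) t x /\ - N <= F t x) ->
  (forall x, Rabs (x - x0) <= r -> m <= w t0 x) ->
  forall x, t0 < t1 -> Rabs (x - x0) <= S * (t1 - t0) -> m * exp (- K * (t1 - t0)) - N <= w t1 x.
Proof.
  intros Hr HS. destruct (spread_rate r S Hr HS) as [K [HK Hrate]].
  exists K. split; auto.
  intros w F t0 t1 x0 m N Hm HN Hcw Hlow Hheat Hinit x Ht Hx.
  set (s := (x - x0) / (t1 - t0)).
  assert (Hs : Rabs s <= S).
  { unfold s, Rdiv. rewrite Rabs_mult (Rabs_pos_eq (/ (t1 - t0))).
    2:{ left; apply Rinv_0_lt_compat; lra. }
    apply Rmult_le_reg_r with (t1 - t0). lra. rewrite Rmult_assoc Rinv_l; lra. }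
  set (xi := fun t y => (y - x0 - s * (t - t0)) / r).
  set (v := fun t y => m * exp (- K * (t - t0)) * bump (xi t y) - N).
  assert (Hcv : seq_cont t0 v).
  { intros tn xn t y _ _ Lt Ly. unfold v. apply is_lim_seq_minus'; [|apply is_lim_seq_const].
    apply is_lim_seq_mult'.
    - apply (is_lim_seq_ex_derive (fun t => m * exp (- K * (t - t0)))); auto. auto_derive; auto.
    - apply is_lim_seq_continuous_at. apply bump_continuous. unfold xi.
      apply is_lim_seq_div'; [|apply is_lim_seq_const|lra].
      apply is_lim_seq_minus'. apply is_lim_seq_minus'; auto. apply is_lim_seq_const.
      apply (is_lim_seq_ex_derive (fun t => s * (t - t0))); auto. auto_derive; auto. }
  assert (Hv1 : v t1 x = m * exp (- K * (t1 - t0)) - N).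
  { unfold v, xi. replace (x - x0 - s * (t1 - t0)) with 0 by (unfold s; field; lra).
    unfold Rdiv. rewrite Rmult_0_l. rewrite bump_in. ring. rewrite Rabs_R0; lra. }
  rewrite <- Hv1.
  assert (Hexp : forall t, t0 <= t -> 0 < exp (- K * (t - t0)) <= 1).
  { intros t Htt. split. apply exp_pos. rewrite <- exp_0. apply exp_le_mono. nra. }
  (* Delay 0 and slope constant 0: [F] serves as forcing for both functions, so the link is trivial,
     and the barrier only has to be a subsolution for the smaller forcing [- N]. *)
  apply (comparison_below w v F F (fun y => Rabs (y - x0) <= r + S * (t1 - t0)) 0 0 t0 t1 m); auto; try lra.
  - intros xn y Hn Hy.
    apply (is_lim_seq_le (fun n => Rabs (xn n - x0)) (fun _ => r + S * (t1 - t0))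
             (Rabs (y - x0)) (r + S * (t1 - t0))); auto.
    + apply (is_lim_seq_abs _ (y - x0)). apply is_lim_seq_minus'; auto. apply is_lim_seq_const.
    + apply is_lim_seq_const.
  - intros t y Ht1 Hy. specialize (Hlow t y Ht1 Hy). unfold v.
    generalize (bump_bounds (xi t y)) (Hexp t (proj1 Ht1)). intros.
    assert (m * exp (- K * (t - t0)) <= m) by nra.
    assert (0 <= m * exp (- K * (t - t0))) by nra. nra.
  - intros t y Ht1 Hy. replace t with t0 by lra. unfold v.
    generalize (bump_bounds (xi t0 y)). intros.
    rewrite Rminus_diag Rmult_0_r exp_0.
    destruct (Rle_lt_dec (Rabs (y - x0)) r) as [Hyr|Hyr].
    + specialize (Hinit y Hyr). nra.
    + rewrite bump_out. specialize (Hlow t0 y). assert (- N <= w t0 y) by (apply Hlow; lra). lra.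
      unfold xi. rewrite Rminus_diag Rmult_0_r Rminus_0_r. unfold Rdiv. rewrite Rabs_mult.
      rewrite (Rabs_pos_eq (/ r)). 2:{ left; apply Rinv_0_lt_compat; lra. }
      apply Rmult_le_reg_r with r; auto. rewrite Rmult_assoc Rinv_l; lra.
  - intros t y Ht1 Hy.
    destruct (Rle_lt_dec 1 (Rabs (xi t y))) as [Hxi|Hxi].
    { left. unfold v. rewrite bump_out; auto. assert (- N <= w t y) by (apply Hlow; lra). lra. }
    right.
    destruct (Hheat t y Ht1 Hy) as [Hh HF].
    assert (Hxr : Rabs (y - x0 - s * (t - t0)) < r).
    { unfold xi, Rdiv in Hxi. rewrite Rabs_mult (Rabs_pos_eq (/ r)) in Hxi.
      2:{ left; apply Rinv_0_lt_compat; lra. }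
      apply Rmult_lt_reg_r with (/ r). apply Rinv_0_lt_compat; auto. rewrite Rinv_r; lra. }
    assert (Hst : Rabs (s * (t - t0)) <= S * (t1 - t0)).
    { rewrite Rabs_mult (Rabs_pos_eq (t - t0)); [|lra]. generalize (Rabs_pos s). nra. }
    split; [|split; [auto|split; [|intros; lra]]].
    { exists (r - Rabs (y - x0 - s * (t - t0))). split. lra. intros z Hz.
      replace (z - x0) with ((z - y) + (y - x0 - s * (t - t0)) + s * (t - t0)) by ring.
      apply Rle_trans with (1 := Rabs_triang _ _).
      generalize (Rabs_triang (z - y) (y - x0 - s * (t - t0))). lra. }
    set (q := fun z => m * exp (- K * (t - t0)) * (1 - xi t z * xi t z) ^ 2 - N).
    set (p := fun z => m * exp (- K * (z - t0)) * (1 - xi z y * xi z y) ^ 2 - N).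
    set (tau := 1 - xi t y * xi t y).
    set (d := (r - Rabs (y - x0 - s * (t - t0))) / (S + 1)).
    assert (Hd : 0 < d) by (apply Rdiv_lt_0_compat; lra).
    assert (Hd1 : d * (S + 1) = r - Rabs (y - x0 - s * (t - t0))) by (unfold d; field; lra).
    assert (Hxi_le : forall a b, Rabs (b - x0 - s * (a - t0)) <= r -> Rabs (xi a b) <= 1).
    { intros a b Hab. unfold xi, Rdiv. rewrite Rabs_mult (Rabs_pos_eq (/ r)).
      2:{ left; apply Rinv_0_lt_compat; lra. }
      apply Rmult_le_reg_r with r; auto. rewrite Rmult_assoc Rinv_l; lra. }
    exists p, q, (fun z => m * exp (- K * (t - t0)) * (2 * (1 - xi t z * xi t z) * (- 2 * xi t z / r))),
      (m * exp (- K * (t - t0)) * (- K * tau ^ 2 + s / r * (4 * xi t y * tau))),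
      (m * exp (- K * (t - t0)) * ((8 - 12 * tau) / (r * r) * -1 * -1)), d.
    split; [auto|]. split. { unfold p, v. rewrite bump_in; lra. }
    split. { unfold q, v. rewrite bump_in; lra. }
    split.
    { intros z Hz. unfold p, v. rewrite bump_in. lra. apply Hxi_le.
      replace (y - x0 - s * (z - t0)) with ((y - x0 - s * (t - t0)) + s * (t - z)) by ring.
      apply Rle_trans with (1 := Rabs_triang _ _). rewrite (Rabs_mult s) (Rabs_pos_eq (t - z)); [|lra].
      generalize (Rabs_pos s). nra. }
    split.
    { intros z Hz. unfold q, v. rewrite bump_in. lra. apply Hxi_le.
      replace (z - x0 - s * (t - t0)) with ((y - x0 - s * (t - t0)) + (z - y)) by ring.
      apply Rle_trans with (1 := Rabs_triang _ _). nra. }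
    split.
    { unfold p, xi. auto_derive; auto. unfold tau, xi. unfold Rminus. field. lra. }
    split.
    { intros z _. unfold q, xi. auto_derive; auto. unfold Rminus. field. lra. }
    split.
    { unfold xi. auto_derive; auto. unfold tau, xi. unfold Rminus. field. lra. }
    unfold v. rewrite bump_in; [|lra]. fold tau.
    specialize (Hrate s (xi t y) Hs ltac:(lra)). fold tau in Hrate.
    generalize (Hexp t ltac:(lra)). intros He.
    assert (0 <= m * exp (- K * (t - t0))) by nra. nra.
Qed.

(** * The profile equation [y'' - c y' - y + f = 0] *)

(** [nup] and [nun] are the roots of [z^2 - c z - 1], the exponents of the homogeneous profile
    equation. Their product is -1, so they have opposite signs and 0 is the only bounded homogeneous
    solution. *)
Definition nup (c : R) : R := (c + sqrt (c * c + 4)) / 2.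
Definition nun (c : R) : R := (c - sqrt (c * c + 4)) / 2.

Lemma nu_sum c : nup c + nun c = c.
Proof. unfold nup, nun. field. Qed.

Lemma nu_prod c : nup c * nun c = -1.
Proof.
  unfold nup, nun. assert (H : sqrt (c * c + 4) * sqrt (c * c + 4) = c * c + 4) by (apply sqrt_sqrt; nra).
  nra.
Qed.

Lemma nu_sign c : nun c < 0 < nup c.
Proof.
  assert (H0 : 0 <= sqrt (c * c + 4)) by apply sqrt_pos.
  assert (H : sqrt (c * c + 4) * sqrt (c * c + 4) = c * c + 4) by (apply sqrt_sqrt; nra).
  unfold nup, nun. split; nra.
Qed.

Lemma derive_nonpos_decr (P P1 : R -> R) a b : a <= b ->
  (forall z, a <= z <= b -> is_derive P z (P1 z)) -> (forall z, a <= z <= b -> P1 z <= 0) ->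
  P b <= P a.
Proof.
  intros [Hab| ->] H H1; [|lra].
  destruct (MVT_cor2 P P1 a b Hab) as [z [Hz1 Hz2]].
  - intros z Hz. apply is_derive_Reals; auto.
  - assert (P1 z <= 0) by (apply H1; lra). nra.
Qed.

Lemma is_derive_mul_exp (p : R -> R) (a z dp : R) : is_derive p z dp ->
  is_derive (fun z => p z * exp (a * z)) z ((dp + a * p z) * exp (a * z)).
Proof.
  intros H. apply is_derive_eq with (dp * exp (a * z) + p z * (a * exp (a * z))); [|ring].
  apply (is_derive_mul p (fun z => exp (a * z))); auto. auto_derive; auto. ring.
Qed.

Lemma exp_small (a eps z : R) : 0 < a -> 0 < eps -> exists w, w <= z /\ exp (a * w) < eps.
Proof.
  intros Ha He. exists (Rmin z (ln (eps / 2) / a)). split. apply Rmin_l.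
  apply Rle_lt_trans with (exp (a * (ln (eps / 2) / a))).
  - apply exp_le_mono. apply Rmult_le_compat_l. lra. apply Rmin_r.
  - replace (a * (ln (eps / 2) / a)) with (ln (eps / 2)) by (field; lra). rewrite exp_ln; lra.
Qed.

(** [p e^{- a z}] is nonincreasing, and since [- a > 0] the bound [M e^{- a w}] on its value at [w]
    tends to 0 as [w -> -oo]. *)
Lemma first_order_nonpos (p f : R -> R) (a M : R) : a < 0 ->
  (forall z : R, is_derive p z (a * p z - f z)) -> (forall z, 0 <= f z) -> (forall z, p z <= M) ->
  forall z, p z <= 0.
Proof.
  intros Ha Hp Hf HM z. apply Rnot_lt_le. intros Hz.
  assert (HP : 0 < p z * exp (- a * z)) by (apply Rmult_lt_0_compat; auto; apply exp_pos).
  assert (HMpos : 0 < M) by (specialize (HM z); lra).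
  destruct (exp_small (- a) (p z * exp (- a * z) / M) z) as [w [Hw1 Hw2]]. lra.
  { apply Rdiv_lt_0_compat; auto. }
  assert (p z * exp (- a * z) <= p w * exp (- a * w)).
  { apply (derive_nonpos_decr (fun z => p z * exp (- a * z))
             (fun z => (a * p z - f z + - a * p z) * exp (- a * z)) w z Hw1).
    - intros y _. apply is_derive_mul_exp. auto.
    - intros y _. generalize (exp_pos (- a * y)) (Hf y). nra. }
  assert (p w * exp (- a * w) <= M * exp (- a * w)).
  { apply Rmult_le_compat_r; auto. left; apply exp_pos. }
  assert (M * exp (- a * w) < p z * exp (- a * z)); [|lra].
  replace (p z * exp (- a * z)) with (M * (p z * exp (- a * z) / M)) by (field; lra).
  apply Rmult_lt_compat_l; auto.
Qed.

Lemma first_order_nonneg (p f : R -> R) (a M : R) : 0 < a ->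
  (forall z : R, is_derive p z (a * p z - f z)) -> (forall z, 0 <= f z) -> (forall z, - M <= p z) ->
  forall z, 0 <= p z.
Proof.
  intros Ha Hp Hf HM z.
  assert (H : - p (-1 * - z + 0) <= 0).
  { apply (first_order_nonpos (fun y => - p (-1 * y + 0)) (fun y => f (-1 * y + 0)) (- a) M) with (z := - z);
      auto; try lra.
    - intros y. apply is_derive_eq with (- (-1 * (a * p (-1 * y + 0) - f (-1 * y + 0)))); [|ring].
      apply is_derive_neg, is_derive_comp_lin. auto.
    - intros y. specialize (HM (-1 * y + 0)). lra. }
  replace (-1 * - z + 0) with z in H by ring. lra.
Qed.

Definition bounded_fun (y : R -> R) : Prop := exists M, forall z, Rabs (y z) <= M.

(** Boundedness of [y] and of its derivative is part of the definition: it selects one solution and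
    makes comparison hold on the whole line without boundary conditions. *)
Definition sol (c : R) (f y y1 : R -> R) : Prop :=
  (forall z : R, is_derive y z (y1 z)) /\ (forall z : R, is_derive y1 z (c * y1 z + y z - f z)) /\
  bounded_fun y /\ bounded_fun y1.

Lemma sol_continuous c f y y1 : sol c f y y1 -> forall z, continuous y z.
Proof. intros [H _] z. apply (ex_derive_continuous y z). eexists; apply H. Qed.

Lemma bounded_lin (y w : R -> R) a b : bounded_fun y -> bounded_fun w -> bounded_fun (fun z => a * y z + b * w z).
Proof.
  intros [M HM] [N HN]. exists (Rabs a * M + Rabs b * N). intros z.
  apply Rle_trans with (1 := Rabs_triang _ _). rewrite !Rabs_mult.
  generalize (HM z) (HN z) (Rabs_pos a) (Rabs_pos b). nra.
Qed.

Lemma sol_lin c f g y y1 w w1 a b : sol c f y y1 -> sol c g w w1 ->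
  sol c (fun z => a * f z + b * g z) (fun z => a * y z + b * w z) (fun z => a * y1 z + b * w1 z).
Proof.
  intros [H1 [H2 [H3 H4]]] [K1 [K2 [K3 K4]]]. split; [|split; [|split]].
  - intros z. apply is_derive_add; apply is_derive_cmul; auto.
  - intros z. apply is_derive_eq with (a * (c * y1 z + y z - f z) + b * (c * w1 z + w z - g z)); [|ring].
    apply is_derive_add; apply is_derive_cmul; auto.
  - apply bounded_lin; auto.
  - apply bounded_lin; auto.
Qed.

(** The operator factors as [(D - nup)(D - nun)]: [y1 - nun y] and [y1 - nup y] are bounded and
    solve first-order equations with rates [nup] and [nun] and forcing [- f], so each has a sign.
    This is a Harnack inequality in differential form; as [nun < nup], it also contains [y >= 0]. *)
Lemma sol_harnack c f y y1 : sol c f y y1 -> (forall z, 0 <= f z) ->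
  forall z, nun c * y z <= y1 z <= nup c * y z.
Proof.
  intros [H1 [H2 [H3 H4]]] Hf z.
  assert (Hs := nu_sum c). assert (Hp := nu_prod c). assert (Hsg := nu_sign c).
  split.
  - destruct (bounded_lin y1 y 1 (- nun c) H4 H3) as [M HM].
    assert (0 <= 1 * y1 z + - nun c * y z); [|lra].
    apply (first_order_nonneg (fun z => 1 * y1 z + - nun c * y z) f (nup c) M); auto; try lra.
    + intros w. apply is_derive_eq with (1 * (c * y1 w + y w - f w) + - nun c * y1 w).
      * apply is_derive_add; apply is_derive_cmul; auto.
      * rewrite <- Hs at 1. replace (nup c * (1 * y1 w + - nun c * y w)) with
          (nup c * y1 w - nup c * nun c * y w) by ring. rewrite Hp. ring.
    + intros w. specialize (HM w). apply Rabs_le_between in HM. lra.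
  - destruct (bounded_lin y1 y 1 (- nup c) H4 H3) as [M HM].
    assert (1 * y1 z + - nup c * y z <= 0); [|lra].
    apply (first_order_nonpos (fun z => 1 * y1 z + - nup c * y z) f (nun c) M); auto; try lra.
    + intros w. apply is_derive_eq with (1 * (c * y1 w + y w - f w) + - nup c * y1 w).
      * apply is_derive_add; apply is_derive_cmul; auto.
      * rewrite <- Hs at 1. replace (nun c * (1 * y1 w + - nup c * y w)) with
          (nun c * y1 w - nup c * nun c * y w) by ring. rewrite Hp. ring.
    + intros w. specialize (HM w). apply Rabs_le_between in HM. lra.
Qed.

Lemma sol_nonneg c f y y1 : sol c f y y1 -> (forall z, 0 <= f z) -> forall z, 0 <= y z.
Proof.
  intros H Hf z. generalize (sol_harnack c f y y1 H Hf z) (nu_sign c). nra.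
Qed.

Lemma sol_le c f g y y1 w w1 : sol c f y y1 -> sol c g w w1 -> (forall z, f z <= g z) ->
  forall z, y z <= w z.
Proof.
  intros H1 H2 Hfg z.
  assert (0 <= 1 * w z + -1 * y z); [|lra].
  apply (sol_nonneg c _ _ _ (sol_lin c g f w w1 y y1 1 (-1) H2 H1)).
  intros t. specialize (Hfg t). lra.
Qed.

(** Integrated Harnack bounds. The second one controls values to the left of a given point, which is
    what delayed arguments require. *)
Lemma sol_grow c f y y1 : sol c f y y1 -> (forall z, 0 <= f z) ->
  forall a b, a <= b -> y b <= y a * exp (nup c * (b - a)) /\ y a <= y b * exp (- nun c * (b - a)).
Proof.
  intros H Hf a b Hab. assert (Hh := sol_harnack c f y y1 H Hf).
  destruct H as [H1 _]. split.
  - assert (HH : y b * exp (- nup c * b) <= y a * exp (- nup c * a)).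
    { apply (derive_nonpos_decr (fun z => y z * exp (- nup c * z))
               (fun z => (y1 z + - nup c * y z) * exp (- nup c * z)) a b Hab).
      - intros z _. apply is_derive_mul_exp; auto.
      - intros z _. generalize (Hh z) (exp_pos (- nup c * z)). nra. }
    apply Rmult_le_reg_r with (exp (- nup c * b)). apply exp_pos.
    rewrite Rmult_assoc -exp_plus. replace (nup c * (b - a) + - nup c * b) with (- nup c * a) by ring. auto.
  - assert (HH : (- y b) * exp (- nun c * b) <= (- y a) * exp (- nun c * a)).
    { apply (derive_nonpos_decr (fun z => (- y z) * exp (- nun c * z))
               (fun z => (- y1 z + - nun c * - y z) * exp (- nun c * z)) a b Hab).
      - intros z _. apply (is_derive_mul_exp (fun z => - y z)). apply is_derive_neg; auto.
      - intros z _. generalize (Hh z) (exp_pos (- nun c * z)). nra. }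
    apply Rmult_le_reg_r with (exp (- nun c * a)). apply exp_pos.
    rewrite Rmult_assoc -exp_plus. replace (- nun c * (b - a) + - nun c * a) with (- nun c * b) by ring. lra.
Qed.

(** Strong maximum principle: the growth bounds carry a zero to the right with the rate [nup] and to
    the left with [nun]. *)
Lemma sol_zero c f y y1 z0 : sol c f y y1 -> (forall z, 0 <= f z) -> y z0 = 0 -> forall z, y z = 0.
Proof.
  intros H Hf H0 z. apply Rle_antisym; [|apply (sol_nonneg c f y y1 H Hf)].
  destruct (Rle_lt_dec z0 z) as [Hz|Hz].
  - destruct (sol_grow c f y y1 H Hf z0 z Hz) as [G _]. rewrite H0 in G. lra.
  - destruct (sol_grow c f y y1 H Hf z z0 (Rlt_le _ _ Hz)) as [_ G]. rewrite H0 in G. lra.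
Qed.

Lemma sol_zero_forcing c f y y1 : sol c f y y1 -> (forall z, y z = 0) -> forall z, f z = 0.
Proof.
  intros [H1 [H2 _]] H0 z.
  assert (Hy1 : forall w, y1 w = 0).
  { intros w. rewrite <- (is_derive_unique _ _ _ (H1 w)).
    rewrite (Derive_ext y (fun _ => 0)); auto. apply Derive_const. }
  assert (E := is_derive_unique _ _ _ (H2 z)).
  rewrite (Derive_ext y1 (fun _ => 0)) in E; auto. rewrite Derive_const in E.
  rewrite H0 Hy1 in E. lra.
Qed.

Lemma antiderivative (f : R -> R) : (forall z, continuous f z) -> exists J : R -> R, forall z : R, is_derive J z (f z).
Proof.
  intros Hf. exists (fun z => RInt f 0 z). intros z.
  apply (is_derive_RInt f (fun z => RInt f 0 z) 0 z); auto.
  exists (mkposreal 1 Rlt_0_1). intros y _. apply (RInt_correct (V := R_CompleteNormedModule)).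
  apply (ex_RInt_continuous (V := R_CompleteNormedModule)). intros w _. apply Hf.
Qed.

(** The solution is [p z = int_z^oo e^{a (z - s)} f s ds]. Adding [M] makes the integrand
    nonnegative, so the improper integral becomes the supremum [S] of an increasing primitive [J];
    the constant [M / a] is subtracted afterwards. *)
Lemma first_order_exists (f : R -> R) (a M : R) : 0 < a -> (forall z, continuous f z) ->
  (forall z, Rabs (f z) <= M) ->
  exists p, (forall z : R, is_derive p z (a * p z - f z)) /\ bounded_fun p.
Proof.
  intros Ha Hf HM.
  destruct (antiderivative (fun s => exp (- a * s) * (f s + M))) as [J HJ].
  { intros z. apply (continuous_mult (fun s => exp (- a * s)) (fun s => f s + M)).
    - apply (ex_derive_continuous (fun s => exp (- a * s))). auto_derive; auto.
    - apply (continuous_plus f (fun _ => M)); auto. apply continuous_const. }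
  assert (Hf2 : forall z, 0 <= f z + M <= 2 * M).
  { intros z. specialize (HM z). apply Rabs_le_between in HM. lra. }
  assert (J1 : forall w z, w <= z -> J w <= J z).
  { intros w z Hwz. assert (- J z <= - J w); [|lra].
    apply (derive_nonpos_decr (fun z => - J z) (fun s => - (exp (- a * s) * (f s + M))) w z Hwz).
    - intros s _. apply is_derive_neg; auto.
    - intros s _. generalize (exp_pos (- a * s)) (Hf2 s). nra. }
  assert (J2 : forall w z, w <= z -> J z <= J w + 2 * M / a * exp (- a * w)).
  { intros w z Hwz.
    assert (J z + 2 * M / a * exp (- a * z) <= J w + 2 * M / a * exp (- a * w)).
    { apply (derive_nonpos_decr (fun z => J z + 2 * M / a * exp (- a * z))
         (fun s => exp (- a * s) * (f s + M) + 2 * M / a * (- a * exp (- a * s))) w z Hwz).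
      - intros s _. apply is_derive_add; auto. apply is_derive_cmul. auto_derive; auto. ring.
      - intros s _. replace (2 * M / a * (- a * exp (- a * s))) with (- 2 * M * exp (- a * s)) by (field; lra).
        generalize (exp_pos (- a * s)) (Hf2 s). nra. }
    assert (0 <= 2 * M / a * exp (- a * z)); [|lra].
    apply Rmult_le_pos; [|left; apply exp_pos]. apply Rmult_le_pos.
    generalize (Hf2 0); lra. left; apply Rinv_0_lt_compat; auto. }
  destruct (completeness (fun x => exists z, x = J z)) as [S [HS1 HS2]].
  { exists (J 0 + 2 * M / a * exp (- a * 0)). intros x [z ->].
    destruct (Rle_lt_dec 0 z) as [Hz|Hz]. auto.
    apply Rle_trans with (J 0). apply J1; lra. apply Rle_trans with (2 := J2 0 0 (Rle_refl 0)). apply J1; lra. }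
  { exists (J 0), 0; auto. }
  exists (fun z => (S - J z) * exp (a * z) - M / a). split.
  - intros z. apply is_derive_eq with ((0 - exp (- a * z) * (f z + M) + a * (S - J z)) * exp (a * z) - 0).
    + apply is_derive_sub. apply (is_derive_mul_exp (fun z => S - J z)). apply is_derive_sub; auto.
      apply (is_derive_const S z). apply (is_derive_const (M / a) z).
    + assert (E : exp (- a * z) * exp (a * z) = 1).
      { rewrite -exp_plus. replace (- a * z + a * z) with 0 by ring. apply exp_0. }
      replace ((0 - exp (- a * z) * (f z + M) + a * (S - J z)) * exp (a * z) - 0) with
        (a * (S - J z) * exp (a * z) - (exp (- a * z) * exp (a * z)) * (f z + M)) by ring.
      rewrite E. field. lra.
  - exists (M / a). intros z.
    assert (H1 : J z <= S) by (apply HS1; exists z; auto).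
    assert (H2 : S <= J z + 2 * M / a * exp (- a * z)).
    { apply HS2. intros x [w ->]. destruct (Rle_lt_dec z w) as [Hw|Hw]. auto.
      apply Rle_trans with (2 := J2 z z (Rle_refl z)). apply J1; lra. }
    assert (H3 : 0 <= (S - J z) * exp (a * z) <= 2 * (M / a)).
    { split. apply Rmult_le_pos. lra. left; apply exp_pos.
      apply Rle_trans with (2 * M / a * exp (- a * z) * exp (a * z)).
      apply Rmult_le_compat_r. left; apply exp_pos. lra.
      rewrite Rmult_assoc -exp_plus. replace (- a * z + a * z) with 0 by ring. rewrite exp_0.
      right; field; lra. }
    apply Rabs_le. lra.
Qed.

(** Variation of constants: [p] integrates [f] from the right with exponent [nup], and [q], obtained
    by reflection, from the left with exponent [nun]; the solution is [(p + q) / (nup - nun)]. *)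
Lemma sol_exists c f M : (forall z, continuous f z) -> (forall z, Rabs (f z) <= M) ->
  exists y y1, sol c f y y1.
Proof.
  intros Hf HM. assert (Hs := nu_sum c). assert (Hp := nu_prod c). assert (Hsg := nu_sign c).
  destruct (first_order_exists f (nup c) M) as [p [Hp1 Hp2]]; auto; try lra.
  destruct (first_order_exists (fun z => f (-1 * z + 0)) (- nun c) M) as [q0 [Hq1 Hq2]]; auto; try lra.
  { intros z. apply (continuous_comp (fun z => -1 * z + 0) f); auto.
    apply (ex_derive_continuous (fun z => -1 * z + 0)). auto_derive; auto. }
  set (q := fun z : R => q0 (-1 * z + 0)).
  assert (Hq : forall z : R, is_derive q z (nun c * q z + f z)).
  { intros z. apply is_derive_eq with (-1 * (- nun c * q0 (-1 * z + 0) - f (-1 * (-1 * z + 0) + 0))).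
    - apply is_derive_comp_lin. auto.
    - unfold q. replace (-1 * (-1 * z + 0) + 0) with z by ring. ring. }
  assert (Hbq : bounded_fun q).
  { destruct Hq2 as [N HN]. exists N. intros z. apply HN. }
  set (D := nup c - nun c). assert (HD : D <> 0) by (unfold D; lra).
  exists (fun z => / D * p z + / D * q z),
         (fun z => nup c / D * p z + nun c / D * q z). split; [|split; [|split]].
  - intros z. apply is_derive_eq with (/ D * (nup c * p z - f z) + / D * (nun c * q z + f z)).
    + apply is_derive_add; apply is_derive_cmul; auto.
    + field; auto.
  - intros z. apply is_derive_eq with
      (nup c / D * (nup c * p z - f z) + nun c / D * (nun c * q z + f z)).
    + apply is_derive_add; apply is_derive_cmul; auto.
    + assert (E1 : nup c * nup c = (nup c + nun c) * nup c + 1) by lra.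
      assert (E2 : nun c * nun c = (nup c + nun c) * nun c + 1) by lra.
      rewrite Hs in E1. rewrite Hs in E2.
      replace (nup c / D * (nup c * p z - f z) + nun c / D * (nun c * q z + f z)) with
        (/ D * ((nup c * nup c) * p z + (nun c * nun c) * q z) - / D * (nup c - nun c) * f z) by (field; auto).
      rewrite E1 E2. fold D. field. auto.
  - apply bounded_lin; auto.
  - apply bounded_lin; auto.
Qed.

Lemma attained_max (f : R -> R) (z0 Rad : R) : (forall z, continuous f z) -> 0 < f z0 ->
  (forall z, Rad < Rabs z -> f z <= 0) -> exists zm, 0 < f zm /\ forall z, f z <= f zm.
Proof.
  intros Hf H0 Hfar.
  assert (Hz0 : Rabs z0 <= Rad). { apply Rnot_lt_le. intros H. specialize (Hfar z0 H). lra. }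
  destruct (continuity_ab_maj f (- Rad) Rad) as [zm [Hm1 Hm2]].
  - generalize (Rabs_pos z0); lra.
  - intros z _. apply continuity_pt_filterlim. apply Hf.
  - exists zm. assert (f z0 <= f zm) by (apply Hm1; apply Rabs_le_between; auto).
    split. lra. intros z. destruct (Rle_lt_dec (Rabs z) Rad) as [Hz|Hz].
    + apply Hm1. apply Rabs_le_between; auto.
    + specialize (Hfar z Hz). lra.
Qed.

(** * Exponential barriers for the profile operator on the whole line *)

(** So small that [sg^2 + |c| sg <= 1/2]; then [csh], which grows at both ends, still satisfies
    [csh'' - c csh' - csh <= - csh / 2]. *)
Definition sg (c : R) : R := / (2 * (1 + Rabs c)).

Lemma sg_spec c : 0 < sg c /\ sg c * sg c + Rabs c * sg c <= / 2.
Proof.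
  assert (H := Rabs_pos c). unfold sg.
  assert (H1 : 0 < / (2 * (1 + Rabs c))) by (apply Rinv_0_lt_compat; lra).
  split; auto.
  assert (H2 : / (2 * (1 + Rabs c)) * (2 * (1 + Rabs c)) = 1) by (apply Rinv_l; lra).
  set (s := / (2 * (1 + Rabs c))) in *.
  assert (s <= 1) by nra. nra.
Qed.

Definition csh (c z : R) : R := exp (sg c * z) + exp (- sg c * z).
Definition snh (c z : R) : R := exp (sg c * z) - exp (- sg c * z).

Lemma csh_derive c z : is_derive (csh c) z (sg c * snh c z).
Proof. unfold csh, snh. auto_derive; auto. unfold Rminus. ring. Qed.

Lemma snh_derive c z : is_derive (snh c) z (sg c * csh c z).
Proof. unfold csh, snh. auto_derive; auto. unfold Rminus. ring. Qed.

Lemma snh_csh c z : Rabs (snh c z) <= csh c z.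
Proof.
  unfold snh, csh. generalize (exp_pos (sg c * z)) (exp_pos (- sg c * z)). intros.
  apply Rabs_le. lra.
Qed.

Lemma csh_lower c z : exp (sg c * Rabs z) <= csh c z.
Proof.
  unfold csh. generalize (exp_pos (sg c * z)) (exp_pos (- sg c * z)). intros.
  unfold Rabs; destruct Rcase_abs; [replace (sg c * - z) with (- sg c * z) by ring|]; lra.
Qed.

Lemma csh_super c z : sg c * (sg c * csh c z) - c * (sg c * snh c z) - csh c z <= - csh c z / 2.
Proof.
  destruct (sg_spec c) as [H1 H2]. assert (H3 := snh_csh c z).
  assert (H4 : - (c * (sg c * snh c z)) <= Rabs c * sg c * csh c z).
  { apply Rle_trans with (1 := Rle_abs _). rewrite Rabs_Ropp !Rabs_mult (Rabs_pos_eq (sg c)); [|lra].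
    rewrite Rmult_assoc. apply Rmult_le_compat_l. apply Rabs_pos. apply Rmult_le_compat_l. lra. auto. }
  assert (0 <= csh c z) by (generalize (Rabs_pos (snh c z)); lra). nra.
Qed.

(** Subtracting [del csh] forces a positive maximum to be attained, and the strict inequality for
    [csh] contradicts the one for [y] there. The inequality is demanded only where [y > 0], which
    allows barriers that are valid on part of the line. *)
Lemma max_principle c (y y1 y2 : R -> R) (M : R) :
  (forall z : R, is_derive y z (y1 z)) -> (forall z : R, is_derive y1 z (y2 z)) ->
  (forall z, y z <= M) -> (forall z, 0 < y z -> 0 <= y2 z - c * y1 z - y z) -> forall z, y z <= 0.
Proof.
  intros H1 H2 HM Hy z0. apply Rnot_lt_le. intros Hz0.
  assert (Hc0 : 0 < csh c z0).
  { apply Rlt_le_trans with (2 := csh_lower c z0). apply exp_pos. }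
  set (del := y z0 / (2 * csh c z0)).
  assert (Hdel : 0 < del) by (unfold del; apply Rdiv_lt_0_compat; lra).
  assert (Hdc : del * csh c z0 = y z0 / 2) by (unfold del; field; lra).
  destruct (sg_spec c) as [Hs1 Hs2].
  assert (HMp : 0 < M) by (specialize (HM z0); lra).
  destruct (attained_max (fun z => y z - del * csh c z) z0 (M / del / sg c)) as [zm [Hm1 Hm2]].
  - intros z. apply (ex_derive_continuous (fun z => y z - del * csh c z)).
    eexists. apply is_derive_sub; [apply H1|]. apply is_derive_cmul, csh_derive.
  - lra.
  - intros z Hz. assert (M <= del * csh c z); [|specialize (HM z); lra].
    apply Rle_trans with (del * exp (sg c * Rabs z)).
    2:{ apply Rmult_le_compat_l. lra. apply csh_lower. }
    apply Rle_trans with (del * (sg c * Rabs z)).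
    + apply Rlt_le. apply Rmult_lt_reg_l with (/ del / sg c).
      { apply Rmult_lt_0_compat; apply Rinv_0_lt_compat; auto. }
      replace (/ del / sg c * (del * (sg c * Rabs z))) with (Rabs z) by (field; lra).
      replace (/ del / sg c * M) with (M / del / sg c) by (field; lra). auto.
    + apply Rmult_le_compat_l. lra. generalize (exp_ineq1_le (sg c * Rabs z)). lra.
  - assert (E1 : y1 zm - del * (sg c * snh c zm) = 0).
    { apply (local_max_derive (fun z => y z - del * csh c z) zm _ 1); try lra.
      - apply is_derive_sub; auto. apply is_derive_cmul, csh_derive.
      - intros; apply Hm2. }
    assert (E2 : y2 zm - del * (sg c * (sg c * csh c zm)) <= 0).
    { apply (local_max_derive2 (fun z => y z - del * csh c z)
               (fun z => y1 z - del * (sg c * snh c z)) zm _ 1); try lra.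
      - intros z _. apply is_derive_sub; auto. apply is_derive_cmul, csh_derive.
      - apply is_derive_sub; auto. apply is_derive_cmul. apply is_derive_cmul, snh_derive.
      - intros; apply Hm2. }
    assert (Hcm : 0 < csh c zm).
    { apply Rlt_le_trans with (2 := csh_lower c zm). apply exp_pos. }
    assert (Hyp : 0 < y zm) by nra.
    specialize (Hy zm Hyp). generalize (csh_super c zm). nra.
Qed.

(** A forcing error of size [M] outside [[- N, N]] is felt at a fixed [z] only through the factor
    [e^{- sg N}]: the added term [2 M e^{- sg N} csh] has a defect of at least [M] once [|t| > N].
    Hence locally uniform convergence of bounded forcings suffices for convergence of solutions. *)
Lemma sol_close c f g y y1 w w1 eps M N : 0 <= eps -> 0 <= M -> sol c f y y1 -> sol c g w w1 ->
  (forall z, f z - g z <= M) -> (forall z, Rabs z <= N -> f z - g z <= eps) ->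
  forall z, y z - w z <= eps + 2 * M * exp (- sg c * N) * csh c z.
Proof.
  intros He HMp [H1 [H2 [H3 H4]]] [K1 [K2 [K3 K4]]] HM HN z.
  set (A := 2 * M * exp (- sg c * N)).
  assert (HA : 0 <= A). { unfold A. generalize (exp_pos (- sg c * N)). nra. }
  assert (y z - w z - (eps + A * csh c z) <= 0); [|unfold A in *; lra].
  assert (Hd1 : forall t : R, is_derive (fun t => y t - w t - (eps + A * csh c t)) t
                   (y1 t - w1 t - (0 + A * (sg c * snh c t)))).
  { intros t. apply is_derive_sub. apply is_derive_sub; auto.
    apply is_derive_add. apply (is_derive_const eps t). apply is_derive_cmul, csh_derive. }
  assert (Hd2 : forall t : R, is_derive (fun t => y1 t - w1 t - (0 + A * (sg c * snh c t))) t
                   ((c * y1 t + y t - f t) - (c * w1 t + w t - g t) - (0 + A * (sg c * (sg c * csh c t))))).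
  { intros t. apply is_derive_sub. apply is_derive_sub; auto.
    apply is_derive_add. apply (is_derive_const 0 t). apply is_derive_cmul, is_derive_cmul, snh_derive. }
  destruct H3 as [My HMy]. destruct K3 as [Mw HMw].
  apply (max_principle c _ _ _ (My + Mw) Hd1 Hd2).
  - intros t. specialize (HMy t). specialize (HMw t).
    apply Rabs_le_between in HMy. apply Rabs_le_between in HMw.
    assert (0 <= A * csh c t); [|lra]. apply Rmult_le_pos; auto.
    apply Rle_trans with (2 := csh_lower c t). left; apply exp_pos.
  - intros t _. assert (Hs := csh_super c t).
    assert (HH : f t - g t <= eps + A * (csh c t / 2)).
    { destruct (Rle_lt_dec (Rabs t) N) as [Ht|Ht].
      - specialize (HN t Ht). assert (0 <= A * (csh c t / 2)); [|lra]. apply Rmult_le_pos; auto.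
        assert (0 < csh c t); [|lra]. apply Rlt_le_trans with (2 := csh_lower c t). apply exp_pos.
      - specialize (HM t).
        assert (M <= A * (csh c t / 2)); [|lra].
        unfold A. replace (2 * M * exp (- sg c * N) * (csh c t / 2)) with (M * (exp (- sg c * N) * csh c t)) by field.
        rewrite <- (Rmult_1_r M) at 1. apply Rmult_le_compat_l; auto.
        apply Rle_trans with (exp (- sg c * N) * exp (sg c * Rabs t)).
        + rewrite -exp_plus -exp_0. apply exp_le_mono. destruct (sg_spec c). nra.
        + apply Rmult_le_compat_l. left; apply exp_pos. apply csh_lower. }
    nra.
Qed.

(** * Existence of fronts below a supersolution *)

Definition lips (K : R) (f : R -> R) : Prop := forall x y, Rabs (f x - f y) <= K * Rabs (x - y).

Lemma lips_continuous K f : 0 <= K -> lips K f -> forall x, continuous f x.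
Proof.
  intros HK Hf x. apply continuous_of_near. intros eps He.
  exists (eps / (K + 1)). split. apply Rdiv_lt_0_compat; lra.
  intros y Hy. apply Rle_lt_trans with (1 := Hf y x).
  apply Rle_lt_trans with ((K + 1) * Rabs (y - x)). generalize (Rabs_pos (y - x)); lra.
  apply Rlt_le_trans with ((K + 1) * (eps / (K + 1))). apply Rmult_lt_compat_l; lra.
  right; field; lra.
Qed.

Lemma lips_derive K (f f1 : R -> R) : (forall z : R, is_derive f z (f1 z)) ->
  (forall z, Rabs (f1 z) <= K) -> lips K f.
Proof.
  intros H HK.
  assert (Hw : forall x y, x <= y -> Rabs (f x - f y) <= K * Rabs (x - y)).
  { intros x y [Hxy| ->].
    2:{ rewrite !Rminus_diag !Rabs_R0. lra. }
    destruct (MVT_cor2 f f1 x y Hxy) as [z [Hz _]].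
    - intros z _. apply is_derive_Reals; auto.
    - rewrite (Rabs_minus_sym (f x)) Hz Rabs_mult (Rabs_minus_sym x).
      apply Rmult_le_compat_r; auto. apply Rabs_pos. }
  intros x y. destruct (Rle_lt_dec x y). auto.
  rewrite (Rabs_minus_sym (f x)) (Rabs_minus_sym x). apply Hw; lra.
Qed.

Lemma Rmax_close a b a' b' e : Rabs (a - a') <= e -> Rabs (b - b') <= e ->
  Rabs (Rmax a b - Rmax a' b') <= e.
Proof.
  intros H1 H2. apply Rabs_le_between in H1. apply Rabs_le_between in H2. apply Rabs_le.
  unfold Rmax; destruct (Rle_dec a b); destruct (Rle_dec a' b'); lra.
Qed.

Lemma lips_Rmax K f g : lips K f -> lips K g -> lips K (fun z => Rmax (f z) (g z)).
Proof. intros Hf Hg x y. apply Rmax_close; auto. Qed.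

Lemma lips_weaken K K' f : K <= K' -> lips K f -> lips K' f.
Proof. intros H Hf x y. apply Rle_trans with (1 := Hf x y). generalize (Rabs_pos (x - y)). nra. Qed.

Lemma lips_shift K f d : lips K f -> lips K (fun z => f (z + d)).
Proof. intros H x y. apply Rle_trans with (1 := H _ _). right. f_equal. f_equal. ring. Qed.

Lemma lips_limit K (F : nat -> R -> R) (f : R -> R) : (forall n, lips K (F n)) ->
  (forall z, is_lim_seq (fun n => F n z) (f z)) -> lips K f.
Proof.
  intros HF Hl x y.
  apply (is_lim_seq_le (fun n => Rabs (F n x - F n y)) (fun _ => K * Rabs (x - y))
           (Rabs (f x - f y)) (K * Rabs (x - y))).
  - intros n; apply HF.
  - apply (is_lim_seq_abs _ (f x - f y)). apply is_lim_seq_minus'; auto.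
  - apply is_lim_seq_const.
Qed.

Definition conv_loc (F : nat -> R -> R) (f : R -> R) : Prop :=
  forall N eps, 0 < eps -> exists n0, forall n z, (n0 <= n)%nat -> Rabs z <= N -> Rabs (F n z - f z) <= eps.

Lemma is_lim_seq_near (u : nat -> R) (l eps : R) : is_lim_seq u l -> 0 < eps ->
  exists n0, forall n, (n0 <= n)%nat -> Rabs (u n - l) <= eps.
Proof.
  intros H He. apply is_lim_seq_spec in H. destruct (H (mkposreal eps He)) as [n0 Hn].
  exists n0. intros n Hn0. left. apply (Hn n Hn0).
Qed.

Lemma is_lim_seq_of_near (u : nat -> R) (l : R) :
  (forall eps, 0 < eps -> exists n0, forall n, (n0 <= n)%nat -> Rabs (u n - l) <= eps) -> is_lim_seq u l.
Proof.
  intros H. apply is_lim_seq_spec. intros eps.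
  destruct (H (eps / 2)) as [n0 Hn]. destruct eps as [e He]; simpl; lra.
  exists n0. intros n Hn0. specialize (Hn n Hn0). destruct eps as [e He]; simpl in *. lra.
Qed.

(** The common Lipschitz constant reduces uniform convergence on [[- N, N]] to convergence at the
    finitely many points [- N + j d], where [K d <= eps / 4]. *)
Lemma lips_conv_loc K (F : nat -> R -> R) (f : R -> R) : 0 <= K -> (forall n, lips K (F n)) ->
  (forall z, is_lim_seq (fun n => F n z) (f z)) -> conv_loc F f.
Proof.
  intros HK HF Hl N eps He.
  assert (Hf : lips K f) by (apply (lips_limit K F); auto).
  set (d := eps / (4 * (K + 1))).
  assert (Hd : 0 < d) by (unfold d; apply Rdiv_lt_0_compat; lra).
  assert (HKd : K * d <= eps / 4).
  { apply Rle_trans with ((K + 1) * d). nra. unfold d. right; field; lra. }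
  assert (Hnet : forall J : nat, exists n0, forall n j, (n0 <= n)%nat -> (j <= J)%nat ->
            Rabs (F n (- N + INR j * d) - f (- N + INR j * d)) <= eps / 4).
  { induction J as [|J [n1 IH]].
    - destruct (is_lim_seq_near _ _ (eps / 4) (Hl (- N + INR 0 * d))) as [n0 H0]. lra.
      exists n0. intros n j Hn Hj. replace j with 0%nat by lia. auto.
    - destruct (is_lim_seq_near _ _ (eps / 4) (Hl (- N + INR (S J) * d))) as [n0 H0]. lra.
      exists (Nat.max n0 n1). intros n j Hn Hj. destruct (Nat.eq_dec j (S J)) as [->|Hne].
      + apply H0. lia.
      + apply IH; lia. }
  destruct (Rle_lt_dec 0 N) as [HN|HN].
  2:{ exists 0%nat. intros n z _ Hz. generalize (Rabs_pos z); lra. }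
  destruct (nfloor_ex (2 * N / d)) as [J HJ].
  { apply Rmult_le_pos. lra. left; apply Rinv_0_lt_compat; auto. }
  destruct (Hnet J) as [n0 Hn0]. exists n0. intros n z Hn Hz.
  apply Rabs_le_between in Hz.
  destruct (nfloor_ex ((z + N) / d)) as [j Hj].
  { apply Rmult_le_pos. lra. left; apply Rinv_0_lt_compat; auto. }
  assert (Hz1 : INR j * d <= z + N <= (INR j + 1) * d).
  { split.
    - apply Rle_trans with ((z + N) / d * d). apply Rmult_le_compat_r; lra. right; field; lra.
    - apply Rle_trans with ((z + N) / d * d). right; field; lra. apply Rmult_le_compat_r; lra. }
  assert (HjJ : (j <= J)%nat).
  { apply Nat.lt_succ_r. apply INR_lt. rewrite S_INR.
    apply Rle_lt_trans with ((z + N) / d). lra. apply Rle_lt_trans with (2 * N / d); [|lra].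
    apply Rmult_le_compat_r. left; apply Rinv_0_lt_compat; auto. lra. }
  specialize (Hn0 n j Hn HjJ).
  set (w := - N + INR j * d) in *.
  assert (Hzw : Rabs (z - w) <= d). { unfold w. rewrite Rabs_pos_eq; lra. }
  assert (A1 : Rabs (F n z - F n w) <= eps / 4). { apply Rle_trans with (1 := HF n z w). nra. }
  assert (A2 : Rabs (f w - f z) <= eps / 4).
  { apply Rle_trans with (1 := Hf w z). rewrite Rabs_minus_sym. nra. }
  replace (F n z - f z) with ((F n z - F n w) + (F n w - f w) + (f w - f z)) by ring.
  apply Rle_trans with (1 := Rabs_triang _ _).
  generalize (Rabs_triang (F n z - F n w) (F n w - f w)). lra.
Qed.

Lemma sol_limit c (fn : nat -> R -> R) f (yn yn1 : nat -> R -> R) y y1 M :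
  (forall n, sol c (fn n) (yn n) (yn1 n)) -> sol c f y y1 ->
  (forall n z, Rabs (fn n z - f z) <= M) -> conv_loc fn f ->
  forall z, is_lim_seq (fun n => yn n z) (y z).
Proof.
  intros Hn Hs HM Hcv z. apply is_lim_seq_of_near. intros eps He.
  assert (HMp : 0 <= M) by (generalize (HM 0%nat 0) (Rabs_pos (fn 0%nat 0 - f 0)); lra).
  destruct (sg_spec c) as [Hsg _].
  assert (Hcz : 0 < csh c z). { apply Rlt_le_trans with (2 := csh_lower c z). apply exp_pos. }
  destruct (exp_small (sg c) (eps / 2 / (2 * (M + 1) * csh c z)) 0 Hsg) as [w [_ Hw]].
  { apply Rdiv_lt_0_compat. lra. nra. }
  assert (Htail : 2 * M * exp (sg c * w) * csh c z <= eps / 2).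
  { apply Rle_trans with (2 * (M + 1) * csh c z * exp (sg c * w)).
    - generalize (exp_pos (sg c * w)). intros. assert (0 <= exp (sg c * w) * csh c z) by nra. nra.
    - apply Rle_trans with (2 * (M + 1) * csh c z * (eps / 2 / (2 * (M + 1) * csh c z))).
      apply Rmult_le_compat_l. nra. lra. right; field; lra. }
  destruct (Hcv (- w) (eps / 2)) as [n0 Hn0]. lra.
  exists n0. intros n Hnn.
  apply Rabs_le. split.
  - assert (HH := sol_close c f (fn n) y y1 (yn n) (yn1 n) (eps / 2) M (- w)).
    assert (HH' : y z - yn n z <= eps / 2 + 2 * M * exp (- sg c * - w) * csh c z).
    { apply HH; auto; try lra.
      - intros t. specialize (HM n t). apply Rabs_le_between in HM. lra.
      - intros t Ht. specialize (Hn0 n t Hnn Ht). apply Rabs_le_between in Hn0. lra. }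
    replace (- sg c * - w) with (sg c * w) in HH' by ring. lra.
  - assert (HH := sol_close c (fn n) f (yn n) (yn1 n) y y1 (eps / 2) M (- w)).
    assert (HH' : yn n z - y z <= eps / 2 + 2 * M * exp (- sg c * - w) * csh c z).
    { apply HH; auto; try lra.
      - intros t. specialize (HM n t). apply Rabs_le_between in HM. lra.
      - intros t Ht. specialize (Hn0 n t Hnn Ht). apply Rabs_le_between in Hn0. lra. }
    replace (- sg c * - w) with (sg c * w) in HH' by ring. lra.
Qed.

Lemma sol_const c k : sol c (fun _ => k) (fun _ => k) (fun _ => 0).
Proof.
  split; [|split; [|split]].
  - intros z. apply (is_derive_const k z).
  - intros z. apply is_derive_eq with 0. apply (is_derive_const 0 z). ring.
  - exists (Rabs k). intros; lra.
  - exists 0. intros. rewrite Rabs_R0. lra.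
Qed.

Lemma is_derive_shift (f : R -> R) (x d l : R) : is_derive f (x + d) l -> is_derive (fun z => f (z + d)) x l.
Proof.
  intros H. apply (is_derive_ext (fun z : R => f (1 * z + d))).
  - intros t. f_equal. ring.
  - apply is_derive_eq with (1 * l); [|ring]. apply is_derive_comp_lin.
    replace (1 * x + d) with (x + d) by ring. auto.
Qed.

Lemma sol_shift c f y y1 d : sol c f y y1 ->
  sol c (fun z => f (z + d)) (fun z => y (z + d)) (fun z => y1 (z + d)).
Proof.
  intros [H1 [H2 [[M HM] [N HN]]]]. split; [|split; [|split]].
  - intros z. apply is_derive_shift; auto.
  - intros z. apply (is_derive_shift y1). auto.
  - exists M. intros; apply HM.
  - exists N. intros; apply HN.
Qed.

Lemma sol_ext c f g y y1 : (forall z, f z = g z) -> sol c f y y1 -> sol c g y y1.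
Proof.
  intros E [H1 [H2 H3]]. split; [auto|split; [|auto]]. intros z. rewrite <- E. auto.
Qed.

(** Arzela-Ascoli on the line: a diagonal subsequence converges at all rationals, and the common
    Lipschitz constant makes the values at every other point a Cauchy sequence. *)
Lemma lips_subsequence (K M : R) (F : nat -> R -> R) : 0 <= K ->
  (forall n, lips K (F n)) -> (forall n z, Rabs (F n z) <= M) ->
  exists (s : nat -> nat) (f : R -> R), increasing_nat s /\
    forall z, is_lim_seq (fun n => F (s n) z) (f z).
Proof.
  intros HK HF HM.
  (* An enumeration of the rationals: [m] codes [(i, j)] and [i] codes [(a, b)], so every
     [(a - b) / (j + 1)] occurs. *)
  set (q := fun m => let (i, j) := Cantor.of_nat m in let (a, b) := Cantor.of_nat i in
                     (INR a - INR b) / (INR j + 1)).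
  assert (Hq : forall x eps, 0 < eps -> exists m, Rabs (q m - x) <= eps).
  { intros x eps He.
    destruct (nfloor_ex (/ eps)) as [j Hj]. { left; apply Rinv_0_lt_compat; auto. }
    assert (Hj0 : 0 < INR j + 1) by (generalize (pos_INR j); lra).
    destruct (archimed (x * (INR j + 1))) as [A1 A2].
    set (k := up (x * (INR j + 1))) in *.
    exists (Cantor.to_nat (Cantor.to_nat (Z.to_nat k, Z.to_nat (- k)), j)).
    unfold q. rewrite !Cantor.cancel_of_to.
    assert (Ek : INR (Z.to_nat k) - INR (Z.to_nat (- k)) = IZR k).
    { rewrite !INR_IZR_INZ -minus_IZR. f_equal. lia. }
    rewrite Ek.
    replace (IZR k / (INR j + 1) - x) with ((IZR k - x * (INR j + 1)) / (INR j + 1)) by (field; lra).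
    unfold Rdiv. rewrite Rabs_mult. rewrite !Rabs_pos_eq; try lra.
    2:{ left; apply Rinv_0_lt_compat; lra. }
    apply Rle_trans with (1 * / (INR j + 1)).
    - apply Rmult_le_compat_r. left; apply Rinv_0_lt_compat; lra. lra.
    - rewrite Rmult_1_l -(Rinv_inv eps). apply Rinv_le_contravar. apply Rinv_0_lt_compat; auto. lra. }
  assert (Hsub : forall us : (nat -> nat) * nat, exists s, increasing_nat s /\
            exists l : R, is_lim_seq (fun n => F (fst us (s n)) (q (snd us))) l).
  { intros [u k]. destruct (bounded_subsequence (fun n => F (u n) (q k)) M) as [s [l [H1 H2]]].
    intros; apply HM. exists s; split; auto. exists l; auto. }
  destruct (choice _ Hsub) as [E HE].
  set (S := fix S k := match k with O => fun n : nat => n | Datatypes.S k' => fun n => S k' (E (S k', k') n) end).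
  assert (HS : forall k, increasing_nat (S k)).
  { induction k as [|k IH]. intros n; simpl; lia.
    apply (increasing_nat_comp (S k) (E (S k, k))); auto. apply HE. }
  assert (Hnest : forall k p, exists r, increasing_nat r /\ forall n, S (p + k)%nat n = S k (r n)).
  { intros k. induction p as [|p [r [Hr1 Hr2]]].
    - exists (fun n => n). split. intros n; lia. auto.
    - exists (fun n => r (E (S (p + k)%nat, (p + k)%nat) n)). split.
      + apply increasing_nat_comp; auto. apply HE.
      + intros n. simpl. apply Hr2. }
  set (D := fun n => S n n).
  assert (HD : increasing_nat D).
  { intros n. unfold D. simpl. apply increasing_nat_lt; auto.
    apply Nat.lt_le_trans with (Datatypes.S n). lia.
    apply increasing_nat_ge. apply HE. }
  assert (Hqlim : forall k, exists l : R, is_lim_seq (fun n => F (D n) (q k)) l).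
  { intros k. destruct (HE (S k, k)) as [_ [l Hl]]. simpl in Hl.
    exists l. apply is_lim_seq_of_near. intros eps He.
    destruct (is_lim_seq_near _ _ eps Hl He) as [n0 Hn0].
    exists (Nat.max n0 (Datatypes.S k)). intros n Hn.
    destruct (Hnest (Datatypes.S k) (n - Datatypes.S k)%nat) as [r [Hr1 Hr2]].
    unfold D. replace (S n n) with (S (n - Datatypes.S k + Datatypes.S k)%nat n) by (f_equal; lia).
    rewrite Hr2. simpl. apply Hn0. apply Nat.le_trans with n. lia.
    apply increasing_nat_ge; auto. }
  assert (Hlim : forall z, exists l : R, is_lim_seq (fun n => F (D n) z) l).
  { intros z. apply ex_lim_seq_cauchy_corr. intros [eps He]. simpl.
    set (d := eps / (4 * (K + 1))).
    assert (Hd : 0 < d) by (unfold d; apply Rdiv_lt_0_compat; lra).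
    assert (HKd : K * d <= eps / 4).
    { apply Rle_trans with ((K + 1) * d). nra. unfold d. right; field; lra. }
    destruct (Hq z d Hd) as [k Hk]. destruct (Hqlim k) as [l Hl].
    destruct (is_lim_seq_near _ _ (eps / 8) Hl) as [n0 Hn0]. lra.
    exists n0. intros n m Hn Hm.
    assert (A : forall i, Rabs (F (D i) z - F (D i) (q k)) <= eps / 4).
    { intros i. apply Rle_trans with (1 := HF _ _ _). rewrite Rabs_minus_sym. nra. }
    assert (B1 := Hn0 n Hn). assert (B2 := Hn0 m Hm). assert (A1 := A n). assert (A2 := A m).
    apply Rabs_le_between in B1. apply Rabs_le_between in B2.
    apply Rabs_le_between in A1. apply Rabs_le_between in A2. apply Rabs_lt_between. lra. }
  destruct (choice _ Hlim) as [f Hf]. exists D, f. auto.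
Qed.

(** * The resolvent, limits of profiles and monotone iteration *)

(** The resolvent of the profile operator; the zero function is only the witness of inhabitation for
    [epsilon]. By [sol_le] the bounded solution is unique. *)
Definition res (c : R) (f : R -> R) : R -> R :=
  epsilon (inhabits (fun _ : R => 0)) (fun y => exists y1, sol c f y y1).

Lemma res_sol c f M : (forall z, continuous f z) -> (forall z, Rabs (f z) <= M) ->
  exists y1, sol c f (res c f) y1.
Proof. intros H1 H2.
  apply (epsilon_spec (inhabits (fun _ : R => 0)) (fun y => exists y1, sol c f y y1)). destruct (sol_exists c f M H1 H2) as [y Hy]. exists y; auto. Qed.

Lemma ms_mono {g kappa L G0 k dk} : monostable g kappa L G0 k dk -> forall x y, x <= y -> g x <= g y.
Proof.
  intros H x y Hxy. assert (HH := ms_slopes H x y x y (Rle_refl x) Hxy (Rle_refl y)). lra.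
Qed.

Lemma ms_lip {g kappa L G0 k dk} : monostable g kappa L G0 k dk -> lips L g.
Proof.
  intros H. assert (HL := ms_L H).
  assert (Hw : forall x y, x <= y -> Rabs (g x - g y) <= L * Rabs (x - y)).
  { intros x y Hxy. assert (HH := ms_slopes H x y x y (Rle_refl x) Hxy (Rle_refl y)).
    rewrite !Rabs_left1; lra. }
  intros x y. destruct (Rle_lt_dec x y). auto.
  rewrite (Rabs_minus_sym (g x)) (Rabs_minus_sym x). apply Hw; lra.
Qed.

Lemma ms_continuous {g kappa L G0 k dk} : monostable g kappa L G0 k dk -> forall x, continuous g x.
Proof.
  intros H. assert (HL := ms_L H). apply (lips_continuous L). lra.
  apply (ms_lip H).
Qed.

Lemma ms_range {g kappa L G0 k dk} : monostable g kappa L G0 k dk ->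
  forall x, 0 <= x <= kappa -> 0 <= g x <= kappa.
Proof.
  intros H x Hx. split.
  - rewrite -(ms_0 H). apply (ms_mono H); lra.
  - rewrite -(ms_k H). apply (ms_mono H); lra.
Qed.

Definition delayed (g : R -> R) (d : R) (a : R -> R) : R -> R := fun z => g (a (z - d)).

Lemma delayed_continuous g d a : (forall x, continuous g x) -> (forall x, continuous a x) ->
  forall z, continuous (delayed g d a) z.
Proof.
  intros Hg Ha z. apply (continuous_comp (fun z => a (z - d)) g); auto.
  apply (continuous_comp (fun z => z - d) a); auto.
  apply (ex_derive_continuous (fun z => z - d)). auto_derive; auto.
Qed.

Lemma res_delayed g kappa L G0 k dk c d a : monostable g kappa L G0 k dk ->
  (forall z, continuous a z) -> (forall z, 0 <= a z <= kappa) ->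
  exists y1, sol c (delayed g d a) (res c (delayed g d a)) y1.
Proof.
  intros H Ha Hr. apply res_sol with kappa.
  - apply delayed_continuous; auto. apply (ms_continuous H).
  - intros z. generalize (ms_range H _ (Hr (z - d))). unfold delayed. intros.
    rewrite Rabs_pos_eq; lra.
Qed.

Lemma sol_delayed_range g kappa L G0 k dk c d a y y1 : monostable g kappa L G0 k dk ->
  (forall z, 0 <= a z <= kappa) -> sol c (delayed g d a) y y1 -> forall z, 0 <= y z <= kappa.
Proof.
  intros H Hr Hs z. assert (Hg := fun z => ms_range H _ (Hr (z - d))). split.
  - apply (sol_nonneg c _ y y1 Hs). intros t. apply Hg.
  - apply (sol_le c _ _ y y1 _ _ Hs (sol_const c kappa)). intros t. apply Hg.
Qed.

(** By [sol_harnack] this bounds [|y'|] for every solution with nonnegative forcing and values in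
    [[0, kappa]]. It depends on [c] and [kappa] alone and is therefore common to all iterates. *)
Definition lipc (c kappa : R) : R := (nup c - nun c) * kappa.

Lemma sol_lips c f y y1 kappa : sol c f y y1 -> (forall z, 0 <= f z) -> (forall z, 0 <= y z <= kappa) ->
  lips (lipc c kappa) y.
Proof.
  intros Hs Hf Hy. apply lips_derive with y1. apply Hs.
  intros z. generalize (sol_harnack c f y y1 Hs Hf z) (Hy z) (nu_sign c). intros.
  unfold lipc. apply Rabs_le. nra.
Qed.

Lemma sol_mono c f y y1 : sol c f y y1 -> (forall s t, s <= t -> f s <= f t) ->
  forall s t, s <= t -> y s <= y t.
Proof.
  intros Hs Hf s t Hst.
  assert (HH := sol_le c f _ y y1 _ _ Hs (sol_shift c f y y1 (t - s) Hs)).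
  replace t with (s + (t - s)) by ring. apply HH. intros z. apply Hf. lra.
Qed.

(** The translates of the forcing approach the constant [g A], whose bounded solution is [g A]
    itself. Along [tau n] going to either end, this relates the limits of a profile to fixed points
    of [g]. *)
Lemma sol_delayed_limit g kappa L G0 k dk c d a y y1 (A : R) (tau : nat -> R) : monostable g kappa L G0 k dk ->
  (forall z, 0 <= a z <= kappa) -> 0 <= A <= kappa ->
  sol c (delayed g d a) y y1 -> conv_loc (fun n z => a (z + tau n)) (fun _ => A) ->
  is_lim_seq (fun n => y (tau n)) (g A).
Proof.
  intros H Ha HA Hs Hc. assert (HL := ms_L H).
  apply is_lim_seq_ext with (u := fun n => y (0 + tau n)). { intros n; f_equal; ring. }
  apply (sol_limit c (fun n z => delayed g d a (z + tau n)) (fun _ => g A)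
           (fun n z => y (z + tau n)) (fun n z => y1 (z + tau n)) (fun _ => g A) (fun _ => 0) kappa).
  - intros n. apply sol_shift. auto.
  - apply sol_const.
  - intros n z. unfold delayed.
    generalize (ms_range H _ (Ha (z + tau n - d))) (ms_range H _ HA). intros.
    apply Rabs_le; lra.
  - intros N eps He. destruct (Hc (N + Rabs d) (eps / L)) as [n0 Hn0]. apply Rdiv_lt_0_compat; lra.
    exists n0. intros n z Hn Hz. unfold delayed.
    apply Rle_trans with (1 := ms_lip H _ _).
    apply Rle_trans with (L * (eps / L)); [|right; field; lra].
    apply Rmult_le_compat_l. lra. replace (z + tau n - d) with ((z - d) + tau n) by ring.
    apply Hn0; auto. unfold Rminus. apply Rle_trans with (1 := Rabs_triang _ _). rewrite Rabs_Ropp; lra.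
Qed.

Lemma mono_conv_loc (a : R -> R) (A : R) (s : R) : s = 1 \/ s = -1 ->
  (forall x y, x <= y -> a x <= a y) ->
  is_lim_seq (fun n => a (s * INR n)) A -> conv_loc (fun n z => a (z + s * INR n)) (fun _ => A).
Proof.
  intros Hs Hm Hl N eps He.
  assert (Hlim : forall x, exists n, Rabs x <= INR n).
  { intros x. destruct (nfloor_ex (Rabs x)) as [n Hn]. apply Rabs_pos. exists (S n). rewrite S_INR. lra. }
  assert (Hbd : forall z, s = 1 /\ a z <= A \/ s = -1 /\ A <= a z).
  { intros z. destruct Hs as [-> | ->]; [left|right]; split; auto.
    - destruct (Hlim z) as [n0 Hn0].
      apply (is_lim_seq_le_loc (fun _ => a z) (fun n => a (1 * INR n)) (a z) A); auto.
      + exists n0. intros n Hn. apply Hm. apply le_INR in Hn. generalize (Rle_abs z). lra.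
      + apply is_lim_seq_const.
    - destruct (Hlim z) as [n0 Hn0].
      apply (is_lim_seq_le_loc (fun n => a (-1 * INR n)) (fun _ => a z) A (a z)); auto.
      + exists n0. intros n Hn. apply Hm. apply le_INR in Hn. generalize (Rle_abs (- z)). rewrite Rabs_Ropp. lra.
      + apply is_lim_seq_const. }
  destruct (is_lim_seq_near _ _ eps Hl He) as [n1 Hn1].
  destruct (Hlim N) as [n2 Hn2].
  exists (n1 + n2)%nat. intros n z Hn Hz.
  assert (Hz' := Hz). apply Rabs_le_between in Hz'.
  assert (HnN : Rabs N <= INR n2) by auto.
  assert (HN := Rle_abs N).
  assert (En : INR n = INR (n - n2) + INR n2). { rewrite -plus_INR. f_equal. lia. }
  specialize (Hn1 (n - n2)%nat ltac:(lia)). apply Rabs_le_between in Hn1.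
  destruct (Hbd (z + s * INR n)) as [[Es Hb]|[Es Hb]]; subst s.
  - assert (a (1 * INR (n - n2)) <= a (z + 1 * INR n)) by (apply Hm; lra).
    rewrite Rabs_left1; lra.
  - assert (a (z + -1 * INR n) <= a (-1 * INR (n - n2))) by (apply Hm; lra).
    rewrite Rabs_pos_eq; lra.
Qed.

Lemma bounded_monotone_limit (u : nat -> R) (a b : R) : (forall n, a <= u n <= b) ->
  (forall n, u n <= u (S n)) -> exists l : R, is_lim_seq u l /\ a <= l <= b /\ forall n, u n <= l.
Proof.
  intros Hb Hi. destruct (ex_finite_lim_seq_incr u b Hi) as [l Hl]. apply Hb.
  exists l. split; auto. split; [split|].
  - apply (is_lim_seq_le (fun _ => a) u a l); auto. apply Hb. apply is_lim_seq_const.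
  - apply (is_lim_seq_le u (fun _ => b) l b); auto. apply Hb. apply is_lim_seq_const.
  - intros n. apply (is_lim_seq_incr_compare u l Hl Hi n).
Qed.

Lemma bounded_antitone_limit (u : nat -> R) (a b : R) : (forall n, a <= u n <= b) ->
  (forall n, u (S n) <= u n) -> exists l : R, is_lim_seq u l /\ a <= l <= b /\ forall n, l <= u n.
Proof.
  intros Hb Hi. destruct (bounded_monotone_limit (fun n => - u n) (- b) (- a)) as [l [H1 [H2 H3]]].
  - intros n; specialize (Hb n); lra.
  - intros n; specialize (Hi n); lra.
  - exists (- l). split; [|split; [lra|intros n; specialize (H3 n); lra]].
    apply is_lim_seq_ext with (u := fun n => - - u n). intros; ring.
    apply (is_lim_seq_opp _ l). auto.
Qed.

(* [a] is the minimal solution of [a = max (eps * ramp, y)], where [y] is forced by [a] itself: the limit of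
   the increasing iteration started at [eps * ramp]. *)
Lemma forced_profile g kappa L G0 k dk c d eps (V : R -> R) : monostable g kappa L G0 k dk ->
  0 < eps <= 1 -> eps <= kappa -> (forall z, continuous V z) -> (forall z, 0 <= V z <= kappa) ->
  (forall y y1, sol c (delayed g d V) y y1 -> forall z, y z <= V z) ->
  (forall z, 0 <= z -> eps <= V z) ->
  exists a y y1, lips (Rmax 1 (lipc c kappa)) a /\ (forall z, 0 <= a z <= V z) /\
    (forall s t, s <= t -> a s <= a t) /\ (forall z, 1 <= z -> eps <= a z) /\
    sol c (delayed g d a) y y1 /\ (forall z, y z <= a z <= y z + eps).
Proof.
  intros H He Hek HcV HV Hsup HV0.
  set (LL := Rmax 1 (lipc c kappa)).
  assert (HLL : 1 <= LL) by apply Rmax_l.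
  assert (HLL2 : lipc c kappa <= LL) by apply Rmax_r.
  (* The floor keeps the iteration away from the zero profile. It vanishes for [z <= 0] and is at
     most [eps] for [z >= 0], where [V >= eps], so it stays below [V]. Being nondecreasing, it makes
     all iterates nondecreasing, although [V] is not assumed monotone. *)
  set (ramp := fun z => eps * Rmin (Rmax 0 z) 1).
  assert (Hr1 : forall z, 0 <= ramp z <= eps).
  { intros z. unfold ramp. assert (0 <= Rmin (Rmax 0 z) 1 <= 1).
    { split. apply Rmin_glb. apply Rmax_l. lra. apply Rmin_r. } nra. }
  assert (Hr2 : lips LL ramp).
  { intros x y. unfold ramp. rewrite -Rmult_minus_distr_l Rabs_mult (Rabs_pos_eq eps); [|lra].
    assert (Rabs (Rmin (Rmax 0 x) 1 - Rmin (Rmax 0 y) 1) <= Rabs (x - y)).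
    { unfold Rmin, Rmax, Rabs; repeat destruct Rle_dec; repeat destruct Rcase_abs; lra. }
    generalize (Rabs_pos (x - y)) (Rabs_pos (Rmin (Rmax 0 x) 1 - Rmin (Rmax 0 y) 1)). nra. }
  assert (Hr3 : forall s t, s <= t -> ramp s <= ramp t).
  { intros s t Hst. unfold ramp. apply Rmult_le_compat_l. lra.
    unfold Rmin, Rmax; repeat destruct Rle_dec; lra. }
  assert (Hr4 : forall z, ramp z <= V z).
  { intros z. destruct (Rle_lt_dec 0 z) as [Hz|Hz].
    - apply Rle_trans with (2 := HV0 z Hz). apply Hr1.
    - unfold ramp. rewrite Rmax_left; [|lra]. rewrite Rmin_left; [|lra]. rewrite Rmult_0_r. apply HV. }
  set (P := fun a : R -> R => lips LL a /\ (forall z, 0 <= a z <= V z) /\ (forall s t, s <= t -> a s <= a t)).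
  set (step := fun a z => Rmax (ramp z) (res c (delayed g d a) z)).
  assert (Hsol : forall a, P a -> exists y1, sol c (delayed g d a) (res c (delayed g d a)) y1).
  { intros a [Ha1 [Ha2 _]]. apply (res_delayed g kappa L G0 k dk); auto.
    - apply (lips_continuous LL); auto. lra.
    - intros z. specialize (Ha2 z). specialize (HV z). lra. }
  assert (Hcmp : forall a b y y1 w w1, (forall z, a z <= b z) -> sol c (delayed g d a) y y1 ->
             sol c (delayed g d b) w w1 -> forall z, y z <= w z).
  { intros a b y y1 w w1 Hab H1 H2. apply (sol_le c _ _ y y1 w w1 H1 H2).
    intros z. apply (ms_mono H). auto. }
  destruct (res_delayed g kappa L G0 k dk c d V H HcV HV) as [V1 HV1].
  assert (Hprop : forall a y y1, P a -> sol c (delayed g d a) y y1 ->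
     lips LL y /\ (forall z, 0 <= y z <= V z) /\ (forall s t, s <= t -> y s <= y t)).
  { intros a y y1 [Ha1 [Ha2 Ha3]] Hs.
    assert (Hak : forall z, 0 <= a z <= kappa).
    { intros z. specialize (Ha2 z). specialize (HV z). lra. }
    assert (Hyk := sol_delayed_range _ _ _ _ _ _ c d a y y1 H Hak Hs).
    split; [|split].
    - apply lips_weaken with (1 := HLL2). apply (sol_lips c _ y y1 kappa Hs); auto.
      intros z. apply (ms_range H _ (Hak (z - d))).
    - intros z. split. apply Hyk. apply Rle_trans with (2 := Hsup _ _ HV1 z).
      apply (Hcmp a V y y1 _ V1); auto. apply Ha2.
    - apply (sol_mono c _ y y1 Hs). intros s t Hst. apply (ms_mono H). apply Ha3. lra. }
  assert (Hstep : forall a, P a -> P (step a)).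
  { intros a Ha. destruct (Hsol a Ha) as [y1 Hs]. destruct (Hprop a _ y1 Ha Hs) as [K1 [K2 K3]].
    split; [|split].
    - apply lips_Rmax; auto.
    - intros z. unfold step. split. apply Rle_trans with (2 := Rmax_l _ _). apply Hr1.
      apply Rmax_lub; auto. apply K2.
    - intros s t Hst. unfold step.
      apply Rmax_lub.
      apply Rle_trans with (2 := Rmax_l _ _). auto.
      apply Rle_trans with (2 := Rmax_r _ _). auto. }
  set (an := fix an n := match n with O => ramp | S m => step (an m) end).
  assert (HPn : forall n, P (an n)).
  { induction n as [|n IH]. split; [auto|split; auto]. intros z; split; auto. apply Hr1.
    apply Hstep; auto. }
  assert (Hinc : forall n z, an n z <= an (S n) z).
  { induction n as [|n IH]; intros z.
    - apply Rmax_l.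
    - simpl. unfold step. apply Rmax_lub. apply Rmax_l. apply Rle_trans with (2 := Rmax_r _ _).
      destruct (Hsol _ (HPn n)) as [y1 Hs1]. destruct (Hsol _ (HPn (S n))) as [w1 Hs2].
      apply (Hcmp _ _ _ y1 _ w1 IH Hs1 Hs2). }
  destruct (choice (fun z l => is_lim_seq (fun n => an n z) (Finite l) /\ 0 <= l <= V z /\ forall n, an n z <= l)) as [a Ha].
  { intros z. apply (bounded_monotone_limit (fun n => an n z) 0 (V z)); auto. intros n. apply HPn. }
  assert (HPa : P a).
  { split; [|split].
    - apply (lips_limit LL an). intros n; apply HPn. apply Ha.
    - intros z. apply Ha.
    - intros s t Hst. apply (is_lim_seq_le (fun n => an n s) (fun n => an n t) (a s) (a t)); try apply Ha.
      intros n. apply HPn; auto. }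
  destruct (Hsol a HPa) as [y1 Hy]. set (y := res c (delayed g d a)) in *.
  destruct (choice (fun n y1 => sol c (delayed g d (an n)) (res c (delayed g d (an n))) y1)) as [yn1 Hyn].
  { intros n. apply Hsol. apply HPn. }
  assert (Hconv : conv_loc an a).
  { apply (lips_conv_loc LL); try lra. intros n; apply HPn. apply Ha. }
  assert (Hlim : forall z, is_lim_seq (fun n => res c (delayed g d (an n)) z) (y z)).
  { apply (sol_limit c (fun n => delayed g d (an n)) (delayed g d a) _ yn1 y y1 kappa); auto.
    - intros n z. assert (A1 : 0 <= an n (z - d) <= kappa).
      { destruct (HPn n) as [_ [Q _]]. specialize (Q (z - d)). specialize (HV (z - d)). lra. }
      assert (A2 : 0 <= a (z - d) <= kappa).
      { destruct HPa as [_ [Q _]]. specialize (Q (z - d)). specialize (HV (z - d)). lra. }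
      apply (ms_range H) in A1. apply (ms_range H) in A2.
      unfold delayed. apply Rabs_le. lra.
    - assert (HL := ms_L H).
      intros N e Hepos. destruct (Hconv (N + Rabs d) (e / L)) as [n0 Hn0]. apply Rdiv_lt_0_compat; lra.
      exists n0. intros n z Hn Hz. unfold delayed.
      apply Rle_trans with (1 := ms_lip H _ _).
      apply Rle_trans with (L * (e / L)); [|right; field; lra].
      apply Rmult_le_compat_l. lra.
      apply Hn0; auto. unfold Rminus. apply Rle_trans with (1 := Rabs_triang _ _). rewrite Rabs_Ropp; lra. }
  assert (Hfix : forall z, a z = Rmax (ramp z) (y z)).
  { intros z.
    assert (Q1 : is_lim_seq (fun n => an (S n) z) (a z)).
    { apply (is_lim_seq_incr_1 (fun n => an n z)). apply Ha. }
    assert (Q2 : is_lim_seq (fun n => an (S n) z) (Rmax (ramp z) (y z))).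
    { simpl. unfold step. apply is_lim_seq_of_near. intros e Hepos.
      destruct (is_lim_seq_near _ _ e (Hlim z) Hepos) as [n0 Hn0]. exists n0. intros n Hn.
      apply Rmax_close; auto. rewrite Rminus_diag Rabs_R0. lra. }
    apply is_lim_seq_unique in Q1. apply is_lim_seq_unique in Q2. congruence. }
  destruct (Hprop a y y1 HPa Hy) as [K1 [K2 K3]].
  exists a, y, y1. destruct HPa as [B1 [B2 B3]].
  split; [auto|split; [auto|split; [auto|split; [|split; [auto|]]]]].
  - intros z Hz. rewrite Hfix. apply Rle_trans with (2 := Rmax_l _ _). unfold ramp.
    rewrite Rmax_right; [|lra]. rewrite Rmin_right; lra.
  - intros z. rewrite Hfix. split. apply Rmax_r. specialize (K2 z). specialize (Hr1 z).
    apply Rmax_lub; lra.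
Qed.

Lemma sol_ext_y c f y w y1 : (forall z, y z = w z) -> sol c f y y1 -> sol c f w y1.
Proof.
  intros E [H1 [H2 [[M HM] H4]]]. split; [|split; [|split]]; auto.
  - intros z. apply (is_derive_ext y); auto.
  - intros z. rewrite -E. auto.
  - exists M. intros z. rewrite -E. auto.
Qed.

Lemma sol_solves_at g h c b b1 : sol c (delayed g (c * h) b) b b1 ->
  forall t x, solves_at g h (fun t x => b (x + c * t)) t x.
Proof.
  intros [H1 [H2 _]] t x.
  assert (E1 : forall y, is_derive (fun x => b (x + c * t)) y (b1 (y + c * t))).
  { intros y. apply is_derive_shift. auto. }
  assert (ED : forall y, Derive (fun x => b (x + c * t)) y = b1 (y + c * t)).
  { intros y. apply is_derive_unique, E1. }
  assert (E2 : is_derive (Derive (fun x => b (x + c * t))) x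
     (c * b1 (x + c * t) + b (x + c * t) - delayed g (c * h) b (x + c * t))).
  { apply (is_derive_ext (fun y => b1 (y + c * t))). intros y; symmetry; apply ED.
    apply (is_derive_shift b1). auto. }
  assert (E3 : is_derive (fun s => b (x + c * s)) t (c * b1 (x + c * t))).
  { apply (is_derive_ext (fun s : R => b (c * s + x))). intros s; f_equal; ring.
    apply is_derive_comp_lin. replace (c * t + x) with (x + c * t) by ring. auto. }
  split; [|split; [|split]].
  - eexists; apply E3.
  - intros y. eexists; apply E1.
  - eexists; apply E2.
  - rewrite (is_derive_unique _ _ _ E3) (is_derive_unique _ _ _ E2). unfold delayed.
    replace (x + c * (t - h)) with (x + c * t - c * h) by ring. ring.
Qed.

Lemma ms_fixed {g kappa L G0 k dk} : monostable g kappa L G0 k dk ->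
  forall A, 0 <= A <= kappa -> g A <= A -> A = 0 \/ A = kappa.
Proof.
  intros H A HA Hg. destruct (Req_dec A 0); [auto|]. destruct (Req_dec A kappa); [auto|].
  assert (A < g A); [|lra]. apply (ms_above H). lra.
Qed.

Lemma eventually_of_lim_gt (u : nat -> R) (l a : R) : is_lim_seq u l -> a < l -> exists n, a < u n.
Proof.
  intros H Ha. destruct (is_lim_seq_near u l ((l - a) / 2) H) as [n Hn]. lra.
  exists n. specialize (Hn n (Nat.le_refl n)). apply Rabs_le_between in Hn. lra.
Qed.

Lemma eventually_of_lim_lt (u : nat -> R) (l a : R) : is_lim_seq u l -> l < a -> exists n, u n < a.
Proof.
  intros H Ha. destruct (is_lim_seq_near u l ((a - l) / 2) H) as [n Hn]. lra.
  exists n. specialize (Hn n (Nat.le_refl n)). apply Rabs_le_between in Hn. lra.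
Qed.

(** The limit of a monotone profile at either end is a fixed point of [g], hence 0 or [kappa]; the
    value at 0, strictly in between, decides which. *)
Lemma mono_profile_limits g kappa L G0 k dk c d b b1 : monostable g kappa L G0 k dk ->
  (forall s t, s <= t -> b s <= b t) -> (forall z, 0 <= b z <= kappa) -> 0 < b 0 < kappa ->
  sol c (delayed g d b) b b1 -> is_lim b m_infty 0 /\ is_lim b p_infty kappa.
Proof.
  intros H Hm Hb H0 Hs. assert (Hk := ms_kappa H). split.
  - destruct (bounded_antitone_limit (fun n => b (-1 * INR n)) 0 kappa) as [A [A1 [A2 A3]]].
    { intros; apply Hb. } { intros n. apply Hm. rewrite S_INR. lra. }
    assert (E : is_lim_seq (fun n => b (-1 * INR n)) (g A)).
    { apply (sol_delayed_limit g kappa L G0 k dk c d b b b1); auto. apply mono_conv_loc; auto. }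
    assert (EA : g A = A).
    { apply is_lim_seq_unique in E. apply is_lim_seq_unique in A1. congruence. }
    assert (HA0 : A <= b 0). { specialize (A3 0%nat). simpl in A3. rewrite Rmult_0_r in A3. auto. }
    destruct (ms_fixed H A A2) as [-> | ->]; [lra| |lra].
    apply is_lim_spec. intros [e He]. simpl.
    destruct (eventually_of_lim_lt _ _ e A1 He) as [n Hn].
    exists (-1 * INR n). intros x Hx. rewrite Rminus_0_r Rabs_pos_eq.
    apply Rle_lt_trans with (2 := Hn). apply Hm; lra. apply Hb.
  - destruct (bounded_monotone_limit (fun n => b (1 * INR n)) 0 kappa) as [A [A1 [A2 A3]]].
    { intros; apply Hb. } { intros n. apply Hm. rewrite S_INR. lra. }
    assert (E : is_lim_seq (fun n => b (1 * INR n)) (g A)).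
    { apply (sol_delayed_limit g kappa L G0 k dk c d b b b1); auto. apply mono_conv_loc; auto. }
    assert (EA : g A = A).
    { apply is_lim_seq_unique in E. apply is_lim_seq_unique in A1. congruence. }
    assert (HA0 : b 0 <= A). { specialize (A3 0%nat). simpl in A3. rewrite Rmult_0_r in A3. auto. }
    destruct (ms_fixed H A A2) as [-> | ->]; [lra|lra|].
    apply is_lim_spec. intros [e He]. simpl.
    destruct (eventually_of_lim_gt _ _ (kappa - e) A1) as [n Hn]. lra.
    exists (1 * INR n). intros x Hx. specialize (Hb x).
    assert (b (1 * INR n) <= b x) by (apply Hm; lra).
    rewrite Rabs_left1; lra.
Qed.

(** Each floored problem has a monotone profile that tends to [kappa] on the right, because its
    limit [A >= en n] satisfies [g A <= A], and that is at most [kappa / 4] somewhere, because it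
    stays below [V]. It is translated to take the value [kappa / 2] at 0; this normalisation
    survives the limit of vanishing floors and excludes both constant profiles. *)
Lemma front_from_super g kappa L G0 k dk h c (V : R -> R) : monostable g kappa L G0 k dk ->
  (forall z, continuous V z) -> (forall z, 0 <= V z <= kappa) ->
  (forall y y1, sol c (delayed g (c * h) V) y y1 -> forall z, y z <= V z) ->
  (exists Z e, 0 < e /\ forall z, Z <= z -> e <= V z) ->
  (forall eps, 0 < eps -> exists z, V z <= eps) ->
  exists phi, wavefront g h kappa phi c.
Proof.
  intros H HcV HV Hsup [Z [e [Hepos HZ]]] Hm. set (d := c * h) in *.
  assert (Hk := ms_kappa H).
  set (e0 := Rmin (Rmin 1 e) (kappa / 2)).
  assert (He0 : 0 < e0) by (apply Rmin_pos; [apply Rmin_pos|]; lra).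
  assert (He1 : e0 <= 1). { apply Rle_trans with (1 := Rmin_l _ _). apply Rmin_l. }
  assert (He3 : e0 <= e). { apply Rle_trans with (1 := Rmin_l _ _). apply Rmin_r. } assert (He2 : e0 <= kappa / 2) by apply Rmin_r.
  set (LL := Rmax 1 (lipc c kappa)). assert (HLL : 1 <= LL) by apply Rmax_l.
  set (en := fun n => e0 / (INR n + 1)).
  assert (Hen : forall n, 0 < en n <= e0).
  { intros n. unfold en. assert (Hn := pos_INR n). split. apply Rdiv_lt_0_compat; lra.
    apply Rmult_le_reg_r with (INR n + 1). lra. replace (e0 / (INR n + 1) * (INR n + 1)) with e0 by (field; lra). nra. }
  assert (Hex : forall n, exists b : (R -> R) * (R -> R) * (R -> R),
     lips LL (fst (fst b)) /\ (forall z, 0 <= fst (fst b) z <= kappa) /\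
     (forall s t, s <= t -> fst (fst b) s <= fst (fst b) t) /\ fst (fst b) 0 = kappa / 2 /\
     sol c (delayed g d (fst (fst b))) (snd (fst b)) (snd b) /\
     (forall z, snd (fst b) z <= fst (fst b) z <= snd (fst b) z + en n)).
  { intros n. specialize (Hen n).
    destruct (forced_profile g kappa L G0 k dk c d (en n) (fun z => V (z + Z)) H) as
      [a [y [y1 [A1 [A2 [A3 [A4 [A5 A6]]]]]]]]; try lra.
    - intros z. apply (continuous_comp (fun z => z + Z) V); auto.
      apply (ex_derive_continuous (fun z => z + Z)). auto_derive; auto.
    - intros; apply HV.
    - intros y y1 Hs z.
      assert (HH : sol c (delayed g d V) (fun z => y (z + - Z)) (fun z => y1 (z + - Z))).
      { apply sol_ext with (2 := sol_shift c _ y y1 (- Z) Hs). intros w. unfold delayed. do 2 f_equal. ring. }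
      assert (E := Hsup _ _ HH (z + Z)). cbv beta in E. replace (z + Z + - Z) with z in E by ring. exact E.
    - intros z Hz. assert (e <= V (z + Z)) by (apply HZ; lra). lra.
    - assert (Hak : forall z, 0 <= a z <= kappa).
      { intros z. specialize (A2 z). specialize (HV (z + Z)). lra. }
      destruct (bounded_monotone_limit (fun n => a (1 * INR n)) 0 kappa) as [A [B1 [B2 B3]]].
      { intros; apply Hak. } { intros m. apply A3. rewrite S_INR. lra. }
      assert (E : is_lim_seq (fun n => y (1 * INR n)) (g A)).
      { apply (sol_delayed_limit g kappa L G0 k dk c d a y y1); auto. apply mono_conv_loc; auto. }
      assert (HgA : g A <= A).
      { apply (is_lim_seq_le (fun n => y (1 * INR n)) (fun n => a (1 * INR n)) (g A) A); auto.
        intros m. apply A6. }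
      assert (HAe : en n <= A).
      { apply Rle_trans with (2 := B3 1%nat). apply A4. simpl. lra. }
      destruct (ms_fixed H A B2 HgA) as [EA|EA]; [lra|]. subst A.
      destruct (eventually_of_lim_gt _ _ (kappa / 2) B1) as [m Hm1]. lra.
      destruct (Hm (kappa / 4)) as [z0 Hz0]. lra.
      assert (Hz0' : a (z0 - Z) <= kappa / 4).
      { specialize (A2 (z0 - Z)). replace (z0 - Z + Z) with z0 in A2 by ring. lra. }
      assert (Hord : z0 - Z < 1 * INR m).
      { apply Rnot_le_lt. intros Hc. apply A3 in Hc. lra. }
      destruct (IVT_gen a (z0 - Z) (1 * INR m) (kappa / 2)) as [zn [_ Hzn]].
      + intros z. apply continuity_pt_filterlim. apply (lips_continuous LL); auto. lra.
      + rewrite Rmin_left; [|lra]. rewrite Rmax_right; lra.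
      + exists (fun z => a (z + zn), fun z => y (z + zn), fun z => y1 (z + zn)). simpl.
        split; [apply lips_shift; auto|split; [auto|split; [|split; [|split; [|auto]]]]].
        * intros s t Hst. apply A3. lra.
        * rewrite Rplus_0_l. auto.
        * apply sol_ext with (2 := sol_shift c _ y y1 zn A5). intros w. unfold delayed. do 2 f_equal. ring. }
  destruct (choice _ Hex) as [B HB].
  set (bn := fun n => fst (fst (B n))). set (yn := fun n => snd (fst (B n))). set (yn1 := fun n => snd (B n)).
  assert (HB' : forall n, lips LL (bn n) /\ (forall z, 0 <= bn n z <= kappa) /\
     (forall s t, s <= t -> bn n s <= bn n t) /\ bn n 0 = kappa / 2 /\
     sol c (delayed g d (bn n)) (yn n) (yn1 n) /\
     (forall z, yn n z <= bn n z <= yn n z + en n)) by exact HB.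
  destruct (lips_subsequence LL kappa bn) as [s [b [Hs Hb]]].
  { lra. } { intros n; apply HB'. } { intros n z. destruct (HB' n) as [_ [Q _]]. specialize (Q z). rewrite Rabs_pos_eq; lra. }
  assert (Hbl : lips LL b).
  { apply (lips_limit LL (fun n => bn (s n))); auto. intros n; apply HB'. }
  assert (Hbr : forall z, 0 <= b z <= kappa).
  { intros z. split.
    - apply (is_lim_seq_le (fun _ => 0) (fun n => bn (s n) z) 0 (b z)); auto.
      intros n; apply HB'. apply is_lim_seq_const.
    - apply (is_lim_seq_le (fun n => bn (s n) z) (fun _ => kappa) (b z) kappa); auto.
      intros n; apply HB'. apply is_lim_seq_const. }
  assert (Hbm : forall x y, x <= y -> b x <= b y).
  { intros x y Hxy. apply (is_lim_seq_le (fun n => bn (s n) x) (fun n => bn (s n) y) (b x) (b y)); auto.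
    intros n; apply HB'; auto. }
  assert (Hb0 : b 0 = kappa / 2).
  { assert (Q1 := Hb 0). assert (Q2 : is_lim_seq (fun n => bn (s n) 0) (kappa / 2)).
    { apply is_lim_seq_ext with (u := fun _ => kappa / 2). intros n; symmetry; apply HB'. apply is_lim_seq_const. }
    apply is_lim_seq_unique in Q1. apply is_lim_seq_unique in Q2. congruence. }
  destruct (res_delayed g kappa L G0 k dk c d b H) as [b1 Hb1]; auto.
  { apply (lips_continuous LL); auto. lra. }
  assert (Hconv : conv_loc (fun n => bn (s n)) b).
  { apply (lips_conv_loc LL); auto. lra. intros n; apply HB'. }
  assert (Hlim : forall z, is_lim_seq (fun n => yn (s n) z) (res c (delayed g d b) z)).
  { apply (sol_limit c (fun n => delayed g d (bn (s n))) (delayed g d b) _ (fun n => yn1 (s n)) _ b1 kappa); auto.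
    - intros n; apply HB'.
    - intros n z.
      assert (A1 : 0 <= bn (s n) (z - d) <= kappa) by apply HB'. assert (A2 := Hbr (z - d)).
      apply (ms_range H) in A1. apply (ms_range H) in A2.
      unfold delayed. apply Rabs_le. lra.
    - assert (HL := ms_L H).
      intros N e1 He1pos. destruct (Hconv (N + Rabs d) (e1 / L)) as [n0 Hn0]. apply Rdiv_lt_0_compat; lra.
      exists n0. intros n z Hn Hz. unfold delayed.
      apply Rle_trans with (1 := ms_lip H _ _).
      apply Rle_trans with (L * (e1 / L)); [|right; field; lra].
      apply Rmult_le_compat_l. lra.
      apply Hn0; auto. unfold Rminus. apply Rle_trans with (1 := Rabs_triang _ _). rewrite Rabs_Ropp; lra. }
  assert (Hen0 : is_lim_seq (fun n => en (s n)) 0).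
  { apply (is_lim_seq_increasing en); auto. unfold en.
    apply is_lim_seq_ext with (u := fun n => e0 * / INR (S n)). { intros n. rewrite S_INR. reflexivity. }
    replace (Finite 0) with (Rbar_mult e0 (Rbar_inv p_infty)) by (simpl; f_equal; ring).
    apply is_lim_seq_scal_l. apply is_lim_seq_inv; [|discriminate].
    apply (is_lim_seq_incr_1 INR). apply is_lim_seq_INR. }
  assert (Hfix : forall z, res c (delayed g d b) z = b z).
  { intros z. apply Rle_antisym.
    - apply (is_lim_seq_le (fun n => yn (s n) z) (fun n => bn (s n) z)
               (res c (delayed g d b) z) (b z)); auto.
      intros n; apply HB'.
    - replace (res c (delayed g d b) z) with (res c (delayed g d b) z + 0) by ring.
      apply (is_lim_seq_le (fun n => bn (s n) z) (fun n => yn (s n) z + en (s n)) (b z)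
               (res c (delayed g d b) z + 0)); auto.
      intros n; apply HB'. apply is_lim_seq_plus'; auto. }
  assert (Hsol : sol c (delayed g d b) b b1) by (apply sol_ext_y with (1 := Hfix); auto).
  destruct (mono_profile_limits g kappa L G0 k dk c d b b1 H Hbm Hbr) as [L1 L2]; auto. lra.
  exists b. split; [|split; [auto|split; [auto|]]].
  - intros z. destruct (Rle_lt_or_eq_dec _ _ (proj1 (Hbr z))) as [|Hz]; auto. exfalso.
    assert (b 0 = 0); [|lra]. apply (sol_zero c (delayed g d b) b b1 z); auto.
    intros w. apply (ms_range H); auto.
  - apply (sol_solves_at g h c b b1). auto.
Qed.

(** * Decay and monotonicity of the front *)

(** By the mean value theorem some point of [[z0, z0 + 1]] has slope at most [2 M] in absolute
    value; the integrating factor [e^{- c w}] carries this bound back to [z0] at the cost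
    [e^{|c|}]. *)
Lemma bounded_derivative (y y1 y2 : R -> R) c M M' : (forall z : R, is_derive y z (y1 z)) ->
  (forall z : R, is_derive y1 z (y2 z)) -> (forall z, Rabs (y z) <= M) ->
  (forall z, Rabs (y2 z - c * y1 z) <= M') -> forall z, Rabs (y1 z) <= (2 * M + M') * exp (Rabs c).
Proof.
  intros H1 H2 HM HM' z0.
  destruct (MVT_cor2 y y1 z0 (z0 + 1)) as [z [Hz1 Hz2]]. lra.
  { intros z _. apply is_derive_Reals; auto. }
  assert (Hxi : Rabs (y1 z) <= 2 * M).
  { replace (y1 z) with (y (z0 + 1) - y z0) by lra.
    apply Rle_trans with (1 := Rabs_triang _ _). rewrite Rabs_Ropp. generalize (HM z0) (HM (z0 + 1)). lra. }
  assert (Hexp : forall w, z0 <= w <= z0 + 1 -> 0 < exp (- c * (w - z0)) <= exp (Rabs c)).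
  { intros w Hw. split. apply exp_pos. apply exp_le_mono.
    apply Rle_trans with (Rabs c * (w - z0)).
    - apply Rmult_le_compat_r. lra. generalize (Rle_abs (- c)). rewrite Rabs_Ropp. auto.
    - generalize (Rabs_pos c). nra. }
  destruct (MVT_cor2 (fun w => y1 w * exp (- c * (w - z0)))
     (fun w => (y2 w - c * y1 w) * exp (- c * (w - z0))) z0 z) as [w [Hw1 Hw2]]. lra.
  { intros w _. apply is_derive_Reals.
    apply is_derive_eq with (y2 w * exp (- c * (w - z0)) + y1 w * (- c * exp (- c * (w - z0)))); [|ring].
    apply (is_derive_mul y1 (fun w => exp (- c * (w - z0)))); auto. auto_derive; auto. unfold Rminus; ring. }
  rewrite Rminus_diag Rmult_0_r exp_0 Rmult_1_r in Hw1.
  replace (y1 z0) with (y1 z * exp (- c * (z - z0)) - (y2 w - c * y1 w) * exp (- c * (w - z0)) * (z - z0)) by lra.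
  apply Rle_trans with (1 := Rabs_triang _ _). rewrite Rabs_Ropp !Rabs_mult.
  destruct (Hexp z) as [E1 E2]. lra. destruct (Hexp w) as [E3 E4]. lra.
  rewrite (Rabs_pos_eq (exp (- c * (z - z0)))); [|lra]. rewrite (Rabs_pos_eq (exp (- c * (w - z0)))); [|lra].
  rewrite (Rabs_pos_eq (z - z0)); [|lra]. rewrite Rmult_plus_distr_r.
  apply Rplus_le_compat.
  - apply Rmult_le_compat; auto; try lra. apply Rabs_pos.
  - rewrite <- (Rmult_1_r (M' * exp (Rabs c))). apply Rmult_le_compat; try lra.
    + apply Rmult_le_pos. apply Rabs_pos. lra.
    + apply Rmult_le_compat; auto; try lra. apply Rabs_pos.
Qed.

Lemma lim_m_infty (f : R -> R) (l : R) : is_lim f m_infty l -> forall eps, 0 < eps ->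
  exists Z, forall z, z <= Z -> Rabs (f z - l) <= eps.
Proof.
  intros H eps He. apply is_lim_spec in H. destruct (H (mkposreal eps He)) as [Z HZ].
  exists (Z - 1). intros z Hz. left. apply HZ. lra.
Qed.

Lemma lim_p_infty (f : R -> R) (l : R) : is_lim f p_infty l -> forall eps, 0 < eps ->
  exists Z, forall z, Z <= z -> Rabs (f z - l) <= eps.
Proof.
  intros H eps He. apply is_lim_spec in H. destruct (H (mkposreal eps He)) as [Z HZ].
  exists (Z + 1). intros z Hz. left. apply HZ. lra.
Qed.

(** The profile equation is the evolution equation read at [t = 0]. The profile is bounded by its
    limits and continuity, and its derivative by [bounded_derivative], because [phi'' - c phi'] is a
    difference of bounded terms. *)
Lemma wavefront_sol g kappa L G0 k dk h phi c : monostable g kappa L G0 k dk -> wavefront g h kappa phi c ->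
  exists phi1, sol c (delayed g (c * h) phi) phi phi1.
Proof.
  intros H [Hpos [Hm [Hp Hs]]]. assert (Hk := ms_kappa H). assert (HL := ms_L H).
  assert (Hex : forall y : R, ex_derive phi y).
  { intros y. destruct (Hs 0 0) as [_ [Hd _]]. specialize (Hd y).
    apply (ex_derive_ext (fun y : R => phi (y + c * 0)) phi y); auto. intros t. f_equal. ring. }
  assert (HD : forall y : R, is_derive phi y (Derive phi y)) by (intros; apply Derive_correct; auto).
  assert (HDD : forall x : R, is_derive (Derive phi) x (c * Derive phi x + phi x - delayed g (c * h) phi x)).
  { intros x. destruct (Hs 0 x) as [_ [_ [Hd2 Heq]]].
    assert (E : forall y, Derive (fun y => phi (y + c * 0)) y = Derive phi y).
    { intros y. apply Derive_ext. intros t. f_equal. ring. }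
    assert (Hd3 : ex_derive (Derive phi) x).
    { apply (ex_derive_ext (Derive (fun y => phi (y + c * 0)))); auto. }
    rewrite (Derive_ext _ _ x E) in Heq.
    assert (E4 : is_derive (fun s => phi (x + c * s)) 0 (c * Derive phi x)).
    { apply (is_derive_ext (fun s : R => phi (c * s + x))). intros s; f_equal; ring.
      apply is_derive_comp_lin. replace (c * 0 + x) with x by ring. auto. }
    rewrite (is_derive_unique _ _ _ E4) in Heq.
    apply is_derive_eq with (Derive (Derive phi) x). apply Derive_correct; auto.
    unfold delayed. replace (x + c * (0 - h)) with (x - c * h) in Heq by ring.
    replace (x + c * 0) with x in Heq by ring. lra. }
  assert (Hb : bounded_fun phi).
  { destruct (lim_m_infty phi 0 Hm 1) as [Z1 HZ1]. lra.
    destruct (lim_p_infty phi kappa Hp 1) as [Z2 HZ2]. lra.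
    destruct (continuity_ab_maj phi (Rmin Z1 Z2) (Rmax Z1 Z2)) as [x [Hx1 _]].
    - apply Rle_trans with Z1. apply Rmin_l. apply Rmax_l.
    - intros y _. apply continuity_pt_filterlim, (ex_derive_continuous phi y); auto.
    - exists (Rmax (phi x) (kappa + 1)). intros z. rewrite Rabs_pos_eq; [|left; auto].
      destruct (Rle_lt_dec z Z1) as [Hz|Hz].
      + apply Rle_trans with (2 := Rmax_r _ _). specialize (HZ1 z Hz). apply Rabs_le_between in HZ1. lra.
      + destruct (Rle_lt_dec Z2 z) as [Hz'|Hz'].
        * apply Rle_trans with (2 := Rmax_r _ _). specialize (HZ2 z Hz'). apply Rabs_le_between in HZ2. lra.
        * apply Rle_trans with (2 := Rmax_l _ _). apply Hx1. split.
          apply Rle_trans with (1 := Rmin_l _ _). lra. apply Rle_trans with (2 := Rmax_r _ _). lra. }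
  exists (Derive phi). split; [auto|split; [auto|split; auto]].
  destruct Hb as [M HM].
  exists ((2 * M + (M + L * M)) * exp (Rabs c)).
  apply (bounded_derivative phi (Derive phi) _ c M (M + L * M)) with (2 := HDD); auto.
  intros z. replace (c * Derive phi z + phi z - delayed g (c * h) phi z - c * Derive phi z) with
    (phi z - delayed g (c * h) phi z) by ring.
  apply Rle_trans with (1 := Rabs_triang _ _). rewrite Rabs_Ropp. apply Rplus_le_compat; auto.
  unfold delayed. rewrite -(Rminus_0_r (g _)) -(ms_0 H).
  apply Rle_trans with (1 := ms_lip H _ _). rewrite Rminus_0_r.
  apply Rmult_le_compat_l; auto. lra.
Qed.

(** At a maximum above [kappa] the equation gives [phi z <= g (phi (z - c h)) <= g (phi z)], while
    [g] has slope at most [k < 1] above [kappa]. Strictness is the strong maximum principle for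
    [kappa - phi]. *)
Lemma wavefront_lt g kappa L G0 k dk h phi phi1 c : monostable g kappa L G0 k dk -> wavefront g h kappa phi c ->
  0 <= c * h -> sol c (delayed g (c * h) phi) phi phi1 -> forall z, 0 < phi z < kappa.
Proof.
  intros H [Hpos [Hm [Hp _]]] Hd Hs. assert (Hk := ms_kappa H).
  assert (Hle : forall z, phi z <= kappa).
  { intros z0. apply Rnot_lt_le. intros Hz0.
    set (mid := (kappa + phi z0) / 2).
    destruct (lim_m_infty phi 0 Hm (kappa / 2)) as [Z1 HZ1]. lra.
    destruct (lim_p_infty phi kappa Hp (mid - kappa)) as [Z2 HZ2]. unfold mid; lra.
    destruct (attained_max (fun z => phi z - mid) z0 (Rabs Z1 + Rabs Z2)) as [zm [Hm1 Hm2]].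
    - intros z. apply (ex_derive_continuous (fun z => phi z - mid)).
      eexists. apply is_derive_sub. apply (proj1 Hs). apply (is_derive_const mid z).
    - unfold mid; lra.
    - intros z Hz. unfold Rabs in Hz at 3.
      destruct (Rcase_abs z) as [Hneg|Hpz].
      + assert (Hz1 : z <= Z1). { generalize (Rle_abs (- Z1)) (Rabs_pos Z2). rewrite Rabs_Ropp. lra. }
        specialize (HZ1 z Hz1). apply Rabs_le_between in HZ1. unfold mid; lra.
      + assert (Hz1 : Z2 <= z). { generalize (Rle_abs Z2) (Rabs_pos Z1). lra. }
        specialize (HZ2 z Hz1). apply Rabs_le_between in HZ2. lra.
    - destruct Hs as [S1 [S2 _]].
      assert (E1 : phi1 zm = 0).
      { apply (local_max_derive phi zm _ 1); auto; try lra. intros y _. specialize (Hm2 y). lra. }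
      assert (E2 : c * phi1 zm + phi zm - delayed g (c * h) phi zm <= 0).
      { apply (local_max_derive2 phi phi1 zm _ 1); auto; try lra. intros y _. specialize (Hm2 y). lra. }
      rewrite E1 in E2.
      assert (E3 : g (phi (zm - c * h)) <= g (phi zm)).
      { apply (ms_mono H). specialize (Hm2 (zm - c * h)). lra. }
      assert (E4 : kappa < phi zm) by (unfold mid in Hm1; lra).
      assert (E5 := ms_neark H (phi zm) kappa (phi zm)).
      assert (Hdk := ms_dk H). assert (Hkb := ms_kbd H).
      assert (E6 := E5 ltac:(lra) ltac:(lra) ltac:(lra)). rewrite (ms_k H) in E6.
      unfold delayed in E2. nra. }
  intros z. split; auto.
  destruct (Rle_lt_or_eq_dec _ _ (Hle z)) as [|Hz]; auto. exfalso.
  assert (Hs' := sol_lin c _ _ _ _ _ _ 1 (-1) (sol_const c kappa) Hs).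
  destruct (lim_m_infty phi 0 Hm (kappa / 2)) as [Z1 HZ1]. lra.
  assert (E : 1 * kappa + -1 * phi Z1 = 0).
  { apply (sol_zero c _ (fun z => 1 * kappa + -1 * phi z) _ z Hs').
    - intros w. assert (delayed g (c * h) phi w <= kappa); [|lra].
      rewrite -(ms_k H). apply (ms_mono H). auto.
    - rewrite Hz. ring. }
  specialize (HZ1 Z1 (Rle_refl _)). apply Rabs_le_between in HZ1. lra.
Qed.

(** Convexity in the exponent: the exponential lies above its tangent at [l], and interpolating the
    quadratic part between the two roots leaves [- (l - l1)(l2 - l)(l2 - l1)], which is strictly
    negative. *)
Lemma chi_neg g h c l1 l2 l : 0 < Derive g 0 -> lambda12 g h c l1 l2 -> l1 < l < l2 -> chi g h l c < 0.
Proof.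
  intros HG [Hl1 [Hl12 [H1 [H2 _]]]] Hl. unfold chi in *.
  set (G := Derive g 0) in *.
  assert (Hconv : forall x y, exp y * (1 + (x - y)) <= exp x).
  { intros x y. replace x with (y + (x - y)) at 2 by ring. rewrite exp_plus.
    apply Rmult_le_compat_l. left; apply exp_pos. apply exp_ineq1_le. }
  assert (C1 := Hconv (- (l1 * c * h)) (- (l * c * h))).
  assert (C2 := Hconv (- (l2 * c * h)) (- (l * c * h))).
  set (E := exp (- (l * c * h))) in *. set (E1 := exp (- (l1 * c * h))) in *. set (E2 := exp (- (l2 * c * h))) in *.
  assert (HE : E * (l2 - l1) <= (l2 - l) * E1 + (l - l1) * E2).
  { apply Rle_trans with ((l2 - l) * (E * (1 + (- (l1 * c * h) - - (l * c * h)))) + (l - l1) * (E * (1 + (- (l2 * c * h) - - (l * c * h))))).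
    right; ring. apply Rplus_le_compat; apply Rmult_le_compat_l; lra. }
  assert (HGE : G * E * (l2 - l1) <= (l2 - l) * (G * E1) + (l - l1) * (G * E2)) by nra.
  assert (HGE1 : G * E1 = 1 + c * l1 - l1 ^ 2) by lra.
  assert (HGE2 : G * E2 = 1 + c * l2 - l2 ^ 2) by lra.
  rewrite HGE1 HGE2 in HGE.
  assert (Hq : (l ^ 2 - c * l - 1 + G * E) * (l2 - l1) < 0).
  { apply Rle_lt_trans with ((l ^ 2 - c * l - 1) * (l2 - l1) + ((l2 - l) * (1 + c * l1 - l1 ^ 2) + (l - l1) * (1 + c * l2 - l2 ^ 2))).
    lra. replace ((l ^ 2 - c * l - 1) * (l2 - l1) + ((l2 - l) * (1 + c * l1 - l1 ^ 2) + (l - l1) * (1 + c * l2 - l2 ^ 2)))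
    with (- ((l - l1) * (l2 - l) * (l2 - l1))) by ring.
    assert (0 < (l - l1) * (l2 - l)) by (apply Rmult_lt_0_compat; lra).
    assert (0 < (l - l1) * (l2 - l) * (l2 - l1)) by (apply Rmult_lt_0_compat; lra). lra. }
  nra.
Qed.

(* If [phi e^{-lz}] came back below a level between two larger values it would have an interior local
   maximum, which [chi l c < 0] forbids. *)
Lemma decay_dichotomy g kappa L G0 k dk d c l phi phi1 eps : monostable g kappa L G0 k dk ->
  0 <= d -> 0 < l -> 0 < eps -> l ^ 2 - c * l - 1 + (G0 + eps) * exp (- (l * d)) < 0 ->
  sol c (delayed g d phi) phi phi1 -> (forall z, 0 < phi z < kappa) -> is_lim phi m_infty 0 ->
  (exists B, forall z, phi z <= B * exp (l * z)) \/
  (forall M, exists Z, forall z, z <= Z -> M * exp (l * z) <= phi z).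
Proof.
  intros H Hd Hl He Hchi Hs Hr Hm. assert (Hk := ms_kappa H).
  destruct (classic (forall M, exists Z, forall z, z <= Z -> M * exp (l * z) <= phi z)) as [|Hn]; [auto|left].
  apply not_all_ex_not in Hn. destruct Hn as [M HM].
  assert (HM' : forall Z, exists z, z <= Z /\ phi z < M * exp (l * z)).
  { intros Z. apply NNPP. intros Hc. apply HM. exists Z. intros z Hz. apply Rnot_lt_le. intros Hlt.
    apply Hc. exists z; auto. }
  destruct (ms_near0 H eps He) as [del [Hdel Hsl]].
  destruct (lim_m_infty phi 0 Hm del Hdel) as [Z0 HZ0].
  assert (Hf : forall z, 0 <= delayed g d phi z).
  { intros z. apply (ms_range H). specialize (Hr (z - d)). lra. }
  assert (Hgr := sol_grow c _ phi phi1 Hs Hf).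
  (* [sol_grow] controls [phi e^{- l z}] on the whole delay window [[z2 - d, z2]] through the value
     at [z2]; [M1] is the resulting bound. *)
  set (M1 := M * exp (- nun c * d) * exp (l * d)).
  set (B := Rmax M1 (kappa * exp (- l * Z0))).
  assert (HB1 : M1 <= B) by apply Rmax_l. assert (HB2 : kappa * exp (- l * Z0) <= B) by apply Rmax_r.
  assert (HBpos : 0 < B).
  { apply Rlt_le_trans with (2 := HB2). apply Rmult_lt_0_compat; auto. apply exp_pos. }
  assert (Hexp : forall z, exp (- l * z) * exp (l * z) = 1).
  { intros z. rewrite -exp_plus. replace (- l * z + l * z) with 0 by ring. apply exp_0. }
  exists B. intros z1. destruct (Rle_lt_dec Z0 z1) as [Hz1|Hz1].
  { apply Rle_trans with (kappa * exp (- l * Z0) * exp (l * z1)).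
    - rewrite Rmult_assoc -exp_plus. rewrite <- (Rmult_1_r (phi z1)).
      apply Rmult_le_compat; try lra. specialize (Hr z1); lra. specialize (Hr z1); lra.
      rewrite -exp_0. apply exp_le_mono. nra.
    - apply Rmult_le_compat_r; auto. left; apply exp_pos. }
  apply Rnot_lt_le. intros Hlt.
  destruct (HM' (z1 - 1)) as [z2 [Hz2 Hphi2]].
  set (r := fun z => phi z * exp (- l * z)).
  assert (Hrphi : forall z, phi z = r z * exp (l * z)).
  { intros z. unfold r. rewrite Rmult_assoc Hexp. ring. }
  (* The maximum exceeds [B], which bounds [r] on the delay window and at [Z0], so it lies inside
     [(z2, Z0)]; the delayed point [zm - d] still belongs to the interval of comparison. *)
  destruct (continuity_ab_maj r (z2 - d) Z0) as [zm [Hm1 Hm2]]. lra.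
  { intros z _. apply continuity_pt_filterlim, (ex_derive_continuous r z). unfold r.
    eexists. apply is_derive_mul_exp. apply (proj1 Hs). }
  assert (Hrz1 : B < r z1).
  { unfold r. apply Rmult_lt_reg_r with (exp (l * z1)). apply exp_pos. rewrite Rmult_assoc Hexp. lra. }
  assert (Hrm : B < r zm). { apply Rlt_le_trans with (1 := Hrz1). apply Hm1. lra. }
  assert (Hleft : forall z, z2 - d <= z <= z2 -> r z <= B).
  { intros z Hz. apply Rle_trans with (2 := HB1). unfold r, M1.
    destruct (Hgr z z2 (proj2 Hz)) as [_ G].
    apply Rle_trans with (phi z2 * exp (- nun c * (z2 - z)) * exp (- l * z)).
    apply Rmult_le_compat_r; auto. left; apply exp_pos.
    apply Rle_trans with (M * exp (l * z2) * exp (- nun c * (z2 - z)) * exp (- l * z)).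
    - apply Rmult_le_compat_r. left; apply exp_pos. apply Rmult_le_compat_r. left; apply exp_pos. lra.
    - assert (HMpos : 0 < M).
      { specialize (Hr z2). generalize (exp_pos (l * z2)). nra. }
      rewrite !Rmult_assoc -!exp_plus. apply Rmult_le_compat_l. lra. apply exp_le_mono.
      generalize (nu_sign c). nra. }
  assert (Hzm : z2 < zm < Z0).
  { split.
    - apply Rnot_le_lt. intros Hc. specialize (Hleft zm). lra.
    - apply Rnot_le_lt. intros Hc. assert (zm = Z0) by lra. subst zm.
      assert (r Z0 <= kappa * exp (- l * Z0)); [|lra]. unfold r. apply Rmult_le_compat_r.
      left; apply exp_pos. specialize (Hr Z0); lra. }
  set (RR := r zm) in *.
  destruct Hs as [S1 [S2 _]].
  set (dd := Rmin (zm - z2) (Z0 - zm)).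
  assert (Hdd : 0 < dd) by (apply Rmin_pos; lra).
  assert (D1 : dd <= zm - z2) by apply Rmin_l. assert (D2 : dd <= Z0 - zm) by apply Rmin_r.
  assert (Hexpd : forall a z : R, is_derive (fun z => a * exp (l * z)) z (a * l * exp (l * z))).
  { intros a z. auto_derive; auto. ring. }
  assert (Hmax : forall y, Rabs (y - zm) < dd -> phi y - RR * exp (l * y) <= phi zm - RR * exp (l * zm)).
  { intros y Hy. apply Rabs_lt_between in Hy. rewrite !Hrphi. fold RR.
    assert (r y <= RR) by (apply Hm1; lra). generalize (exp_pos (l * y)). nra. }
  assert (E1 : phi1 zm - RR * l * exp (l * zm) = 0).
  { apply (local_max_derive (fun z => phi z - RR * exp (l * z)) zm _ dd Hdd); auto.
    apply is_derive_sub; auto. }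
  assert (E2 : c * phi1 zm + phi zm - delayed g d phi zm - RR * l * l * exp (l * zm) <= 0).
  { apply (local_max_derive2 (fun z => phi z - RR * exp (l * z)) (fun z => phi1 z - RR * l * exp (l * z)) zm _ dd Hdd); auto.
    - intros y _. apply is_derive_sub; auto.
    - apply is_derive_sub; auto. }
  assert (E3 : delayed g d phi zm <= (G0 + eps) * (RR * exp (l * zm) * exp (- (l * d)))).
  { unfold delayed. assert (Hp := Hr (zm - d)).
    assert (HZ := HZ0 (zm - d) ltac:(lra)). rewrite Rminus_0_r Rabs_pos_eq in HZ; [|lra].
    assert (Hsl' := Hsl 0 0 (phi (zm - d)) (Rle_refl 0) ltac:(lra) HZ).
    rewrite (ms_0 H) !Rminus_0_r in Hsl'.
    apply Rle_trans with ((G0 + eps) * phi (zm - d)). lra.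
    assert (HG := ms_G0 H).
    apply Rmult_le_compat_l. lra. rewrite Hrphi Rmult_assoc -exp_plus.
    replace (l * zm + - (l * d)) with (l * (zm - d)) by ring.
    apply Rmult_le_compat_r. left; apply exp_pos. apply Hm1. lra. }
  assert (E4 : phi zm = RR * exp (l * zm)) by apply Hrphi.
  assert (Hpos : 0 < RR * exp (l * zm)). { rewrite -E4. apply Hr. }
  rewrite E4 in E2.
  assert (E5 : phi1 zm = l * (RR * exp (l * zm))) by lra. rewrite E5 in E2.
  set (P := RR * exp (l * zm)) in *.
  assert (0 < P * - (l ^ 2 - c * l - 1 + (G0 + eps) * exp (- (l * d)))) by (apply Rmult_lt_0_compat; lra).
  replace (RR * l * l * exp (l * zm)) with (l * l * P) in E2 by (unfold P; ring). nra.
Qed.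

(** * The weight, and supersolutions built from a slowly decaying front *)

Lemma eta_pos l z : 0 < eta l z.
Proof. apply Rmin_pos. apply exp_pos. lra. Qed.

Lemma eta_le_1 l z : eta l z <= 1.
Proof. apply Rmin_r. Qed.

Lemma eta_le_exp l z : eta l z <= exp (l * z).
Proof. apply Rmin_l. Qed.

Lemma eta_right l z : 0 <= l -> 0 <= z -> eta l z = 1.
Proof. intros Hl Hz. apply Rmin_right. rewrite -exp_0. apply exp_le_mono. nra. Qed.

Lemma eta_left l z : 0 <= l -> z <= 0 -> eta l z = exp (l * z).
Proof. intros Hl Hz. apply Rmin_left. rewrite -exp_0. apply exp_le_mono. nra. Qed.

Lemma Rmin_continuous (f g : R -> R) x : continuous f x -> continuous g x ->
  continuous (fun z => Rmin (f z) (g z)) x.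
Proof.
  intros Hf Hg. apply continuous_of_near. intros eps He.
  destruct (continuous_near f x eps Hf He) as [d1 [Hd1 H1]].
  destruct (continuous_near g x eps Hg He) as [d2 [Hd2 H2]].
  exists (Rmin d1 d2). split. apply Rmin_pos; auto. intros y Hy.
  assert (A1 := H1 y (Rlt_le_trans _ _ _ Hy (Rmin_l _ _))).
  assert (A2 := H2 y (Rlt_le_trans _ _ _ Hy (Rmin_r _ _))).
  apply Rabs_lt_between in A1. apply Rabs_lt_between in A2. apply Rabs_lt_between.
  unfold Rmin. destruct (Rle_dec (f y) (g y)); destruct (Rle_dec (f x) (g x)); lra.
Qed.

Lemma eta_continuous l z : continuous (eta l) z.
Proof.
  apply (Rmin_continuous (fun z => exp (l * z)) (fun _ => 1)).
  - apply (ex_derive_continuous (fun z => exp (l * z))). auto_derive; auto.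
  - apply continuous_const.
Qed.

Lemma eta_shift l z s : 0 <= l -> 0 <= s -> eta l (z + s) <= eta l z * exp (l * s).
Proof.
  intros Hl Hs. assert (H1 : 1 <= exp (l * s)). { rewrite -exp_0. apply exp_le_mono. nra. }
  unfold eta at 2. unfold Rmin. destruct (Rle_dec (exp (l * z)) 1).
  - rewrite -exp_plus. replace (l * z + l * s) with (l * (z + s)) by ring. apply eta_le_exp.
  - apply Rle_trans with 1. apply eta_le_1. lra.
Qed.

Lemma exp_derive_cmul (a l z : R) : is_derive (fun z => a * exp (l * z)) z (a * l * exp (l * z)).
Proof. auto_derive; auto. ring. Qed.

(* [C e^{lz}] and [C] are both barriers for [y]. *)
Lemma sol_le_eta c f y y1 l d m C : sol c f y y1 -> 0 < l -> 0 < 1 + c * l - l ^ 2 -> 0 <= m ->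
  (forall z, f z <= m * eta l (z - d)) -> m <= C ->
  m * exp (- (l * d)) <= C * (1 + c * l - l ^ 2) -> forall z, y z <= C * eta l z.
Proof.
  intros Hs Hl Hden Hm Hf HC1 HC2 z. assert (HC : 0 <= C) by lra.
  assert (A1 : y z <= C).
  { apply (sol_le c f _ y y1 _ _ Hs (sol_const c C)). intros t. apply Rle_trans with (1 := Hf t).
    generalize (eta_le_1 l (t - d)). nra. }
  assert (A2 : y z - C * exp (l * z) <= 0).
  { destruct Hs as [S1 [S2 [[M HM] _]]].
    apply (max_principle c (fun z => y z - C * exp (l * z)) (fun z => y1 z - C * l * exp (l * z))
             (fun z => (c * y1 z + y z - f z) - C * l * l * exp (l * z)) M).
    - intros t. apply is_derive_sub; auto. apply exp_derive_cmul.
    - intros t. apply is_derive_sub; auto. apply exp_derive_cmul.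
    - intros t. specialize (HM t). apply Rabs_le_between in HM. generalize (exp_pos (l * t)). nra.
    - intros t _. assert (Hft : f t <= C * (1 + c * l - l ^ 2) * exp (l * t)).
      { apply Rle_trans with (1 := Hf t). apply Rle_trans with (m * exp (- (l * d)) * exp (l * t)).
        - rewrite Rmult_assoc -exp_plus. replace (- (l * d) + l * t) with (l * (t - d)) by ring.
          apply Rmult_le_compat_l; auto. apply eta_le_exp.
        - apply Rmult_le_compat_r; auto. left; apply exp_pos. }
      replace (c * y1 t + y t - f t - C * l * l * exp (l * t) - c * (y1 t - C * l * exp (l * t)) - (y t - C * exp (l * t)))
        with (C * (1 + c * l - l ^ 2) * exp (l * t) - f t) by ring. lra. }
  unfold eta, Rmin. destruct (Rle_dec (exp (l * z)) 1); lra.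
Qed.

(* [V = min (phi, B e^{lz}) + q eta]: the minimum is a supersolution because [phi] dominates [B e^{lz}] at
   [-oo], it is strict on compact sets, and [q eta] makes it strict at both ends. *)
Lemma slow_strict_super g kappa L G0 k dk c d l phi phi1 eps : monostable g kappa L G0 k dk ->
  0 <= d -> 0 < l -> 0 < eps < G0 -> l ^ 2 - c * l - 1 + (G0 + eps) * exp (- (l * d)) < 0 ->
  sol c (delayed g d phi) phi phi1 -> (forall z, 0 < phi z < kappa) ->
  is_lim phi m_infty 0 -> is_lim phi p_infty kappa ->
  (forall M, exists Z, forall z, z <= Z -> M * exp (l * z) <= phi z) ->
  exists (V y y1 : R -> R) (CV m : R), 0 < m /\ 0 < CV /\ (forall z, continuous V z) /\
    (forall z, 0 <= V z <= CV * eta l z) /\ sol c (delayed g d V) y y1 /\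
    (forall z, y z <= V z - m * eta l z).
Proof.
  intros H Hd Hl Heps Hchi Hs Hr Hminf Hpinf Hslow.
  assert (Hk := ms_kappa H). assert (HL := ms_L H).
  assert (HG := ms_G0 H). assert (Hdk := ms_dk H).
  assert (Hkb := ms_kbd H).
  set (X := exp (- (l * d))) in *. assert (HX : 0 < X) by apply exp_pos.
  set (Q := 1 + c * l - l ^ 2).
  assert (HGX : 0 < (G0 + eps) * X) by (apply Rmult_lt_0_compat; lra).
  assert (HQ : (G0 + eps) * X < Q) by (unfold Q; lra).
  destruct (ms_near0 H eps (proj1 Heps)) as [del [Hdel Hsl]].
  destruct (lim_m_infty phi 0 Hminf del Hdel) as [Zd HZd].
  (* With this [B] the exponential reaches [kappa] at [Zd], so the minimum [w] is [phi] to the right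
     of [Zd], and the exponential bound on [g (w z)] holds on the whole line. *)
  set (B := kappa * exp (- l * Zd)).
  assert (HB : 0 < B) by (apply Rmult_lt_0_compat; auto; apply exp_pos).
  set (w := fun z => Rmin (phi z) (B * exp (l * z))).
  assert (Hw1 : forall z, w z <= phi z) by (intros; apply Rmin_l).
  assert (Hw2 : forall z, w z <= B * exp (l * z)) by (intros; apply Rmin_r).
  assert (Hw0 : forall z, 0 < w z).
  { intros z. apply Rmin_pos. apply Hr. apply Rmult_lt_0_compat; auto. apply exp_pos. }
  assert (Hwk : forall z, 0 <= w z <= kappa).
  { intros z. specialize (Hw1 z). specialize (Hw0 z). specialize (Hr z). lra. }
  assert (Hwc : forall z, continuous w z).
  { intros z. apply Rmin_continuous.
    - apply (sol_continuous c _ phi phi1 Hs).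
    - apply (ex_derive_continuous (fun z => B * exp (l * z))). auto_derive; auto. }
  assert (Hgw : forall z, g (w z) <= (G0 + eps) * B * exp (l * z)).
  { intros z. assert (Hez := exp_pos (l * z)). destruct (Rle_lt_dec z Zd) as [Hz|Hz].
    - assert (Hwd : w z <= del).
      { specialize (HZd z Hz). apply Rabs_le_between in HZd. specialize (Hw1 z). lra. }
      assert (Hsl' := Hsl 0 0 (w z) (Rle_refl 0) (proj1 (Hwk z)) Hwd).
      rewrite (ms_0 H) !Rminus_0_r in Hsl'.
      apply Rle_trans with ((G0 + eps) * w z). lra. rewrite Rmult_assoc. apply Rmult_le_compat_l. lra. auto.
    - apply Rle_trans with kappa. apply (ms_range H _ (Hwk z)).
      apply Rle_trans with (1 * (B * exp (l * z))).
      + unfold B. rewrite Rmult_1_l Rmult_assoc -exp_plus. rewrite <- (Rmult_1_r kappa) at 1.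
        apply Rmult_le_compat_l. lra. rewrite -exp_0. apply exp_le_mono. nra.
      + rewrite Rmult_assoc. apply Rmult_le_compat_r. nra. lra. }
  destruct (res_delayed g kappa L G0 k dk c d w H Hwc Hwk) as [y01 Hy0].
  set (y0 := res c (delayed g d w)) in *.
  assert (Hdiff := sol_lin c _ _ _ _ _ _ 1 (-1) Hs Hy0).
  assert (Hforc : forall z, 0 <= 1 * delayed g d phi z + -1 * delayed g d w z).
  { intros z. assert (delayed g d w z <= delayed g d phi z); [|lra]. apply (ms_mono H). auto. }
  (* Equality at one point would make the two forcings agree everywhere, although far to the left
     [phi > B e^{l z} = w] and [g] has slope at least [G0 - eps > 0]. *)
  assert (Hy0phi : forall z, y0 z < phi z).
  { intros z. assert (Hn := sol_nonneg c _ _ _ Hdiff Hforc z). cbv beta in Hn.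
    destruct (Rle_lt_or_eq_dec _ _ Hn) as [Hlt|Heq]; [lra|]. exfalso.
    assert (Hz := sol_zero c _ _ _ z Hdiff Hforc (eq_sym Heq)).
    assert (Hzf := sol_zero_forcing c _ _ _ Hdiff Hz).
    destruct (Hslow (B + 1)) as [Z HZ].
    set (z2 := Rmin Z Zd).
    assert (P1 : B * exp (l * z2) < phi z2).
    { assert (HH : (B + 1) * exp (l * z2) <= phi z2) by (apply HZ; apply Rmin_l). generalize (exp_pos (l * z2)). lra. }
    assert (P2 : phi z2 <= del).
    { assert (HH := HZd z2 (Rmin_r _ _)). apply Rabs_le_between in HH. lra. }
    assert (P3 : w z2 = B * exp (l * z2)) by (apply Rmin_right; lra).
    specialize (Hzf (z2 + d)). unfold delayed in Hzf. replace (z2 + d - d) with z2 in Hzf by ring.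
    assert (P4 := Hsl (w z2) (w z2) (phi z2) (Rle_refl _) ltac:(lra) P2).
    assert (0 < (G0 - eps) * (phi z2 - w z2)) by (apply Rmult_lt_0_compat; lra). lra. }
  (* The ratio by which the resolvent contracts [e^{l z}] under the linear bound [G0 + eps]. That
     [rho < 1] is the sign of the characteristic function in quantitative form, and the source of
     strictness at [-oo]. *)
  set (rho := (G0 + eps) * X / Q).
  assert (HrQ : rho * Q = (G0 + eps) * X) by (unfold rho; field; lra).
  assert (Hrho : 0 < rho < 1).
  { split. apply Rdiv_lt_0_compat; lra. apply Rmult_lt_reg_r with Q; lra. }
  assert (Hy0exp : forall z, y0 z <= rho * B * exp (l * z)).
  { intros z. assert (y0 z - rho * B * exp (l * z) <= 0); [|lra].
    destruct Hy0 as [S1 [S2 [[M HM] _]]].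
    assert (HrB : 0 < rho * B) by (apply Rmult_lt_0_compat; lra).
    apply (max_principle c (fun z => y0 z - rho * B * exp (l * z)) (fun z => y01 z - rho * B * l * exp (l * z))
             (fun z => (c * y01 z + y0 z - delayed g d w z) - rho * B * l * l * exp (l * z)) M).
    - intros t. apply is_derive_sub; auto. apply exp_derive_cmul.
    - intros t. apply is_derive_sub; auto. apply exp_derive_cmul.
    - intros t. specialize (HM t). apply Rabs_le_between in HM. generalize (exp_pos (l * t)). nra.
    - intros t _. assert (Hft : delayed g d w t <= rho * Q * B * exp (l * t)).
      { apply Rle_trans with (1 := Hgw (t - d)). rewrite HrQ.
        replace (l * (t - d)) with (- (l * d) + l * t) by ring. rewrite exp_plus. fold X. right; ring. }
      replace (c * y01 t + y0 t - delayed g d w t - rho * B * l * l * exp (l * t) - c * (y01 t - rho * B * l * exp (l * t)) - (y0 t - rho * B * exp (l * t)))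
        with (rho * Q * B * exp (l * t) - delayed g d w t) by (unfold Q; ring). lra. }
  assert (Hy0w : forall z, y0 z < w z).
  { intros z. apply Rmin_glb_lt; auto. apply Rle_lt_trans with (1 := Hy0exp z).
    generalize (exp_pos (l * z)). intros. apply Rmult_lt_compat_r; auto. nra. }
  (* The response constant: adding [q eta] to the argument of [g] raises the solution by at most
     [C1 q eta]. Later [q] is chosen so that this uses at most half of the gap [w - y0] in the left
     tail and in the middle. *)
  set (C1 := Rmax L (L * X / Q)).
  assert (HC1 : L <= C1) by apply Rmax_l.
  assert (HC1' : L * X <= C1 * Q).
  { apply Rle_trans with (L * X / Q * Q). right; field; lra. apply Rmult_le_compat_r. lra. apply Rmax_r. }
  assert (Hwright : exists Zk, 0 <= Zk /\ forall z, Zk <= z -> kappa - dk <= w (z - d)).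
  { destruct (lim_p_infty phi kappa Hpinf dk Hdk) as [Z1 HZ1].
    exists (Rmax 0 (Rmax Z1 Zd + d)). split. apply Rmax_l. intros z Hz.
    assert (A0 : Rmax Z1 Zd + d <= z). { apply Rle_trans with (2 := Hz). apply Rmax_r. }
    assert (A1 := Rmax_l Z1 Zd). assert (A2 := Rmax_r Z1 Zd).
    apply Rmin_glb.
    - specialize (HZ1 (z - d) ltac:(lra)). apply Rabs_le_between in HZ1. lra.
    - apply Rle_trans with kappa. lra. unfold B. rewrite Rmult_assoc -exp_plus. rewrite <- (Rmult_1_r kappa) at 1.
      apply Rmult_le_compat_l. lra. rewrite -exp_0. apply exp_le_mono. nra. }
  destruct Hwright as [Zk [HZk0 HZk]].
  assert (Hnun := nu_sign c).
  assert (HZm : exists Zm, Zk <= Zm /\ forall z, Zm <= z -> C1 * exp (nun c * (z - Zk)) <= (1 - k) / 2).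
  { destruct (exp_small (- nun c) ((1 - k) / 2 / C1) 0) as [v [Hv1 Hv2]]. lra. apply Rdiv_lt_0_compat; lra.
    exists (Zk - v). split. lra. intros z Hz.
    apply Rle_trans with (C1 * ((1 - k) / 2 / C1)); [|right; field; lra].
    apply Rmult_le_compat_l. lra. apply Rle_trans with (exp (- nun c * v)); [|lra]. apply exp_le_mono. nra. }
  destruct HZm as [Zm [HZm1 HZm2]].
  destruct (Hslow B) as [Zs HZs]. set (Z2 := Rmin Zs 0).
  assert (HZ2 : forall z, z <= Z2 -> w z = B * exp (l * z)).
  { intros z Hz. apply Rmin_right. apply HZs. apply Rle_trans with (1 := Hz). apply Rmin_l. }
  assert (HZ20 : Z2 <= 0) by apply Rmin_r.
  destruct (continuity_ab_min (fun z => w z - y0 z) Z2 Zm) as [zmin [Hmin1 Hmin2]]. lra.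
  { intros z _. apply continuity_pt_filterlim. apply (continuous_minus w y0); auto.
    apply (sol_continuous c _ y0 y01 Hy0). }
  set (m0 := w zmin - y0 zmin) in *.
  assert (Hm0 : 0 < m0). { unfold m0. specialize (Hy0w zmin). lra. }
  set (q := Rmin ((1 - rho) * B / (2 * C1)) (m0 / (2 * C1))).
  assert (Hq : 0 < q).
  { unfold q. apply Rmin_pos; apply Rdiv_lt_0_compat; try lra. apply Rmult_lt_0_compat; lra. }
  assert (Hq1 : C1 * q <= (1 - rho) * B / 2).
  { apply Rle_trans with (C1 * ((1 - rho) * B / (2 * C1))). apply Rmult_le_compat_l. lra. apply Rmin_l. right; field; lra. }
  assert (Hq2 : C1 * q <= m0 / 2).
  { apply Rle_trans with (C1 * (m0 / (2 * C1))). apply Rmult_le_compat_l. lra. apply Rmin_r. right; field; lra. }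
  set (V := fun z => w z + q * eta l z).
  assert (HVc : forall z, continuous V z).
  { intros z. apply (continuous_plus w (fun z => q * eta l z)); auto.
    apply (continuous_mult (fun _ => q) (eta l)). apply continuous_const. apply eta_continuous. }
  assert (HVw : forall z, w z <= V z <= w z + q).
  { intros z. unfold V. generalize (eta_pos l z) (eta_le_1 l z). nra. }
  destruct (res_sol c (delayed g d V) (L * (kappa + q))) as [y1 Hy].
  { apply delayed_continuous; auto. apply (ms_continuous H). }
  { intros z. unfold delayed. rewrite -(Rminus_0_r (g _)) -(ms_0 H).
    apply Rle_trans with (1 := ms_lip H _ _). rewrite Rminus_0_r.
    apply Rmult_le_compat_l. lra. specialize (HVw (z - d)). specialize (Hwk (z - d)). rewrite Rabs_pos_eq; lra. }
  set (y := res c (delayed g d V)) in *.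
  assert (HD := sol_lin c _ _ _ _ _ _ 1 (-1) Hy Hy0).
  assert (HF1 : forall z, 1 * delayed g d V z + -1 * delayed g d w z <= L * q * eta l (z - d)).
  { intros z. unfold delayed.
    assert (HH := ms_slopes H (w (z - d)) (V (z - d)) (w (z - d)) (V (z - d)) (Rle_refl _) (proj1 (HVw (z - d))) (Rle_refl _)).
    unfold V in HH at 4. lra. }
  assert (HDeta : forall z, 1 * y z + -1 * y0 z <= C1 * q * eta l z).
  { apply (sol_le_eta c _ _ _ l d (L * q) (C1 * q) HD Hl); auto; fold Q; fold X; try lra.
    - apply Rmult_le_pos; lra.
    - apply Rmult_le_compat_r; lra.
    - replace (L * q * X) with (q * (L * X)) by ring. replace (C1 * q * Q) with (q * (C1 * Q)) by ring.
      apply Rmult_le_compat_l; lra. }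
  (* On the right the response [C1 q] improves to nearly [k q]: the slope of [g] is at most [k]
     there, and the influence of the region left of [Zk] decays with exponent [nun]. *)
  assert (HDk : forall z, (1 * y z + -1 * y0 z) - (q * k + q * C1 * exp (nun c * (z - Zk))) <= 0).
  { destruct HD as [S1 [S2 [[M HM] _]]].
    assert (HqC : 0 < q * C1) by (apply Rmult_lt_0_compat; lra).
    apply (max_principle c _ (fun z => (1 * y1 z + -1 * y01 z) - (0 + q * C1 * (nun c * exp (nun c * (z - Zk)))))
       (fun z => (c * (1 * y1 z + -1 * y01 z) + (1 * y z + -1 * y0 z) - (1 * delayed g d V z + -1 * delayed g d w z))
           - (0 + q * C1 * (nun c * (nun c * exp (nun c * (z - Zk)))))) M).
    - intros t. apply is_derive_sub; auto. apply is_derive_add. apply (is_derive_const (q * k) t).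
      apply is_derive_cmul. auto_derive; auto. unfold Rminus. ring.
    - intros t. apply is_derive_sub; auto. apply is_derive_add. apply (is_derive_const 0 t).
      apply is_derive_cmul, is_derive_cmul. auto_derive; auto. unfold Rminus. ring.
    - intros t. specialize (HM t). apply Rabs_le_between in HM.
      assert (0 < q * C1 * exp (nun c * (t - Zk))) by (apply Rmult_lt_0_compat; auto; apply exp_pos).
      assert (0 <= q * k) by (apply Rmult_le_pos; lra). lra.
    - intros t Ht. cbv beta in Ht.
      assert (HtZ : Zk <= t).
      { apply Rnot_lt_le. intros Hlt. specialize (HDeta t). generalize (eta_le_1 l t). intros He1.
        assert (1 <= exp (nun c * (t - Zk))). { rewrite -exp_0. apply exp_le_mono. nra. }
        assert (0 <= q * k) by (apply Rmult_le_pos; lra).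
        assert (0 <= q * C1 * (exp (nun c * (t - Zk)) - 1)) by (apply Rmult_le_pos; lra).
        assert (0 <= q * C1 * (1 - eta l t)) by (apply Rmult_le_pos; lra). lra. }
      assert (HF2 : 1 * delayed g d V t + -1 * delayed g d w t <= q * k).
      { unfold delayed.
        assert (HH := ms_neark H (V (t - d)) (w (t - d)) (V (t - d)) (HZk t HtZ) (proj1 (HVw (t - d))) (Rle_refl _)).
        assert (HV2 := HVw (t - d)). nra. }
      assert (Enu : nun c * nun c = c * nun c + 1).
      { assert (E : nun c * nun c = (nup c + nun c) * nun c + 1) by (generalize (nu_prod c); lra).
        rewrite nu_sum in E. exact E. }
      set (E := exp (nun c * (t - Zk))) in *.
      replace (q * C1 * (nun c * (nun c * E))) with (q * C1 * ((c * nun c + 1) * E)) by (rewrite -Enu; ring).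
      lra. }
  set (m1 := Rmin (q * (1 - k) / 2) (Rmin ((1 - rho) * B / 2) (m0 / 2))).
  assert (Hm1 : 0 < m1).
  { unfold m1. repeat apply Rmin_pos; try lra.
    assert (0 < q * (1 - k)) by (apply Rmult_lt_0_compat; lra). lra.
    assert (0 < (1 - rho) * B) by (apply Rmult_lt_0_compat; lra). lra. }
  assert (Hm11 : m1 <= q * (1 - k) / 2) by apply Rmin_l.
  assert (Hm12 : m1 <= (1 - rho) * B / 2). { apply Rle_trans with (1 := Rmin_r _ _). apply Rmin_l. }
  assert (Hm13 : m1 <= m0 / 2). { apply Rle_trans with (1 := Rmin_r _ _). apply Rmin_r. }
  exists V, y, y1, (B + kappa + q), m1.
  split; [auto|split; [lra|split; [auto|split; [|split; [auto|]]]]].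
  - intros z. specialize (HVw z). specialize (Hwk z). split. lra.
    unfold V. assert (w z <= (B + kappa) * eta l z); [|lra].
    specialize (Hw2 z). unfold eta, Rmin. destruct (Rle_dec (exp (l * z)) 1).
    + generalize (exp_pos (l * z)). nra.
    + lra.
  - intros z. specialize (HDeta z). unfold V.
    assert (He := eta_pos l z). assert (He1 := eta_le_1 l z).
    destruct (Rle_lt_dec Zm z) as [Hz|Hz].
    + rewrite (eta_right l z); try lra. specialize (HDk z). specialize (HZm2 z Hz). specialize (Hy0w z).
      assert (q * (C1 * exp (nun c * (z - Zk))) <= q * ((1 - k) / 2)) by (apply Rmult_le_compat_l; lra). lra.
    + destruct (Rle_lt_dec z Z2) as [Hz2|Hz2].
      * rewrite (HZ2 z Hz2). specialize (Hy0exp z). rewrite (eta_left l z) in HDeta |- *; try lra.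
        assert (Hez := exp_pos (l * z)).
        assert (0 <= ((1 - rho) * B / 2 - C1 * q) * exp (l * z)) by (apply Rmult_le_pos; lra).
        assert (0 <= ((1 - rho) * B / 2 - m1) * exp (l * z)) by (apply Rmult_le_pos; lra).
        assert (0 < q * exp (l * z)) by (apply Rmult_lt_0_compat; lra). nra.
      * assert (Hmm : m0 <= w z - y0 z) by (apply Hmin1; lra).
        assert (C1 * q * eta l z <= C1 * q). { assert (0 < C1 * q) by (apply Rmult_lt_0_compat; lra). nra. }
        assert (m1 * eta l z <= m1) by nra. nra.
Qed.

(* With [y] and [m] as in [slow_strict_super], [min (y + (m / 2) eta, kappa)] is a supersolution at all
   speeds slightly below [c]. *)
Lemma slow_decay_slower_front g kappa L G0 k dk c h l phi phi1 eps : monostable g kappa L G0 k dk ->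
  0 <= h -> 0 <= c -> 0 < l -> 0 < eps < G0 -> l ^ 2 - c * l - 1 + (G0 + eps) * exp (- (l * (c * h))) < 0 ->
  sol c (delayed g (c * h) phi) phi phi1 -> (forall z, 0 < phi z < kappa) ->
  is_lim phi m_infty 0 -> is_lim phi p_infty kappa ->
  (forall M, exists Z, forall z, z <= Z -> M * exp (l * z) <= phi z) ->
  exists c' psi, c' < c /\ wavefront g h kappa psi c'.
Proof.
  intros H Hh Hc Hl Heps Hchi Hs Hr Hminf Hpinf Hslow.
  assert (Hd : 0 <= c * h) by (apply Rmult_le_pos; auto).
  destruct (slow_strict_super g kappa L G0 k dk c (c * h) l phi phi1 eps H Hd Hl Heps Hchi Hs Hr Hminf Hpinf Hslow)
    as [V [y [y1 [CV [m [Hm [HCV [HVc [HV [Hy HyV]]]]]]]]]].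
  assert (Hk := ms_kappa H). assert (HG := ms_G0 H).
  set (Q := 1 + c * l - l ^ 2).
  assert (HQ : 0 < Q).
  { assert (0 < (G0 + eps) * exp (- (l * (c * h)))) by (apply Rmult_lt_0_compat; [lra|apply exp_pos]). unfold Q. lra. }
  assert (Hnu := nu_sign c).
  assert (HfV : forall z, 0 <= delayed g (c * h) V z).
  { intros z. unfold delayed. rewrite -(ms_0 H). apply (ms_mono H). apply HV. }
  assert (Hy0 := sol_nonneg c _ y y1 Hy HfV).
  assert (Hyh := sol_harnack c _ y y1 Hy HfV).
  assert (Hyg := sol_grow c _ y y1 Hy HfV).
  assert (Heta := eta_pos l).
  assert (HyC : forall z, y z <= CV * eta l z).
  { intros z. specialize (HyV z). specialize (HV z). specialize (Heta z). nra. }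
  assert (HmC : m <= CV).
  { apply Rmult_le_reg_r with (eta l 0); auto. specialize (HyV 0). specialize (HV 0). specialize (Hy0 0). lra. }
  set (rho := 1 - m / (2 * CV)).
  assert (Hm2 : m / (2 * CV) * (2 * CV) = m) by (field; lra).
  assert (Hrho : / 2 <= rho < 1).
  { unfold rho. assert (0 < m / (2 * CV)) by (apply Rdiv_lt_0_compat; lra). nra. }
  (* The margin [m] yields [U <= rho V], so a factor [e^r = 1 / rho] is available. It pays for the
     shorter delay at the smaller speed, which amounts to a translation by [th h]. *)
  set (r := - ln rho).
  assert (Hrpos : 0 < r). { unfold r. rewrite -ln_1. assert (ln rho < ln 1) by (apply ln_increasing; lra). rewrite ln_1 in H0. rewrite ln_1. lra. }
  assert (Hexpr : exp r * rho = 1).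
  { unfold r. rewrite exp_Ropp exp_ln; [|lra]. field. lra. }
  set (b := Rmin 1 (Q / 2)).
  assert (Hb : 0 < b) by (apply Rmin_pos; lra).
  assert (Hb1 : b <= 1) by apply Rmin_l. assert (Hb2 : b <= Q / 2) by apply Rmin_r.
  assert (Hnh : 0 <= (nup c + l) * h) by (apply Rmult_le_pos; lra).
  (* The three bounds keep [1 + (c - th) l - l^2] at least [Q / 2], make the extra term [th y']
     small enough to be absorbed by the added [(m / 2) eta], and keep the loss from the translation
     at most [e^r]. *)
  set (th := Rmin (Q / (2 * l)) (Rmin (m / 2 * b / (nup c * CV)) (r / ((nup c + l) * h + 1)))).
  assert (HnC : 0 < nup c * CV) by (apply Rmult_lt_0_compat; lra).
  assert (Hth : 0 < th).
  { unfold th. repeat apply Rmin_pos; apply Rdiv_lt_0_compat; try lra. apply Rmult_lt_0_compat; lra. }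
  assert (T1 : th * l <= Q / 2).
  { apply Rle_trans with (Q / (2 * l) * l). apply Rmult_le_compat_r. lra. apply Rmin_l. right; field; lra. }
  assert (T2 : th * (nup c * CV) <= m / 2 * b).
  { apply Rle_trans with (m / 2 * b / (nup c * CV) * (nup c * CV)); [|right; field; lra].
    apply Rmult_le_compat_r. lra. apply Rle_trans with (1 := Rmin_r _ _). apply Rmin_l. }
  assert (T3 : (nup c + l) * (th * h) <= r).
  { apply Rle_trans with (th * ((nup c + l) * h + 1)). lra.
    apply Rle_trans with (r / ((nup c + l) * h + 1) * ((nup c + l) * h + 1)); [|right; field; lra].
    apply Rmult_le_compat_r. lra. apply Rle_trans with (1 := Rmin_r _ _). apply Rmin_r. }
  set (U := fun z => y z + m / 2 * eta l z).
  assert (HUpos : forall z, 0 < U z).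
  { intros z. unfold U. specialize (Hy0 z). specialize (Heta z). nra. }
  set (s := th * h) in *.
  assert (Hs0 : 0 <= s) by (apply Rmult_le_pos; lra).
  assert (HUV : forall z, U (z + s) <= V z).
  { intros z.
    assert (A1 : y (z + s) <= y z * exp ((nup c + l) * s)).
    { destruct (Hyg z (z + s) ltac:(lra)) as [G _]. replace (z + s - z) with s in G by ring.
      apply Rle_trans with (1 := G). apply Rmult_le_compat_l; auto. apply exp_le_mono. nra. }
    assert (A2 : eta l (z + s) <= eta l z * exp ((nup c + l) * s)).
    { apply Rle_trans with (1 := eta_shift l z s (Rlt_le _ _ Hl) Hs0). apply Rmult_le_compat_l. left; auto.
      apply exp_le_mono. nra. }
    assert (A3 : U (z + s) <= U z * exp ((nup c + l) * s)).
    { unfold U. rewrite Rmult_plus_distr_r. apply Rplus_le_compat; auto. rewrite Rmult_assoc.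
      apply Rmult_le_compat_l; lra. }
    assert (A4 : exp ((nup c + l) * s) <= exp r) by (apply exp_le_mono; auto).
    assert (A5 : U z <= rho * V z).
    { unfold U. specialize (HyV z). destruct (HV z) as [V1 V2]. unfold rho.
      assert (m / (2 * CV) * V z <= m / 2 * eta l z).
      { apply Rle_trans with (m / (2 * CV) * (CV * eta l z)). apply Rmult_le_compat_l; auto.
        left. apply Rdiv_lt_0_compat; lra. right. field. lra. }
      lra. }
    apply Rle_trans with (1 := A3). apply Rle_trans with (U z * exp r).
    apply Rmult_le_compat_l; auto. left; auto.
    apply Rle_trans with (rho * V z * exp r). apply Rmult_le_compat_r; auto. left; apply exp_pos.
    replace (rho * V z * exp r) with (exp r * rho * V z) by ring. rewrite Hexpr. lra. }
  assert (HUc : forall z, continuous U z).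
  { intros z. apply (continuous_plus y (fun z => m / 2 * eta l z)).
    apply (sol_continuous c _ y y1 Hy).
    apply (continuous_mult (fun _ => m / 2) (eta l)). apply continuous_const. apply eta_continuous. }
  set (W := fun z => Rmin (U z) kappa).
  exists (c - th).
  destruct (front_from_super g kappa L G0 k dk h (c - th) W H) as [psi Hpsi].
  - intros z. apply (Rmin_continuous U (fun _ => kappa)); auto. apply continuous_const.
  - intros z. unfold W. split. apply Rmin_glb. left; auto. lra. apply Rmin_r.
  - intros x x1 Hx.
    assert (HWr : forall z, 0 <= W z <= kappa).
    { intros z. unfold W. split. apply Rmin_glb. left; auto. lra. apply Rmin_r. }
    assert (Hxk := sol_delayed_range g kappa L G0 k dk (c - th) _ W x x1 H HWr Hx).
    assert (Hgle : forall z, delayed g ((c - th) * h) W z <= delayed g (c * h) V z).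
    { intros z. apply (ms_mono H). apply Rle_trans with (1 := Rmin_l _ _).
      replace (z - (c - th) * h) with (z - c * h + s) by (unfold s; ring). auto. }
    assert (Hth2 : forall z, th * y1 z <= m / 2 * b * eta l z).
    { intros z. apply Rle_trans with (th * (nup c * (CV * eta l z))).
      apply Rmult_le_compat_l. lra. destruct (Hyh z) as [_ G]. apply Rle_trans with (1 := G).
      apply Rmult_le_compat_l. lra. auto.
      replace (th * (nup c * (CV * eta l z))) with (th * (nup c * CV) * eta l z) by ring.
      apply Rmult_le_compat_r; auto. left; auto. }
    destruct Hx as [X1 [X2 [[M HM] _]]]. destruct Hy as [Y1 [Y2 _]].
    intros z. unfold W. apply Rmin_glb; [|apply Hxk].
    (* [U] is the minimum of [y + m / 2] and [y + (m / 2) e^{l z}]; each of them is smooth and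
       dominates the solution separately. *)
    assert (B1 : x z - (y z + m / 2) <= 0).
    { apply (max_principle (c - th) (fun z => x z - (y z + m / 2)) (fun z => x1 z - (y1 z + 0))
        (fun z => ((c - th) * x1 z + x z - delayed g ((c - th) * h) W z) - ((c * y1 z + y z - delayed g (c * h) V z) + 0)) M).
      - intros t. apply is_derive_sub; auto. apply is_derive_add; auto. apply (is_derive_const (m / 2) t).
      - intros t. apply is_derive_sub; auto. apply is_derive_add; auto. apply (is_derive_const 0 t).
      - intros t. specialize (HM t). apply Rabs_le_between in HM. specialize (Hy0 t). lra.
      - intros t _. specialize (Hgle t). specialize (Hth2 t).
        assert (m / 2 * b * eta l t <= m / 2).
        { rewrite Rmult_assoc. rewrite <- (Rmult_1_r (m / 2)) at 2. apply Rmult_le_compat_l. lra.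
          generalize (eta_le_1 l t) (eta_pos l t). nra. }
        lra. }
    assert (B2 : x z - (y z + m / 2 * exp (l * z)) <= 0).
    { apply (max_principle (c - th) (fun z => x z - (y z + m / 2 * exp (l * z))) (fun z => x1 z - (y1 z + m / 2 * l * exp (l * z)))
        (fun z => ((c - th) * x1 z + x z - delayed g ((c - th) * h) W z) - ((c * y1 z + y z - delayed g (c * h) V z) + m / 2 * l * l * exp (l * z))) M).
      - intros t. apply is_derive_sub; auto. apply is_derive_add; auto. apply exp_derive_cmul.
      - intros t. apply is_derive_sub; auto. apply is_derive_add; auto. apply exp_derive_cmul.
      - intros t. specialize (HM t). apply Rabs_le_between in HM. specialize (Hy0 t). generalize (exp_pos (l * t)). nra.
      - intros t _. specialize (Hgle t). specialize (Hth2 t). assert (Het := exp_pos (l * t)).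
        assert (m / 2 * b * eta l t <= m / 2 * (1 + (c - th) * l - l ^ 2) * exp (l * t)).
        { apply Rmult_le_compat; try (left; auto; fail).
          apply Rmult_le_pos; lra. apply Rmult_le_compat_l. lra. unfold Q in *. lra. apply eta_le_exp. }
        lra. }
    unfold U, eta, Rmin. destruct (Rle_dec (exp (l * z)) 1); lra.
  - exists 0, (Rmin (m / 2) kappa). split. apply Rmin_pos; lra. intros z Hz. unfold W, U.
    rewrite eta_right; try lra. apply Rle_min_compat_r. specialize (Hy0 z). lra.
  - intros e He. destruct (exp_small l (e / (2 * CV)) 0 Hl) as [z [_ Hz]]. apply Rdiv_lt_0_compat; lra.
    exists z. apply Rle_trans with (1 := Rmin_l _ _). unfold U.
    assert (HU1 : y z + m / 2 * eta l z <= 2 * CV * exp (l * z)).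
    { specialize (HyC z). generalize (eta_le_exp l z) (eta_pos l z). intros. nra. }
    apply Rle_trans with (1 := HU1). apply Rle_trans with (2 * CV * (e / (2 * CV))).
    apply Rmult_le_compat_l; lra. right; field; lra.
  - exists psi. split; [lra|auto].
Qed.

Lemma chi_slack g h c l : chi g h l c < 0 -> 1 < Derive g 0 ->
  exists eps, 0 < eps < Derive g 0 /\ l ^ 2 - c * l - 1 + (Derive g 0 + eps) * exp (- (l * (c * h))) < 0.
Proof.
  intros Hchi HG. unfold chi in Hchi.
  replace (- (l * c * h)) with (- (l * (c * h))) in Hchi by ring.
  set (X := exp (- (l * (c * h)))) in *. assert (HX : 0 < X) by apply exp_pos.
  set (a := - (l ^ 2 - c * l - 1 + Derive g 0 * X)).
  assert (Ha : 0 < a) by (unfold a; lra).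
  exists (Rmin (1 / 2) (a / (2 * X))).
  assert (0 < a / (2 * X)) by (apply Rdiv_lt_0_compat; lra).
  split.
  - split. apply Rmin_pos; lra. apply Rle_lt_trans with (1 := Rmin_l _ _). lra.
  - assert (Rmin (1 / 2) (a / (2 * X)) * X <= a / 2).
    { apply Rle_trans with (a / (2 * X) * X). apply Rmult_le_compat_r. lra. apply Rmin_r. right; field; lra. }
    unfold a in *. lra.
Qed.

Lemma minimal_front_fast g kappa L k dk h phi phi1 cs l : monostable g kappa L (Derive g 0) k dk ->
  0 <= h -> 0 <= cs -> 0 < l -> chi g h l cs < 0 -> min_speed g h kappa cs ->
  wavefront g h kappa phi cs -> sol cs (delayed g (cs * h) phi) phi phi1 ->
  exists B, forall z, phi z <= B * exp (l * z).
Proof.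
  intros H Hh Hc Hl Hchi [_ Hmin] Hw Hs.
  assert (HG := ms_G0 H).
  destruct (chi_slack g h cs l Hchi HG) as [eps [He1 He2]].
  assert (Hd : 0 <= cs * h) by (apply Rmult_le_pos; auto).
  assert (Hr := wavefront_lt g kappa L _ k dk h phi phi1 cs H Hw Hd Hs).
  assert (Hw' := Hw). destruct Hw' as [_ [Hm [Hp _]]].
  destruct (decay_dichotomy g kappa L _ k dk (cs * h) cs l phi phi1 eps H Hd Hl (proj1 He1) He2 Hs Hr Hm) as [HB|Hslow]; auto.
  exfalso.
  destruct (slow_decay_slower_front g kappa L _ k dk cs h l phi phi1 eps H Hh Hc Hl He1 He2 Hs Hr Hm Hp Hslow)
    as [c' [psi [Hc' Hpsi]]].
  specialize (Hmin psi c' Hpsi). lra.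
Qed.

(* The maximum principle near both ends, in the weight [eta l]: the order between [phi] and a
   translate only has to be checked on a fixed compact interval. *)
Lemma order_from_core g kappa L G0 k dk c d l l' B phi phi1 eps : monostable g kappa L G0 k dk ->
  0 <= d -> 0 < l < l' -> 0 < eps -> l ^ 2 - c * l - 1 + (G0 + eps) * exp (- (l * d)) < 0 ->
  sol c (delayed g d phi) phi phi1 -> (forall z, 0 < phi z < kappa) ->
  is_lim phi m_infty 0 -> is_lim phi p_infty kappa -> (forall z, phi z <= B * exp (l' * z)) ->
  exists Z, 0 < Z /\ forall s, 0 <= s -> (forall z, - Z <= z <= Z -> phi z <= phi (z + s)) ->
    forall z, phi z <= phi (z + s).
Proof.
  intros H Hd Hl Heps Hchi Hs Hr Hminf Hpinf HB.
  assert (Hdk := ms_dk H). assert (Hkb := ms_kbd H).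
  assert (HG := ms_G0 H).
  destruct (ms_near0 H eps Heps) as [del [Hdel Hsl]].
  destruct (lim_m_infty phi 0 Hminf del Hdel) as [Z1 HZ1].
  destruct (lim_p_infty phi kappa Hpinf dk Hdk) as [Z2 HZ2].
  set (Z := Rmax 1 (Rmax (- Z1) (Z2 + d))).
  assert (HZa : 1 <= Z) by apply Rmax_l.
  assert (HZb : - Z1 <= Z). { apply Rle_trans with (2 := Rmax_r _ _). apply Rmax_l. }
  assert (HZc : Z2 + d <= Z). { apply Rle_trans with (2 := Rmax_r _ _). apply Rmax_r. }
  exists Z. split. lra. intros s Hs0 Hcore z0.
  apply Rnot_lt_le. intros Hz0.
  set (D := fun z => phi z - phi (z + s)).
  (* [wt] is the reciprocal of [eta l]; the argument maximises the weighted difference [D wt]. *)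
  set (wt := fun z => Rmax (exp (- l * z)) 1).
  assert (Hwt : forall z, wt z * eta l z = 1).
  { intros z. unfold wt, eta. destruct (Rle_lt_dec z 0) as [Hz|Hz].
    - rewrite Rmax_left ?Rmin_left. rewrite -exp_plus -exp_0. f_equal. ring.
      rewrite -exp_0; apply exp_le_mono; nra. rewrite -exp_0; apply exp_le_mono; nra.
    - rewrite Rmax_right ?Rmin_right. ring.
      rewrite -exp_0; apply exp_le_mono; nra. rewrite -exp_0; apply exp_le_mono; nra. }
  assert (Hwtpos : forall z, 0 < wt z). { intros z. apply Rlt_le_trans with (2 := Rmax_r _ _). lra. }
  assert (HD0 : 0 < D z0) by (unfold D; lra).
  (* Half of the weighted violation is the threshold: [phi wt] tends to 0 on the left since
     [l' > l], and [phi] tends to [kappa] on the right, so [D wt <= e] far away and the maximum is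
     attained. *)
  set (e := D z0 * wt z0 / 2).
  assert (He : 0 < e). { unfold e. specialize (Hwtpos z0). nra. }
  destruct Hs as [S1 [S2 _]].
  assert (HBpos : 0 < B). { specialize (HB 0). specialize (Hr 0). generalize (exp_pos (l' * 0)). nra. }
  destruct (exp_small (l' - l) (e / B) 0) as [W1 [HW1 HW1']]. lra. apply Rdiv_lt_0_compat; auto.
  destruct (lim_p_infty phi kappa Hpinf e He) as [W2 HW2].
  destruct (attained_max (fun z => D z * wt z - e) z0 (Rabs W1 + Rabs W2)) as [zm [Hm1 Hm2]].
  - intros z. apply (continuous_minus (fun z => D z * wt z) (fun _ => e)); [|apply continuous_const].
    apply (continuous_mult D wt).
    + apply (ex_derive_continuous D z). unfold D. eexists. apply is_derive_sub; [apply S1|apply is_derive_shift; apply S1].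
    + apply (continuous_ext (fun z => - Rmin (- exp (- l * z)) (- 1))).
      { intros y. unfold wt, Rmin, Rmax. destruct (Rle_dec (- exp (- l * y)) (- 1)); destruct (Rle_dec (exp (- l * y)) 1); lra. }
      apply (continuous_opp (fun z => Rmin (- exp (- l * z)) (- 1))).
      apply (Rmin_continuous (fun z => - exp (- l * z)) (fun _ => - 1)).
      apply (ex_derive_continuous (fun z => - exp (- l * z))). auto_derive; auto. apply continuous_const.
  - unfold e in He |- *. lra.
  - intros z Hz. unfold D.
    assert (Hz' : z <= W1 \/ W2 <= z /\ 0 <= z).
    { unfold Rabs in Hz at 3. destruct (Rcase_abs z).
      - left. generalize (Rle_abs (- W1)) (Rabs_pos W2). rewrite Rabs_Ropp. lra.
      - right. generalize (Rle_abs W2) (Rabs_pos W1). lra. }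
    assert (Hd1 := Hr z). assert (Hd2 := Hr (z + s)).
    destruct Hz' as [Hz'|[Hz' Hz'']].
    + assert (phi z * wt z <= e); [|specialize (Hwtpos z); nra].
      apply Rle_trans with (B * exp (l' * z) * wt z).
      { apply Rmult_le_compat_r. left; auto. auto. }
      unfold wt. rewrite Rmax_left. 2:{ rewrite -exp_0; apply exp_le_mono; nra. }
      rewrite Rmult_assoc -exp_plus. apply Rle_trans with (B * (e / B)); [|right; field; lra].
      apply Rmult_le_compat_l. lra. apply Rle_trans with (2 := Rlt_le _ _ HW1'). apply exp_le_mono. nra.
    + unfold wt. rewrite Rmax_right. 2:{ rewrite -exp_0; apply exp_le_mono; nra. }
      specialize (HW2 (z + s) ltac:(lra)). apply Rabs_le_between in HW2. lra.
  - set (M := D zm * wt zm) in *.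
    assert (HM : 0 < M) by lra.
    assert (HDM : forall z, D z <= M * eta l z).
    { intros z. assert (HH : D z * wt z <= M) by (specialize (Hm2 z); lra).
      replace (D z) with (D z * wt z * eta l z) by (rewrite Rmult_assoc Hwt; ring).
      apply Rmult_le_compat_r; auto. left; apply eta_pos. }
    assert (HDm : D zm = M * eta l zm) by (unfold M; rewrite Rmult_assoc Hwt; ring).
    assert (Hout : zm < - Z \/ Z < zm).
    { destruct (Rlt_le_dec zm (- Z)); auto. destruct (Rlt_le_dec Z zm); auto. exfalso.
      assert (D zm <= 0). { unfold D. assert (phi zm <= phi (zm + s)) by (apply Hcore; lra). lra. }
      generalize (eta_pos l zm). nra. }
    assert (HDd : forall z : R, is_derive D z (phi1 z - phi1 (z + s))).
    { intros z. unfold D. apply is_derive_sub; auto. apply is_derive_shift; auto. }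
    assert (HDd2 : forall z : R, is_derive (fun z => phi1 z - phi1 (z + s)) z
        ((c * phi1 z + phi z - delayed g d phi z) - (c * phi1 (z + s) + phi (z + s) - delayed g d phi (z + s)))).
    { intros z. apply is_derive_sub; auto. apply (is_derive_shift phi1); auto. }
    set (DG := delayed g d phi zm - delayed g d phi (zm + s)).
    (* If the order is already correct at the delayed point, monotonicity of [g] gives [DG <= 0];
       only the opposite case calls for a slope bound. *)
    assert (HDG : forall K, 0 <= K -> (0 < D (zm - d) -> DG <= K * D (zm - d)) -> DG <= K * (M * eta l (zm - d))).
    { intros K HK HKD. destruct (Rlt_le_dec 0 (D (zm - d))) as [Hp|Hn].
      - apply Rle_trans with (1 := HKD Hp). apply Rmult_le_compat_l; auto.
      - apply Rle_trans with 0.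
        + unfold DG, delayed. assert (g (phi (zm - d)) <= g (phi (zm + s - d))); [|lra].
          apply (ms_mono H). unfold D in Hn. replace (zm + s - d) with (zm - d + s) by ring. lra.
        + apply Rmult_le_pos; auto. apply Rmult_le_pos. lra. left; apply eta_pos. }
    destruct Hout as [Hleft|Hright].
    + assert (Eeta : forall z, z <= 0 -> eta l z = exp (l * z)) by (intros; apply eta_left; lra).
      assert (E1 : phi1 zm - phi1 (zm + s) - M * l * exp (l * zm) = 0).
      { apply (local_max_derive (fun z => D z - M * exp (l * z)) zm _ 1); try lra.
        - apply is_derive_sub; auto. apply exp_derive_cmul.
        - intros y _. rewrite HDm Eeta; [|lra]. specialize (HDM y). generalize (eta_le_exp l y). nra. }
      assert (E2 : (c * phi1 zm + phi zm - delayed g d phi zm) - (c * phi1 (zm + s) + phi (zm + s) - delayed g d phi (zm + s)) - M * l * l * exp (l * zm) <= 0).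
      { apply (local_max_derive2 (fun z => D z - M * exp (l * z)) (fun z => phi1 z - phi1 (z + s) - M * l * exp (l * z)) zm _ 1); try lra.
        - intros y _. apply is_derive_sub; auto. apply exp_derive_cmul.
        - apply is_derive_sub; auto. apply exp_derive_cmul.
        - intros y _. rewrite HDm Eeta; [|lra]. specialize (HDM y). generalize (eta_le_exp l y). nra. }
      assert (E3 : DG <= (G0 + eps) * (M * eta l (zm - d))).
      { apply HDG. lra. intros Hp. unfold DG, delayed, D in *.
        replace (zm + s - d) with (zm - d + s) by ring.
        assert (HH := HZ1 (zm - d) ltac:(lra)). apply Rabs_le_between in HH.
        assert (HH2 := Hsl _ (phi (zm - d + s)) (phi (zm - d)) (Rle_refl _) ltac:(lra) ltac:(lra)). lra. }
      rewrite Eeta in E3; [|lra]. replace (l * (zm - d)) with (- (l * d) + l * zm) in E3 by ring.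
      rewrite exp_plus in E3.
      assert (E4 : phi zm - phi (zm + s) = M * exp (l * zm)). { rewrite -Eeta; [|lra]. exact HDm. }
      assert (HMe : 0 < M * exp (l * zm)) by (apply Rmult_lt_0_compat; auto; apply exp_pos).
      assert (0 < M * exp (l * zm) * - (l ^ 2 - c * l - 1 + (G0 + eps) * exp (- (l * d)))) by (apply Rmult_lt_0_compat; lra).
      assert (E5 : phi1 zm - phi1 (zm + s) = l * (M * exp (l * zm))) by lra.
      assert (E6 : c * phi1 zm - c * phi1 (zm + s) = c * (l * (M * exp (l * zm)))) by (rewrite -E5; ring).
      unfold DG in E3. nra.
    + assert (E0 : D zm = M). { rewrite HDm eta_right; lra. }
      assert (HDM1 : forall y, D y <= M). { intros y. apply Rle_trans with (1 := HDM y). generalize (eta_le_1 l y). nra. }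
      assert (E1 : phi1 zm - phi1 (zm + s) = 0).
      { apply (local_max_derive D zm _ 1); auto; try lra. intros y _. rewrite E0. auto. }
      assert (E2 : (c * phi1 zm + phi zm - delayed g d phi zm) - (c * phi1 (zm + s) + phi (zm + s) - delayed g d phi (zm + s)) <= 0).
      { apply (local_max_derive2 D (fun z => phi1 z - phi1 (z + s)) zm _ 1); auto; try lra. intros y _. rewrite E0. auto. }
      assert (E3 : DG <= k * (M * eta l (zm - d))).
      { apply HDG. lra. intros Hp. unfold DG, delayed, D in *.
        replace (zm + s - d) with (zm - d + s) by ring.
        assert (HH := HZ2 (zm - d + s) ltac:(lra)). apply Rabs_le_between in HH.
        assert (HH2 := ms_neark H (phi (zm - d)) (phi (zm - d + s)) (phi (zm - d)) ltac:(lra) ltac:(lra) (Rle_refl _)). lra. }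
      assert (E4 : k * (M * eta l (zm - d)) <= k * M).
      { apply Rmult_le_compat_l. lra. generalize (eta_le_1 l (zm - d)). nra. }
      unfold DG in E3. unfold D in E0. assert (c * phi1 zm = c * phi1 (zm + s)) by (f_equal; lra). nra.
Qed.

(** Let [sig] be the supremum of the shifts that violate the order; it is finite, since large shifts
    lift the core above the maximum of [phi] on it. At [sig] the order holds by continuity, and it
    is strict by the strong maximum principle: equality would make [phi] periodic with period [sig],
    against its limit [kappa]. The positive margin on the core then admits slightly smaller
    shifts. *)
Lemma sliding g kappa L G0 k dk c d l l' B phi phi1 eps : monostable g kappa L G0 k dk ->
  0 <= d -> 0 < l < l' -> 0 < eps -> l ^ 2 - c * l - 1 + (G0 + eps) * exp (- (l * d)) < 0 ->
  sol c (delayed g d phi) phi phi1 -> (forall z, 0 < phi z < kappa) ->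
  is_lim phi m_infty 0 -> is_lim phi p_infty kappa -> (forall z, phi z <= B * exp (l' * z)) ->
  forall x y, x <= y -> phi x <= phi y.
Proof.
  intros H Hd Hl Heps Hchi Hs Hr Hminf Hpinf HB.
  destruct (order_from_core g kappa L G0 k dk c d l l' B phi phi1 eps H Hd Hl Heps Hchi Hs Hr Hminf Hpinf HB) as [Z [HZ Hcore]].
  assert (Hf : forall z, 0 <= delayed g d phi z).
  { intros z. apply (ms_range H). specialize (Hr (z - d)). lra. }
  assert (Hlip : lips (lipc c kappa) phi).
  { apply (sol_lips c _ phi phi1 kappa Hs Hf). intros z. specialize (Hr z). lra. }
  assert (Hlc : 0 <= lipc c kappa).
  { unfold lipc. generalize (nu_sign c) (ms_kappa H). nra. }
  assert (Hcont : forall z, continuous phi z) by (apply (lips_continuous (lipc c kappa)); auto).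
  assert (Hgoal : forall s, 0 <= s -> forall z, phi z <= phi (z + s)).
  2:{ intros x y Hxy. replace y with (x + (y - x)) by ring. apply Hgoal. lra. }
  apply NNPP. intros Hbad.
  set (T := fun s => 0 <= s /\ exists z, phi (z + s) < phi z).
  assert (HTex : exists s, T s).
  { apply NNPP. intros Hno. apply Hbad. intros s Hs0 z. apply Rnot_lt_le. intros Hlt. apply Hno.
    exists s. split; auto. exists z; auto. }
  destruct (continuity_ab_maj phi (- Z) Z) as [zM [HM1 HM2]]. lra.
  { intros z _. apply continuity_pt_filterlim. apply Hcont. }
  destruct (lim_p_infty phi kappa Hpinf (kappa - phi zM)) as [Z2 HZ2]. specialize (Hr zM); lra.
  destruct (completeness T) as [sig [Hub Hlub]].
  { exists (Rabs Z2 + Z). intros s [Hs0 [z Hz]]. apply Rnot_lt_le. intros Hlt.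
    assert (phi z <= phi (z + s)); [|lra]. apply Hcore; auto. intros y Hy.
    apply Rle_trans with (1 := HM1 y Hy). specialize (HZ2 (y + s)).
    generalize (Rle_abs Z2). intros. specialize (HZ2 ltac:(lra)). apply Rabs_le_between in HZ2. lra. }
  { auto. }
  assert (Hsig : 0 < sig).
  { destruct HTex as [s Hs1]. assert (Hs2 := Hub s Hs1). destruct Hs1 as [Hs0 [z Hz]].
    destruct (Rle_lt_or_eq_dec _ _ Hs0) as [|E]. lra. subst s. rewrite Rplus_0_r in Hz. lra. }
  assert (Habove : forall s, sig < s -> forall z, phi z <= phi (z + s)).
  { intros s Hss z. apply Rnot_lt_le. intros Hlt. assert (s <= sig); [|lra]. apply Hub. split. lra. exists z; auto. }
  assert (Hat : forall z, phi z <= phi (z + sig)).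
  { intros z. apply Rnot_lt_le. intros Hlt.
    set (e := (phi z - phi (z + sig)) / (2 * (lipc c kappa + 1))).
    assert (He : 0 < e) by (apply Rdiv_lt_0_compat; lra).
    assert (Ha := Habove (sig + e) ltac:(lra) z).
    assert (Hl2 := Hlip (z + (sig + e)) (z + sig)).
    replace (z + (sig + e) - (z + sig)) with e in Hl2 by ring. rewrite (Rabs_pos_eq e) in Hl2; [|lra].
    apply Rabs_le_between in Hl2.
    assert (lipc c kappa * e <= (phi z - phi (z + sig)) / 2).
    { apply Rle_trans with ((lipc c kappa + 1) * e). nra. unfold e. right; field. lra. }
    lra. }
  assert (Hdiff := sol_lin c _ _ _ _ _ _ 1 (-1) (sol_shift c _ _ _ sig Hs) Hs).
  assert (Hforc : forall z, 0 <= 1 * delayed g d phi (z + sig) + -1 * delayed g d phi z).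
  { intros z. assert (delayed g d phi z <= delayed g d phi (z + sig)); [|lra].
    apply (ms_mono H). replace (z + sig - d) with (z - d + sig) by ring. auto. }
  assert (Hstrict : forall z, phi z < phi (z + sig)).
  { intros z. destruct (Rle_lt_or_eq_dec _ _ (Hat z)) as [|E]; auto. exfalso.
    assert (Hz := sol_zero c _ _ _ z Hdiff Hforc). cbv beta in Hz.
    assert (Hper : forall w, phi (w + sig) = phi w).
    { intros w. assert (1 * phi (w + sig) + -1 * phi w = 0); [|lra]. apply Hz. rewrite E. ring. }
    assert (Hn : forall n, phi (INR n * sig) = phi 0).
    { induction n as [|n IH]. simpl. f_equal; ring. rewrite S_INR. replace ((INR n + 1) * sig) with (INR n * sig + sig) by ring. rewrite Hper. exact IH. }
    destruct (lim_p_infty phi kappa Hpinf ((kappa - phi 0) / 2)) as [Z3 HZ3]. specialize (Hr 0); lra.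
    destruct (nfloor_ex (Rabs Z3 / sig)) as [n Hnf].
    { apply Rmult_le_pos. apply Rabs_pos. left; apply Rinv_0_lt_compat; auto. }
    assert (Hge : Z3 <= INR (S n) * sig).
    { apply Rle_trans with (1 := Rle_abs _). rewrite S_INR. apply Rle_trans with (Rabs Z3 / sig * sig). right; field; lra.
      apply Rmult_le_compat_r; lra. }
    specialize (HZ3 _ Hge). rewrite Hn in HZ3. apply Rabs_le_between in HZ3. specialize (Hr 0). lra. }
  destruct (continuity_ab_min (fun z => phi (z + sig) - phi z) (- Z) Z) as [zm [Hm1 Hm2]]. lra.
  { intros z _. apply continuity_pt_filterlim. apply (continuous_minus (fun z => phi (z + sig)) phi); auto.
    apply (continuous_comp (fun z => z + sig) phi); auto. apply (ex_derive_continuous (fun z => z + sig)). auto_derive; auto. }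
  set (m := phi (zm + sig) - phi zm) in *. assert (Hm : 0 < m). { unfold m. specialize (Hstrict zm). lra. }
  set (e := Rmin sig (m / (lipc c kappa + 1))).
  assert (He : 0 < e). { apply Rmin_pos; auto. apply Rdiv_lt_0_compat; lra. }
  assert (He1 : e <= sig) by apply Rmin_l.
  assert (He2 : lipc c kappa * e <= m).
  { apply Rle_trans with ((lipc c kappa + 1) * e). nra.
    apply Rle_trans with ((lipc c kappa + 1) * (m / (lipc c kappa + 1))).
    apply Rmult_le_compat_l. lra. apply Rmin_r. right; field; lra. }
  assert (sig <= sig - e); [|lra].
  apply Hlub. intros s [Hs0 [z Hz]]. apply Rnot_lt_le. intros Hlt.
  assert (phi z <= phi (z + s)); [|lra].
  destruct (Rlt_le_dec sig s) as [Hss|Hss]. auto.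
  apply Hcore; auto. intros y Hy.
  assert (Hmy : m <= phi (y + sig) - phi y) by (apply Hm1; auto).
  assert (Hl2 := Hlip (y + s) (y + sig)).
  replace (y + s - (y + sig)) with (- (sig - s)) in Hl2 by ring. rewrite Rabs_Ropp (Rabs_pos_eq (sig - s)) in Hl2; [|lra].
  apply Rabs_le_between in Hl2. assert (lipc c kappa * (sig - s) <= lipc c kappa * e) by (apply Rmult_le_compat_l; lra). lra.
Qed.

(** The equation cannot be differentiated, as [g] is only Lipschitz in the middle. A zero of [phi1]
    at [z0] is a minimum of [phi1], so [phi z0] equals the forcing [f0] there. Then
    [N = (phi1 - nup (phi - f0)) e^{- nun z}] is nondecreasing up to [z0], vanishes at [z0] and
    tends to 0 at [-oo]. Hence it is 0 and the forcing is constant to the left of [z0], against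
    [phi -> 0]. *)
Lemma profile_derive_pos g kappa L G0 k dk c d phi phi1 : monostable g kappa L G0 k dk ->
  sol c (delayed g d phi) phi phi1 -> (forall z, 0 < phi z < kappa) ->
  is_lim phi m_infty 0 -> (forall x y, x <= y -> phi x <= phi y) -> forall z, 0 < phi1 z.
Proof.
  intros H Hs Hr Hminf Hmono.
  assert (HL := ms_L H).
  destruct Hs as [S1 [S2 [[M HM] [M1 HM1]]]].
  assert (Hge : forall z, 0 <= phi1 z).
  { intros z. apply (left_max_derive phi z (phi1 z) 1); auto. lra. intros s Hs. apply Hmono. lra. }
  intros z0. destruct (Rle_lt_or_eq_dec _ _ (Hge z0)) as [|E0]; auto. exfalso. symmetry in E0.
  set (f := delayed g d phi) in *.
  assert (Ef : phi z0 = f z0).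
  { assert (HH : - (c * phi1 z0 + phi z0 - f z0) = 0).
    { apply (local_max_derive (fun z => - phi1 z) z0 _ 1). lra. apply is_derive_neg; auto.
      intros y _. specialize (Hge y). lra. }
    rewrite E0 in HH. lra. }
  assert (Hnu := nu_sign c). assert (Hsum := nu_sum c). assert (Hprod := nu_prod c).
  set (f0 := f z0) in *.
  set (N := fun z => (phi1 z - nup c * phi z + nup c * f0) * exp (- nun c * z)).
  assert (HN : forall z : R, is_derive N z ((f0 - f z) * exp (- nun c * z))).
  { intros z. apply is_derive_eq with
      ((c * phi1 z + phi z - f z - nup c * phi1 z + 0 + - nun c * (phi1 z - nup c * phi z + nup c * f0)) * exp (- nun c * z)).
    - apply (is_derive_mul_exp (fun z => phi1 z - nup c * phi z + nup c * f0)).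
      apply is_derive_add; [|apply (is_derive_const (nup c * f0) z)].
      apply is_derive_sub; auto. apply is_derive_cmul; auto.
    - f_equal. replace (c * phi1 z) with ((nup c + nun c) * phi1 z) by (rewrite Hsum; ring).
      replace (- nun c * (phi1 z - nup c * phi z + nup c * f0)) with
        (- nun c * phi1 z + (nup c * nun c) * phi z - (nup c * nun c) * f0) by ring. rewrite Hprod. ring. }
  assert (Hfm : forall z, z <= z0 -> f z <= f0).
  { intros z Hz. apply (ms_mono H). apply Hmono. lra. }
  assert (HNm : forall a b, a <= b -> b <= z0 -> N a <= N b).
  { intros a b Hab Hb. assert (- N b <= - N a); [|lra].
    apply (derive_nonpos_decr (fun z => - N z) (fun z => - ((f0 - f z) * exp (- nun c * z))) a b Hab).
    - intros z _. apply is_derive_neg; auto.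
    - intros z Hz. specialize (Hfm z ltac:(lra)). generalize (exp_pos (- nun c * z)). nra. }
  assert (HN0 : N z0 = 0). { unfold N. rewrite E0 Ef. ring. }
  set (C := M1 + nup c * M + nup c * Rabs f0).
  assert (HC : forall z, Rabs (N z) <= C * exp (- nun c * z)).
  { intros z. unfold N. rewrite Rabs_mult (Rabs_pos_eq (exp _)); [|left; apply exp_pos].
    apply Rmult_le_compat_r. left; apply exp_pos. unfold C.
    apply Rle_trans with (1 := Rabs_triang _ _). apply Rplus_le_compat.
    - apply Rle_trans with (1 := Rabs_triang _ _). rewrite Rabs_Ropp Rabs_mult (Rabs_pos_eq (nup c)); [|lra].
      apply Rplus_le_compat; auto. apply Rmult_le_compat_l; auto. lra.
    - rewrite Rabs_mult (Rabs_pos_eq (nup c)); lra. }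
  assert (HCpos : 0 <= C). { unfold C. generalize (HM 0) (HM1 0) (Rabs_pos (phi 0)) (Rabs_pos (phi1 0)) (Rabs_pos f0). nra. }
  assert (HNz : forall z, z <= z0 -> N z = 0).
  { intros z Hz. apply Rle_antisym. rewrite -HN0. apply HNm; lra.
    apply Rnot_lt_le. intros Hneg.
    destruct (exp_small (- nun c) (- N z / (C + 1)) z) as [w [Hw1 Hw2]]. lra. apply Rdiv_lt_0_compat; lra.
    assert (A1 := HNm w z Hw1 Hz). assert (A2 := HC w). apply Rabs_le_between in A2.
    assert ((C + 1) * exp (- nun c * w) < - N z).
    { apply Rlt_le_trans with ((C + 1) * (- N z / (C + 1))). apply Rmult_lt_compat_l; lra. right; field; lra. }
    generalize (exp_pos (- nun c * w)). lra. }
  assert (Hf0 : 0 < f0) by (specialize (Hr z0); lra).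
  destruct (lim_m_infty phi 0 Hminf (f0 / (2 * L))) as [Z HZ]. apply Rdiv_lt_0_compat; lra.
  set (z1 := Rmin z0 (Z + d) - 1).
  assert (B1 := Rmin_l z0 (Z + d)). assert (B2 := Rmin_r z0 (Z + d)).
  destruct (MVT_cor2 N (fun z => (f0 - f z) * exp (- nun c * z)) z1 (z1 + 1)) as [xi [Hxi1 Hxi2]]. lra.
  { intros z _. apply is_derive_Reals; auto. }
  rewrite !HNz in Hxi1; try (unfold z1; lra).
  assert (Hfx : f xi <= f0 / 2).
  { unfold f, delayed. assert (HH := HZ (xi - d) ltac:(unfold z1 in *; lra)). apply Rabs_le_between in HH.
    assert (Hl := ms_lip H (phi (xi - d)) 0). rewrite (ms_0 H) !Rminus_0_r in Hl.
    rewrite (Rabs_pos_eq (phi _)) in Hl; [|specialize (Hr (xi - d)); lra].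
    apply Rle_trans with (1 := Rle_abs _). apply Rle_trans with (1 := Hl).
    apply Rle_trans with (L * (f0 / (2 * L))). apply Rmult_le_compat_l; lra. right; field; lra. }
  assert (0 < (f0 - f xi) * exp (- nun c * xi)) by (apply Rmult_lt_0_compat; [lra|apply exp_pos]). lra.
Qed.

(* [lam] is the exponent of the weight [eta lam]; by [ff_m] the front decays faster than this weight. *)
Record fast_front (g : R -> R) (kappa h c lam : R) (phi phi1 : R -> R) (nu : R) : Prop := {
  ff_c : 0 < c;
  ff_lam : 0 < lam;
  ff_nu : 0 < nu;
  ff_rng : forall z, 0 < phi z < kappa;
  ff_d1 : forall z : R, is_derive phi z (phi1 z);
  ff_d2 : forall z : R, is_derive phi1 z (c * phi1 z + phi z - g (phi (z - c * h)));
  ff_pos : forall z, 0 < phi1 z;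
  ff_left : forall z, phi1 z <= nu * phi z;
  ff_right : forall z, phi1 z <= nu * (kappa - phi z);
  ff_m : forall eps, 0 < eps -> exists Z, forall z, z <= Z -> phi z <= eps * exp (lam * z);
  ff_p : forall eps, 0 < eps -> exists Z, forall z, Z <= z -> kappa - eps <= phi z }.

Arguments ff_c {g kappa h c lam phi phi1 nu}.
Arguments ff_lam {g kappa h c lam phi phi1 nu}.
Arguments ff_nu {g kappa h c lam phi phi1 nu}.
Arguments ff_rng {g kappa h c lam phi phi1 nu}.
Arguments ff_d1 {g kappa h c lam phi phi1 nu}.
Arguments ff_d2 {g kappa h c lam phi phi1 nu}.
Arguments ff_pos {g kappa h c lam phi phi1 nu}.
Arguments ff_left {g kappa h c lam phi phi1 nu}.
Arguments ff_right {g kappa h c lam phi phi1 nu}.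
Arguments ff_m {g kappa h c lam phi phi1 nu}.
Arguments ff_p {g kappa h c lam phi phi1 nu}.

(** Decay is obtained with the exponent [l' = (lam + l2) / 2], larger than [lam], which gives
    [o(e^{lam z})]. The two bounds on [phi1] are the Harnack inequality for [phi] and for
    [kappa - phi]. *)
Lemma minimal_front_is_fast g kappa L k dk h phi cs lam l2 : monostable g kappa L (Derive g 0) k dk ->
  0 <= h -> 0 < cs -> 0 < lam < l2 -> (forall l, lam <= l < l2 -> chi g h l cs < 0) ->
  min_speed g h kappa cs -> wavefront g h kappa phi cs ->
  exists phi1 nu, fast_front g kappa h cs lam phi phi1 nu.
Proof.
  intros H Hh Hc Hl Hchi Hmin Hw.
  destruct (wavefront_sol g kappa L _ k dk h phi cs H Hw) as [phi1 Hs].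
  assert (Hd : 0 <= cs * h) by (apply Rmult_le_pos; lra).
  assert (HG := ms_G0 H).
  set (l' := (lam + l2) / 2).
  destruct (minimal_front_fast g kappa L k dk h phi phi1 cs l' H Hh (Rlt_le _ _ Hc)) as [B HB]; auto.
  { unfold l'; lra. } { apply Hchi. unfold l'; lra. }
  assert (Hr := wavefront_lt g kappa L _ k dk h phi phi1 cs H Hw Hd Hs).
  destruct Hw as [_ [Hm [Hp _]]].
  destruct (chi_slack g h cs lam (Hchi lam ltac:(lra)) HG) as [eps [He1 He2]].
  assert (Hmono := sliding g kappa L _ k dk cs (cs * h) lam l' B phi phi1 eps H Hd ltac:(unfold l'; lra) (proj1 He1) He2 Hs Hr Hm Hp HB).
  assert (Hpos := profile_derive_pos g kappa L _ k dk cs (cs * h) phi phi1 H Hs Hr Hm Hmono).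
  assert (Hf : forall z, 0 <= delayed g (cs * h) phi z).
  { intros z. apply (ms_range H). specialize (Hr (z - cs * h)). lra. }
  assert (Hh1 := sol_harnack cs _ _ _ Hs Hf).
  assert (Hs2 := sol_lin cs _ _ _ _ _ _ 1 (-1) (sol_const cs kappa) Hs).
  assert (Hf2 : forall z, 0 <= 1 * kappa + -1 * delayed g (cs * h) phi z).
  { intros z. assert (delayed g (cs * h) phi z <= kappa); [|lra].
    apply (ms_range H). specialize (Hr (z - cs * h)). lra. }
  assert (Hh2 := sol_harnack cs _ _ _ Hs2 Hf2). cbv beta in Hh2.
  assert (Hnu := nu_sign cs).
  exists phi1, (Rmax (nup cs) (- nun cs)).
  assert (N1 := Rmax_l (nup cs) (- nun cs)). assert (N2 := Rmax_r (nup cs) (- nun cs)).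
  constructor; try lra; auto.
  - apply Hs.
  - apply Hs.
  - intros z. apply Rle_trans with (nup cs * phi z). apply Hh1. apply Rmult_le_compat_r; auto. specialize (Hr z); lra.
  - intros z. apply Rle_trans with (- nun cs * (kappa - phi z)). specialize (Hh2 z). lra.
    apply Rmult_le_compat_r; auto. specialize (Hr z); lra.
  - intros e He.
    assert (HBpos : 0 < B). { specialize (HB 0). specialize (Hr 0). generalize (exp_pos (l' * 0)). nra. }
    destruct (exp_small (l' - lam) (e / B) 0) as [Z [_ HZ]]. unfold l'; lra. apply Rdiv_lt_0_compat; auto.
    exists Z. intros z Hz. apply Rle_trans with (1 := HB z).
    replace (l' * z) with ((l' - lam) * z + lam * z) by ring. rewrite exp_plus -Rmult_assoc.
    apply Rmult_le_compat_r. left; apply exp_pos.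
    apply Rle_trans with (B * (e / B)); [|right; field; lra]. apply Rmult_le_compat_l. lra.
    apply Rle_trans with (2 := Rlt_le _ _ HZ). apply exp_le_mono. apply Rmult_le_compat_l; auto. unfold l'; lra.
  - intros e He. destruct (lim_p_infty phi kappa Hp e He) as [Z HZ]. exists Z. intros z Hz.
    specialize (HZ z Hz). apply Rabs_le_between in HZ. lra.
Qed.

(** * Stability of the fast front *)

Record evolution (g : R -> R) (kappa h : R) (u : R -> R -> R) : Prop := {
  ev_cont : seq_cont (- h) u;
  ev_rng : forall t x, - h <= t -> 0 <= u t x <= kappa;
  ev_pde : forall t x, 0 < t -> heat_at u (g (u (t - h) x)) t x }.

Arguments ev_cont {g kappa h u}.
Arguments ev_rng {g kappa h u}.
Arguments ev_pde {g kappa h u}.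

(** Continuity at [ga = 0]: a strict inequality leaves room for the factor [e^{ga h}], by which a
    decaying amplitude was larger one delay earlier, and for the decay rate itself. *)
Lemma exp_room (A B h : R) : A < B -> exists gb, 0 < gb /\ forall ga, 0 <= ga <= gb -> A * exp (ga * h) + ga <= B.
Proof.
  intros HAB.
  assert (Hc : continuous (fun ga => A * exp (ga * h) + ga) 0).
  { apply (ex_derive_continuous (fun ga => A * exp (ga * h) + ga)). auto_derive; auto. }
  destruct (continuous_near _ 0 (B - A) Hc) as [d [Hd H]]. lra.
  exists (d / 2). split. lra. intros ga Hga. specialize (H ga). rewrite Rminus_0_r Rabs_pos_eq in H; [|lra].
  specialize (H ltac:(lra)). rewrite Rmult_0_l exp_0 Rmult_1_r Rplus_0_r in H.
  apply Rabs_lt_between in H. lra.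
Qed.

(* [e^{a y}] is the branch of the minimum [eta lam] that is attained at [y]. *)
Definition active (lam a y : R) : Prop := (a = lam /\ y <= 0) \/ (a = 0 /\ 0 <= y).

Lemma active_exists lam y : exists a, active lam a y.
Proof. destruct (Rle_lt_dec y 0); [exists lam; left|exists 0; right]; split; auto; lra. Qed.

Lemma active_eta lam a y : 0 < lam -> active lam a y -> eta lam y = exp (a * y).
Proof.
  intros Hl [[-> Hy]|[-> Hy]].
  - apply eta_left; lra.
  - rewrite eta_right; try lra. rewrite Rmult_0_l exp_0. auto.
Qed.

Lemma active_le lam a y z : active lam a y -> eta lam z <= exp (a * z).
Proof.
  intros [[-> Hy]|[-> Hy]]. apply eta_le_exp. rewrite Rmult_0_l exp_0. apply eta_le_1.
Qed.

(* The common core of the upper and the lower barrier: [v] or [w] is the value of the front, the other one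
   its perturbation. *)
Lemma core_inequality g kappa L G0 k dk h c lam phi phi1 nu eps : monostable g kappa L G0 k dk ->
  0 <= h -> 0 < eps -> lam ^ 2 - c * lam - 1 + (G0 + eps) * exp (- (lam * (c * h))) < 0 ->
  fast_front g kappa h c lam phi phi1 nu ->
  exists gb, 0 < gb /\ forall ga, 0 < ga <= gb -> exists qb C1, 0 < qb /\ 0 < C1 /\
    forall q a y zeta v w, 0 < q <= qb -> active lam a y -> Rabs (zeta - y) <= 1 ->
      v <= w <= v + q * exp (ga * h) * eta lam (y - c * h) ->
      v = phi (zeta - c * h) \/ w = phi (zeta - c * h) ->
      g w - g v <= C1 * q * phi1 zeta + q * (1 - ga + c * a - a * a) * exp (a * y).
Proof.
  intros H Hh Heps Hchi FF.
  assert (Hk := ms_kappa H). assert (HL := ms_L H).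
  assert (HG := ms_G0 H). assert (Hdk := ms_dk H).
  assert (Hkb := ms_kbd H).
  assert (Hc := ff_c FF). assert (Hlam := ff_lam FF).
  assert (Hrng := ff_rng FF). assert (Hpos := ff_pos FF).
  assert (Hd : 0 <= c * h) by (apply Rmult_le_pos; lra).
  set (d := c * h) in *. set (X := exp (- (lam * d))) in *. assert (HX : 0 < X) by apply exp_pos.
  (* Admissible decay rates at the two ends: [g1] from the negative characteristic function on the
     left, [g2] from [k < 1] on the right. *)
  destruct (exp_room ((G0 + eps) * X) (1 + c * lam - lam * lam) h) as [g1 [Hg1 Hg1']]. simpl in Hchi; lra.
  destruct (exp_room k 1 h) as [g2 [Hg2 Hg2']]. lra.
  exists (Rmin g1 g2). split. apply Rmin_pos; auto. intros ga Hga.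
  assert (Hga1 : 0 <= ga <= g1). { generalize (Rmin_l g1 g2); lra. }
  assert (Hga2 : 0 <= ga <= g2). { generalize (Rmin_r g1 g2); lra. }
  specialize (Hg1' ga Hga1). specialize (Hg2' ga Hga2).
  set (E := exp (ga * h)) in *. assert (HE : 0 < E) by apply exp_pos.
  assert (HGX : 0 < (G0 + eps) * X) by (apply Rmult_lt_0_compat; lra).
  assert (HQ : ga <= 1 + c * lam - lam * lam) by nra.
  assert (Hga3 : ga <= 1) by nra.
  destruct (ms_near0 H eps Heps) as [del [Hdel Hsl]].
  destruct (ff_m FF (del / 2)) as [Z1 HZ1]. lra.
  destruct (ff_p FF (dk / 2)) as [Z2 HZ2]. lra.
  set (Z := Rabs Z1 + Rabs Z2 + 1 + d).
  assert (HZpos : 0 < Z) by (unfold Z; generalize (Rabs_pos Z1) (Rabs_pos Z2); lra).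
  assert (HZl : forall z, z <= - Z + 1 -> phi z <= del / 2).
  { intros z Hz. generalize (Rle_abs (- Z1)) (Rabs_pos Z2). rewrite Rabs_Ropp. intros A1 A2. unfold Z in Hz.
    assert (Hzz : z <= Z1) by lra. apply Rle_trans with (1 := HZ1 z Hzz).
    rewrite <- (Rmult_1_r (del / 2)) at 2. apply Rmult_le_compat_l. lra. rewrite -exp_0. apply exp_le_mono.
    generalize (Rabs_pos Z1). nra. }
  assert (HZr : forall z, Z - 1 - d <= z -> kappa - dk / 2 <= phi z).
  { intros z Hz. apply HZ2. generalize (Rle_abs Z2) (Rabs_pos Z1). unfold Z in Hz. lra. }
  destruct (continuity_ab_min phi1 (- Z - 1) (Z + 1)) as [zm [Hzm1 Hzm2]]. lra.
  { intros z _. apply continuity_pt_filterlim, (ex_derive_continuous phi1 z). eexists; apply (ff_d2 FF). }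
  set (m := phi1 zm) in *. assert (Hm : 0 < m) by apply Hpos.
  (* The bound on [q] keeps the delayed perturbation, at most [q E], inside the zones where the
     slope bounds near 0 and [kappa] apply. On the compact core [phi1 >= m], so [C1 = L E / m] lets
     the drift absorb the full Lipschitz error. *)
  exists (Rmin (del / 2) (dk / 2) / E), (L * E / m).
  split. { apply Rdiv_lt_0_compat; auto. apply Rmin_pos; lra. }
  split. { apply Rdiv_lt_0_compat; auto. apply Rmult_lt_0_compat; lra. }
  intros q a y zeta v w Hq Ha Hzy Hvw Hor.
  apply Rabs_le_between in Hzy.
  assert (HqE : q * E <= Rmin (del / 2) (dk / 2)).
  { apply Rle_trans with (Rmin (del / 2) (dk / 2) / E * E). apply Rmult_le_compat_r; lra. right; field; lra. }
  assert (HqE1 : q * E <= del / 2). { apply Rle_trans with (1 := HqE). apply Rmin_l. }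
  assert (HqE2 : q * E <= dk / 2). { apply Rle_trans with (1 := HqE). apply Rmin_r. }
  assert (HqEpos : 0 < q * E) by (apply Rmult_lt_0_compat; lra).
  assert (He0 := eta_pos lam (y - d)). assert (He1 := eta_le_1 lam (y - d)). assert (He2 := eta_le_exp lam (y - d)).
  assert (Hwv : w - v <= q * E). { assert (q * E * eta lam (y - d) <= q * E) by nra. lra. }
  assert (Hphi : v <= phi (zeta - d) <= w). { destruct Hor as [-> | ->]; lra. }
  assert (HC1phi : 0 < L * E / m * q * phi1 zeta).
  { apply Rmult_lt_0_compat; auto. apply Rmult_lt_0_compat; [|lra]. apply Rdiv_lt_0_compat; auto. apply Rmult_lt_0_compat; lra. }
  assert (Hbr : 0 <= q * (1 - ga + c * a - a * a) * exp (a * y)).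
  { apply Rmult_le_pos; [|left; apply exp_pos]. apply Rmult_le_pos. lra.
    destruct Ha as [[-> _]|[-> _]]; lra. }
  destruct (Rle_lt_dec y (- Z)) as [Hy1|Hy1].
  - assert (Ea : a = lam). { destruct Ha as [[-> _]|[_ Hy]]; auto; lra. } subst a.
    assert (Hwd : w <= del). { assert (phi (zeta - d) <= del / 2) by (apply HZl; lra). lra. }
    assert (HS := Hsl v v w (Rle_refl _) (proj1 Hvw) Hwd).
    apply Rle_trans with (q * (1 - ga + c * lam - lam * lam) * exp (lam * y)); [|lra].
    apply Rle_trans with ((G0 + eps) * (q * E * (X * exp (lam * y)))).
    + apply Rle_trans with ((G0 + eps) * (w - v)). lra. apply Rmult_le_compat_l. lra.
      apply Rle_trans with (q * E * eta lam (y - d)). lra. apply Rmult_le_compat_l. lra.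
      unfold X. rewrite -exp_plus. replace (- (lam * d) + lam * y) with (lam * (y - d)) by ring. auto.
    + replace ((G0 + eps) * (q * E * (X * exp (lam * y)))) with (q * ((G0 + eps) * X * E) * exp (lam * y)) by ring.
      apply Rmult_le_compat_r. left; apply exp_pos. apply Rmult_le_compat_l; lra.
  - destruct (Rle_lt_dec Z y) as [Hy2|Hy2].
    + assert (Ea : a = 0). { destruct Ha as [[_ Hy]|[-> _]]; auto; lra. } subst a.
      assert (Hvk : kappa - dk <= v). { assert (kappa - dk / 2 <= phi (zeta - d)) by (apply HZr; lra). lra. }
      assert (HS := ms_neark H w v w Hvk (proj1 Hvw) (Rle_refl _)).
      assert (E0 : exp (0 * y) = 1) by (rewrite Rmult_0_l exp_0; auto). rewrite E0. rewrite E0 in Hbr.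
      assert (k * (w - v) <= q * (k * E)). { replace (q * (k * E)) with (k * (q * E)) by ring. apply Rmult_le_compat_l; lra. }
      assert (q * (k * E) <= q * (1 - ga)) by (apply Rmult_le_compat_l; lra). lra.
    + assert (HS := ms_slopes H v w v w (Rle_refl _) (proj1 Hvw) (Rle_refl _)).
      assert (Hmz : m <= phi1 zeta) by (apply Hzm1; lra).
      assert (L * (w - v) <= L * E / m * q * phi1 zeta); [|lra].
      apply Rle_trans with (L * E / m * q * m).
      * replace (L * E / m * q * m) with (L * (q * E)) by (field; lra). apply Rmult_le_compat_l; lra.
      * apply Rmult_le_compat_l; auto. apply Rmult_le_pos; [|lra]. left. apply Rdiv_lt_0_compat; auto. apply Rmult_lt_0_compat; lra.
Qed.

Definition closed_dom_True : closed_dom (fun _ => True) := fun _ _ _ _ => I.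

Lemma closed_dom_nonpos : closed_dom (fun x => x <= 0).
Proof.
  intros xn x Hn Hx. apply (is_lim_seq_le xn (fun _ => 0) x 0); auto. apply is_lim_seq_const.
Qed.

Lemma is_lim_seq_frame (c : R) (tn xn : nat -> R) (t x b : R) : is_lim_seq tn t -> is_lim_seq xn x ->
  is_lim_seq (fun n => xn n + c * tn n + b) (x + c * t + b).
Proof.
  intros Ht Hx. apply is_lim_seq_plus'; [|apply is_lim_seq_const].
  apply is_lim_seq_plus'; auto. apply is_lim_seq_mult'; auto. apply is_lim_seq_const.
Qed.

Definition stable_above (g : R -> R) (kappa h c lam : R) (phi : R -> R) (u : R -> R -> R) (ga qb C : R) : Prop :=
  forall t0 b q, 0 <= t0 -> 0 < q <= qb ->
    (forall t x, t0 - h <= t <= t0 -> u t x <= phi (x + c * t + b) + q * eta lam (x + c * t + b)) ->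
    forall t x, t0 <= t -> u t x <= phi (x + c * t + b + C * q) + q * exp (- ga * (t - t0)) * eta lam (x + c * t + b).

(** The barrier lives on [x <= 0], hence the two conditions at the origin. Where the moving
    coordinate is nonnegative the weight is 1 and the barrier is below
    [kappa - q e^{- ga (t - t0)}]; where it is negative the barrier is below [phi 0]. *)
Definition stable_below (g : R -> R) (kappa h c lam : R) (phi : R -> R) (u : R -> R -> R) (ga qb C : R) : Prop :=
  forall t0 b q, 0 <= t0 -> 0 < q <= qb ->
    (forall t x, t0 - h <= t <= t0 -> x <= 0 -> phi (x + c * t + b) - q * eta lam (x + c * t + b) <= u t x) ->
    (forall t, t0 <= t -> kappa - q * exp (- ga * (t - t0)) <= u t 0 /\ phi 0 <= u t 0) ->
    forall t x, t0 <= t -> x <= 0 ->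
      phi (x + c * t + b - C * q) - q * exp (- ga * (t - t0)) * eta lam (x + c * t + b) <= u t x.

Lemma ff_mono {g kappa h c lam phi phi1 nu} : fast_front g kappa h c lam phi phi1 nu ->
  forall x y, x <= y -> phi x <= phi y.
Proof.
  intros FF x y Hxy. assert (- phi y <= - phi x); [|lra].
  apply (derive_nonpos_decr (fun z => - phi z) (fun z => - phi1 z) x y Hxy).
  - intros z _. apply is_derive_neg. apply FF.
  - intros z _. generalize (ff_pos FF z). lra.
Qed.

(* Barriers: [phi (y + s t) + q e^{- ga (t - t0)} eta y] and [phi (y - s t) - q e^{- ga (t - t0)} eta y] with
   [y = x + c t + b] and [s' = C1 q e^{- ga (t - t0)}]. The weight handles the ends of the front, where
   [chi lam c < 0] and [k < 1]; in the middle the drift [s' phi1] absorbs the Lipschitz error. *)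
Lemma stability g kappa L G0 k dk h c lam phi phi1 nu eps u : monostable g kappa L G0 k dk ->
  0 <= h -> 0 < eps -> lam ^ 2 - c * lam - 1 + (G0 + eps) * exp (- (lam * (c * h))) < 0 ->
  fast_front g kappa h c lam phi phi1 nu -> evolution g kappa h u ->
  exists gb, 0 < gb /\ forall ga, 0 < ga <= gb -> exists qb C, 0 < qb /\ 0 < C /\ C * qb <= 1 /\
    stable_above g kappa h c lam phi u ga qb C /\ stable_below g kappa h c lam phi u ga qb C.
Proof.
  intros H Hh Heps Hchi FF EV.
  destruct (core_inequality g kappa L G0 k dk h c lam phi phi1 nu eps H Hh Heps Hchi FF) as [gb [Hgb Hcore]].
  exists gb. split; auto. intros ga Hga. destruct (Hcore ga Hga) as [q1 [C1 [Hq1 [HC1 Hc1]]]].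
  assert (Hk := ms_kappa H). assert (HL := ms_L H).
  assert (Hc := ff_c FF). assert (Hlam := ff_lam FF).
  assert (Hrng := ff_rng FF). assert (Hpos := ff_pos FF).
  assert (Hd1 := ff_d1 FF). assert (Hd2 := ff_d2 FF).
  assert (Hmono := ff_mono FF).
  set (E := exp (ga * h)) in *. assert (HE : 0 < E) by apply exp_pos.
  (* The total drift per unit of [q]: the integral of [s' = C1 q e^{- ga (t - t0)}] from [t0 - h] to
     [+oo] is [C q]. *)
  set (C := C1 * E / ga).
  assert (HC : 0 < C). { apply Rdiv_lt_0_compat; [|lra]. apply Rmult_lt_0_compat; auto. }
  (* [q <= 1 / C] keeps the shift [s] at most 1, as [core_inequality] requires of the distance
     between [zeta] and [y]. *)
  exists (Rmin q1 (/ C)), C.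
  assert (Hm1 := Rmin_l q1 (/ C)). assert (Hm2 := Rmin_r q1 (/ C)).
  assert (HiC : 0 < / C) by (apply Rinv_0_lt_compat; auto).
  assert (HCC : C * / C = 1) by (apply Rinv_r; lra).
  assert (Hphic : forall z, continuous phi z).
  { intros z. apply (ex_derive_continuous phi z). eexists; apply Hd1. }
  split. { apply Rmin_pos; auto. }
  split; auto. split. { nra. }
  assert (Hdata : forall t0 q, 0 < q <= Rmin q1 (/ C) -> exists s : R -> R,
     (forall t : R, is_derive s t (C1 * (q * exp (- ga * (t - t0))))) /\
     (forall t, t0 - h <= t -> 0 <= s t) /\ (forall t, s t <= C * q) /\ (forall t, s (t - h) <= s t)).
  { intros t0 q Hq. exists (fun t => C1 * q / ga * (E - exp (- ga * (t - t0)))).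
    assert (Hcoef : 0 < C1 * q / ga). { apply Rdiv_lt_0_compat; [|lra]. apply Rmult_lt_0_compat; lra. }
    split; [|split; [|split]].
    - intros t. auto_derive; auto. unfold Rminus. field. lra.
    - intros t Ht. apply Rmult_le_pos. lra. assert (exp (- ga * (t - t0)) <= E); [|lra].
      apply exp_le_mono. nra.
    - intros t. replace (C * q) with (C1 * q / ga * E) by (unfold C; field; lra).
      apply Rmult_le_compat_l. lra. generalize (exp_pos (- ga * (t - t0))). lra.
    - intros t. apply Rmult_le_compat_l. lra.
      assert (exp (- ga * (t - t0)) <= exp (- ga * (t - h - t0))); [|lra]. apply exp_le_mono. nra. }
  assert (Hqt : forall t0 q t, 0 < q <= Rmin q1 (/ C) -> t0 <= t -> 0 < q * exp (- ga * (t - t0)) <= q).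
  { intros t0 q t Hq Ht. assert (0 < exp (- ga * (t - t0)) <= 1); [|nra].
    split. apply exp_pos. rewrite -exp_0. apply exp_le_mono. nra. }
  assert (Hqh : forall t0 q t, q * exp (- ga * (t - h - t0)) = q * exp (- ga * (t - t0)) * E).
  { intros t0 q t. unfold E. rewrite Rmult_assoc -exp_plus. do 2 f_equal. ring. }
  split.
  - intros t0 b q Ht0 Hq Hinit t1 x1 Ht1.
    destruct (Hdata t0 q Hq) as [s [Hs1 [Hs2 [Hs3 Hs4]]]].
    set (qt := fun t => q * exp (- ga * (t - t0))).
    set (v := fun t x => phi (x + c * t + b + s t) + qt t * eta lam (x + c * t + b)).
    apply Rle_trans with (v t1 x1).
    2:{ unfold v. apply Rplus_le_compat_r. apply Hmono. specialize (Hs3 t1). lra. }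
    apply (comparison u v (fun t x => g (u (t - h) x)) (fun t x => g (v (t - h) x)) (fun _ => True) h L t0 t1 kappa); auto; try lra.
    + apply closed_dom_True.
    + apply seq_cont_le with (- h). lra. apply EV.
    + intros tn xn t x _ _ Lt Lx. unfold v. assert (Lf := is_lim_seq_frame c tn xn t x b Lt Lx).
      apply is_lim_seq_plus'.
      * apply is_lim_seq_continuous_at; auto. apply is_lim_seq_plus'; auto.
        apply (is_lim_seq_ex_derive s); auto. eexists; apply Hs1.
      * apply is_lim_seq_mult'.
        apply (is_lim_seq_ex_derive qt); auto. unfold qt. auto_derive; auto.
        apply is_lim_seq_continuous_at; auto. apply eta_continuous.
    + intros t x Ht _. assert (Hu := ev_rng EV t x ltac:(lra)). unfold v.
      generalize (Hrng (x + c * t + b + s t)) (Hqt t0 q t Hq ltac:(lra)) (eta_pos lam (x + c * t + b)). unfold qt. nra.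
    + intros t x Ht _. apply Rle_trans with (1 := Hinit t x Ht). unfold v. apply Rplus_le_compat.
      * apply Hmono. specialize (Hs2 t ltac:(lra)). lra.
      * apply Rmult_le_compat_r. left; apply eta_pos. unfold qt. rewrite <- (Rmult_1_r q) at 1.
        apply Rmult_le_compat_l. lra. rewrite -exp_0. apply exp_le_mono. nra.
    + intros t x Ht _. right. split; [|split; [|split]].
      * exists 1; split; auto. lra.
      * apply (ev_pde EV). lra.
      * set (y := x + c * t + b). set (zeta := y + s t).
        (* At the touching point [eta] is replaced by its active exponential, which is smooth,
           agrees with it at [y] and lies above it; this gives the test functions in time and in
           space. *)
        destruct (active_exists lam y) as [a Ha].
        assert (Heta := active_eta lam a y Hlam Ha).
        assert (Hst : 0 <= s t <= 1).
        { split. apply Hs2; lra. apply Rle_trans with (1 := Hs3 t). nra. }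
        assert (Hqt' := Hqt t0 q t Hq ltac:(lra)).
        assert (Hcc := Hc1 (qt t) a y zeta (phi (zeta - c * h)) (phi (zeta - c * h) + qt t * E * eta lam (y - c * h))).
        assert (Hcc' : g (phi (zeta - c * h) + qt t * E * eta lam (y - c * h)) - g (phi (zeta - c * h)) <=
           C1 * qt t * phi1 zeta + qt t * (1 - ga + c * a - a * a) * exp (a * y)).
        { apply Hcc; auto.
          - unfold qt; lra.
          - unfold zeta. replace (y + s t - y) with (s t) by ring. rewrite Rabs_pos_eq; lra.
          - split; [|lra]. assert (0 <= qt t * E * eta lam (y - c * h)); [|lra].
            apply Rmult_le_pos. apply Rmult_le_pos; unfold qt; lra. left; apply eta_pos. }
        exists (fun r => phi (x + c * r + b + s r) + qt r * exp (a * (x + c * r + b))),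
          (fun r => phi (r + (c * t + b + s t)) + qt t * exp (a * (r + (c * t + b)))),
          (fun r => phi1 (r + (c * t + b + s t)) + qt t * (a * exp (a * (r + (c * t + b))))),
          ((c + C1 * qt t) * phi1 zeta + (- ga * qt t * exp (a * y) + qt t * (a * c * exp (a * y)))),
          ((c * phi1 zeta + phi zeta - g (phi (zeta - c * h))) + qt t * (a * (a * exp (a * y)))), 1.
        assert (Ez : x + (c * t + b + s t) = zeta) by (unfold zeta, y; ring).
        assert (Ey : x + (c * t + b) = y) by (unfold y; ring).
        split; [lra|]. split. { unfold v. fold y. rewrite Heta. reflexivity. }
        split. { rewrite Ez Ey. unfold v. fold y. fold zeta. rewrite Heta. reflexivity. }
        split. { intros r _. unfold v. apply Rplus_le_compat_l. apply Rmult_le_compat_l.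
          unfold qt. left. apply Rmult_lt_0_compat. lra. apply exp_pos. apply (active_le lam a y); auto. }
        split. { intros r _. unfold v. replace (r + (c * t + b + s t)) with (r + c * t + b + s t) by ring.
          replace (r + (c * t + b)) with (r + c * t + b) by ring.
          apply Rplus_le_compat_l. apply Rmult_le_compat_l. unfold qt; lra. apply (active_le lam a y); auto. }
        split.
        { apply is_derive_add.
          - apply (is_derive_comp_real phi (fun r => x + c * r + b + s r)).
            + apply Hd1.
            + apply is_derive_add; [|apply Hs1]. auto_derive; auto. ring.
          - apply (is_derive_mul qt (fun r => exp (a * (x + c * r + b)))).
            + unfold qt. auto_derive; auto. unfold Rminus. ring.
            + auto_derive; auto. unfold y. ring. }
        split.
        { intros r _. apply is_derive_add. apply is_derive_shift; auto.
          apply is_derive_cmul. auto_derive; auto. ring. }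
        split.
        { apply is_derive_add. apply (is_derive_shift phi1). rewrite Ez. apply Hd2.
          apply is_derive_cmul. auto_derive; auto. rewrite Ey. ring. }
        assert (Hvh : g (v (t - h) x) <= g (phi (zeta - c * h) + qt t * E * eta lam (y - c * h))).
        { apply (ms_mono H). unfold v.
          replace (x + c * (t - h) + b) with (y - c * h) by (unfold y; ring).
          apply Rplus_le_compat.
          - apply Hmono. unfold zeta. specialize (Hs4 t). lra.
          - unfold qt. rewrite Hqh. lra. }
        replace (v t x) with (phi zeta + qt t * exp (a * y)) by (rewrite -Heta; reflexivity).
        assert (Ering : (c + C1 * qt t) * phi1 zeta + (- ga * qt t * exp (a * y) + qt t * (a * c * exp (a * y))) -
          (c * phi1 zeta + phi zeta - g (phi (zeta - c * h)) + qt t * (a * (a * exp (a * y)))) + (phi zeta + qt t * exp (a * y))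
          = g (phi (zeta - c * h)) + (C1 * qt t * phi1 zeta + qt t * (1 - ga + c * a - a * a) * exp (a * y))) by ring.
        rewrite Ering. lra.
      * intros e He Hue.
        apply Rle_trans with (g (v (t - h) x + e)). apply (ms_mono H); auto.
        assert (HS := ms_slopes H (v (t - h) x) (v (t - h) x + e) (v (t - h) x) (v (t - h) x + e) (Rle_refl _) ltac:(lra) (Rle_refl _)).
        lra.
  - intros t0 b q Ht0 Hq Hinit Hbd t1 x1 Ht1 Hx1.
    destruct (Hdata t0 q Hq) as [s [Hs1 [Hs2 [Hs3 Hs4]]]].
    set (qt := fun t => q * exp (- ga * (t - t0))).
    set (v := fun t x => phi (x + c * t + b - s t) - qt t * eta lam (x + c * t + b)).
    apply Rle_trans with (v t1 x1).
    { unfold v, qt. apply Rplus_le_compat_r. apply Hmono. specialize (Hs3 t1). lra. }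
    apply (comparison_below u v (fun t x => g (u (t - h) x)) (fun t x => g (v (t - h) x)) (fun x => x <= 0) h L t0 t1 kappa); auto; try lra.
    + apply closed_dom_nonpos.
    + apply seq_cont_le with (- h). lra. apply EV.
    + intros tn xn t x _ _ Lt Lx. unfold v. assert (Lf := is_lim_seq_frame c tn xn t x b Lt Lx).
      apply is_lim_seq_minus'.
      * apply is_lim_seq_continuous_at; auto. apply is_lim_seq_minus'; auto.
        apply (is_lim_seq_ex_derive s); auto. eexists; apply Hs1.
      * apply is_lim_seq_mult'.
        apply (is_lim_seq_ex_derive qt); auto. unfold qt. auto_derive; auto.
        apply is_lim_seq_continuous_at; auto. apply eta_continuous.
    + intros t x Ht _. assert (Hu := ev_rng EV t x ltac:(lra)). unfold v.
      generalize (Hrng (x + c * t + b - s t)) (Hqt t0 q t Hq ltac:(lra)) (eta_pos lam (x + c * t + b)). unfold qt. nra.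
    + intros t x Ht Hx. apply Rle_trans with (2 := Hinit t x Ht Hx). unfold v.
      apply Rplus_le_compat.
      * apply Hmono. specialize (Hs2 t ltac:(lra)). lra.
      * apply Ropp_le_contravar. apply Rmult_le_compat_r. left; apply eta_pos. unfold qt. rewrite <- (Rmult_1_r q) at 1.
        apply Rmult_le_compat_l. lra. rewrite -exp_0. apply exp_le_mono. nra.
    + intros t x Ht Hx. destruct (Req_dec x 0) as [->|Hx0].
      { left. destruct (Hbd t ltac:(lra)) as [Hb1 Hb2]. assert (Hst := Hs2 t ltac:(lra)).
        assert (Hqt' := Hqt t0 q t Hq ltac:(lra)). unfold v. destruct (Rle_lt_dec 0 (0 + c * t + b)) as [Hy|Hy].
        - rewrite eta_right; try lra. specialize (Hrng (0 + c * t + b - s t)). unfold qt in *. lra.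
        - apply Rle_trans with (2 := Hb2). apply Rle_trans with (phi (0 + c * t + b - s t)).
          + assert (0 < qt t * eta lam (0 + c * t + b)); [|lra]. apply Rmult_lt_0_compat. unfold qt; lra. apply eta_pos.
          + apply Hmono. lra. }
      right. split; [|split; [|split]].
      * exists (- x). split. lra. intros y Hy. apply Rabs_lt_between in Hy. lra.
      * apply (ev_pde EV). lra.
      * set (y := x + c * t + b). set (zeta := y - s t).
        destruct (active_exists lam y) as [a Ha].
        assert (Heta := active_eta lam a y Hlam Ha).
        assert (Hst : 0 <= s t <= 1).
        { split. apply Hs2; lra. apply Rle_trans with (1 := Hs3 t). nra. }
        assert (Hqt' := Hqt t0 q t Hq ltac:(lra)).
        assert (Hcc := Hc1 (qt t) a y zeta (phi (zeta - c * h) - qt t * E * eta lam (y - c * h)) (phi (zeta - c * h))).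
        assert (Hcc' : g (phi (zeta - c * h)) - g (phi (zeta - c * h) - qt t * E * eta lam (y - c * h)) <=
           C1 * qt t * phi1 zeta + qt t * (1 - ga + c * a - a * a) * exp (a * y)).
        { apply Hcc; auto.
          - unfold qt; lra.
          - unfold zeta. replace (y - s t - y) with (- s t) by ring. rewrite Rabs_Ropp Rabs_pos_eq; lra.
          - split; [|lra]. assert (0 <= qt t * E * eta lam (y - c * h)); [|lra].
            apply Rmult_le_pos. apply Rmult_le_pos; unfold qt; lra. left; apply eta_pos. }
        exists (fun r => phi (x + c * r + b - s r) - qt r * exp (a * (x + c * r + b))),
          (fun r => phi (r + (c * t + b - s t)) - qt t * exp (a * (r + (c * t + b)))),
          (fun r => phi1 (r + (c * t + b - s t)) - qt t * (a * exp (a * (r + (c * t + b))))),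
          ((c - C1 * qt t) * phi1 zeta - (- ga * qt t * exp (a * y) + qt t * (a * c * exp (a * y)))),
          ((c * phi1 zeta + phi zeta - g (phi (zeta - c * h))) - qt t * (a * (a * exp (a * y)))), 1.
        assert (Ez : x + (c * t + b - s t) = zeta) by (unfold zeta, y; ring).
        assert (Ey : x + (c * t + b) = y) by (unfold y; ring).
        split; [lra|]. split. { unfold v. fold y. rewrite Heta. reflexivity. }
        split. { rewrite Ez Ey. unfold v. fold y. fold zeta. rewrite Heta. reflexivity. }
        split. { intros r _. unfold v. apply Rplus_le_compat_l, Ropp_le_contravar. apply Rmult_le_compat_l.
          unfold qt. left. apply Rmult_lt_0_compat. lra. apply exp_pos. apply (active_le lam a y); auto. }
        split. { intros r _. unfold v. replace (r + (c * t + b - s t)) with (r + c * t + b - s t) by ring.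
          replace (r + (c * t + b)) with (r + c * t + b) by ring.
          apply Rplus_le_compat_l, Ropp_le_contravar. apply Rmult_le_compat_l. unfold qt; lra. apply (active_le lam a y); auto. }
        split.
        { apply is_derive_sub.
          - apply (is_derive_comp_real phi (fun r => x + c * r + b - s r)).
            + apply Hd1.
            + apply is_derive_sub; [|apply Hs1]. auto_derive; auto. ring.
          - apply (is_derive_mul qt (fun r => exp (a * (x + c * r + b)))).
            + unfold qt. auto_derive; auto. unfold Rminus. ring.
            + auto_derive; auto. unfold y. ring. }
        split.
        { intros r _. apply is_derive_sub. apply is_derive_shift; auto.
          apply is_derive_cmul. auto_derive; auto. ring. }
        split.
        { apply is_derive_sub. apply (is_derive_shift phi1). rewrite Ez. apply Hd2.
          apply is_derive_cmul. auto_derive; auto. rewrite Ey. ring. }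
        assert (Hvh : g (phi (zeta - c * h) - qt t * E * eta lam (y - c * h)) <= g (v (t - h) x)).
        { apply (ms_mono H). unfold v.
          replace (x + c * (t - h) + b) with (y - c * h) by (unfold y; ring).
          apply Rplus_le_compat.
          - apply Hmono. unfold zeta. specialize (Hs4 t). lra.
          - unfold qt. rewrite Hqh. lra. }
        replace (v t x) with (phi zeta - qt t * exp (a * y)) by (rewrite -Heta; reflexivity).
        assert (Ering : (c - C1 * qt t) * phi1 zeta - (- ga * qt t * exp (a * y) + qt t * (a * c * exp (a * y))) -
          (c * phi1 zeta + phi zeta - g (phi (zeta - c * h)) - qt t * (a * (a * exp (a * y)))) + (phi zeta - qt t * exp (a * y))
          = g (phi (zeta - c * h)) - (C1 * qt t * phi1 zeta + qt t * (1 - ga + c * a - a * a) * exp (a * y))) by ring.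
        rewrite Ering. lra.
      * intros e He Hue.
        apply Rle_trans with (g (v (t - h) x - e)).
        { assert (HS := ms_slopes H (v (t - h) x - e) (v (t - h) x) (v (t - h) x - e) (v (t - h) x) (Rle_refl _) ltac:(lra) (Rle_refl _)). lra. }
        apply (ms_mono H); auto.
Qed.

(** * Invariant range and invasion of the origin *)

Lemma solves_heat_at g h u t x : solves_at g h u t x -> heat_at u (g (u (t - h) x)) t x.
Proof.
  intros [H1 [H2 [H3 H4]]].
  exists (Derive (u t)), (Derive (fun s => u s x) t), (Derive (Derive (u t)) x).
  split; [apply Derive_correct; auto|split; [|split; [apply Derive_correct; auto|auto]]].
  intros y. apply Derive_correct; auto.
Qed.

(** The range [[0, kappa]] follows by comparison with the two constants. During the comparison [u]
    may leave this range; the slope bounds of the extended [g] then give [g (- e) >= - L e] and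
    [g (kappa + e) <= kappa + L e]. *)
Lemma ivp_evolution g kappa L G0 k dk h w0 u : monostable g kappa L G0 k dk -> 0 <= h ->
  (forall s x, - h <= s <= 0 -> 0 <= w0 s x <= kappa) -> ivp_solution g h w0 u -> evolution g kappa h u.
Proof.
  intros H Hh Hw [Hi [Hc [Hb Hp]]].
  assert (Hk := ms_kappa H). assert (HL := ms_L H).
  assert (Hcont : seq_cont (- h) u).
  { intros tn xn t x Hn Ht Lt Lx. specialize (Hc t x Ht).
    unfold is_lim_seq. intros P HP. specialize (Hc P HP). destruct Hc as [e He].
    destruct (Lt (ball t e)) as [n1 Hn1]. exists e; auto.
    destruct (Lx (ball x e)) as [n2 Hn2]. exists e; auto.
    exists (Nat.max n1 n2). intros n Hnn. apply (He (tn n, xn n)).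
    - split; [apply Hn1|apply Hn2]; lia.
    - simpl. apply Hn. }
  assert (Hdomint : forall x : R, exists d, 0 < d /\ forall y : R, Rabs (y - x) < d -> True).
  { intros x. exists 1; split; auto; lra. }
  assert (Hconst : forall K t x, supersol_at (fun _ _ => K) K t x /\ subsol_at (fun _ _ => K) K t x).
  { intros K t x. split; exists (fun _ => K), (fun _ => K), (fun _ => 0), 0, 0, 1;
    (split; [lra|split; [auto|split; [auto|split; [intros; lra|split; [intros; lra|
     split; [apply (is_derive_const K t)|split; [intros; apply (is_derive_const K y)|split; [apply (is_derive_const 0 x)|lra]]]]]]]]). }
  assert (Hinit : forall t x, 0 - h <= t <= 0 -> 0 <= u t x <= kappa).
  { intros t x Ht. rewrite Hi; [|lra]. apply Hw. lra. }
  constructor; auto.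
  2:{ intros t x Ht. apply solves_heat_at. auto. }
  intros t x Ht. destruct (Rle_lt_dec t 0) as [Ht0|Ht0]. { apply Hinit. lra. }
  destruct (Hb t) as [M HM]. split.
  - apply (comparison_below u (fun _ _ => 0) (fun t x => g (u (t - h) x)) (fun _ _ => 0) (fun _ => True) h L 0 t M); auto; try lra.
    + apply closed_dom_True.
    + apply seq_cont_le with (- h); auto. lra.
    + apply seq_cont_const.
    + intros s y Hs _. specialize (HM s y ltac:(lra)). apply Rabs_le_between in HM. lra.
    + intros s y Hs _. apply Hinit. lra.
    + intros s y Hs _. right. split; [apply (Hdomint y)|split; [apply solves_heat_at; apply Hp; lra|split; [apply Hconst|]]].
      intros e He Hle.
      assert (HS := ms_slopes H (- e) 0 (- e) 0 (Rle_refl _) ltac:(lra) (Rle_refl _)).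
      rewrite (ms_0 H) in HS. apply Rle_trans with (g (- e)). lra. apply (ms_mono H). lra.
  - apply (comparison u (fun _ _ => kappa) (fun t x => g (u (t - h) x)) (fun _ _ => kappa) (fun _ => True) h L 0 t M); auto; try lra.
    + apply closed_dom_True.
    + apply seq_cont_le with (- h); auto. lra.
    + apply seq_cont_const.
    + intros s y Hs _. specialize (HM s y ltac:(lra)). apply Rabs_le_between in HM. lra.
    + intros s y Hs _. apply Hinit. lra.
    + intros s y Hs _. right. split; [apply (Hdomint y)|split; [apply solves_heat_at; apply Hp; lra|split; [apply Hconst|]]].
      intros e He Hle.
      assert (HS := ms_slopes H kappa (kappa + e) kappa (kappa + e) (Rle_refl _) ltac:(lra) (Rle_refl _)).
      rewrite (ms_k H) in HS. apply Rle_trans with (g (kappa + e)). apply (ms_mono H). lra. lra.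
Qed.

Lemma evolution_continuous_x g kappa h u t x : evolution g kappa h u -> - h <= t -> continuous (u t) x.
Proof.
  intros EV Ht. apply continuous_of_near. intros eps He. apply NNPP. intros Hno.
  assert (Hn : forall n : nat, exists y, Rabs (y - x) < / (INR n + 1) /\ eps <= Rabs (u t y - u t x)).
  { intros n. apply NNPP. intros Hc. apply Hno. exists (/ (INR n + 1)). split.
    apply Rinv_0_lt_compat. generalize (pos_INR n); lra.
    intros y Hy. apply Rnot_le_lt. intros Hle. apply Hc. exists y; auto. }
  destruct (choice _ Hn) as [yn Hyn].
  assert (Hl : is_lim_seq yn x).
  { apply is_lim_seq_of_near. intros e Hepos.
    destruct (nfloor_ex (/ e)) as [n0 Hn0]. { left; apply Rinv_0_lt_compat; auto. }
    exists n0. intros n Hnn. destruct (Hyn n) as [A _]. apply Rlt_le. apply Rlt_le_trans with (1 := A).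
    rewrite <- (Rinv_inv e). apply Rinv_le_contravar. apply Rinv_0_lt_compat; auto. apply le_INR in Hnn. lra. }
  assert (Hu := ev_cont EV (fun _ => t) yn t x (fun _ => Ht) Ht (is_lim_seq_const t) Hl).
  destruct (is_lim_seq_near _ _ (eps / 2) Hu) as [n0 Hn0]. lra.
  specialize (Hn0 n0 (Nat.le_refl n0)). destruct (Hyn n0) as [_ A]. lra.
Qed.

(** The datum may be positive only at negative times [s]; the case [s = - h] is first moved inside
    the window by continuity. A zero at time [s + h] would be a minimum in space and over the past,
    while the delayed reaction [g (u s x)] is positive there. *)
Lemma positive_somewhere g kappa L G0 k dk h u : monostable g kappa L G0 k dk -> 0 <= h ->
  evolution g kappa h u -> (exists s x, - h <= s <= 0 /\ 0 < u s x) -> exists t x, 0 <= t /\ 0 < u t x.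
Proof.
  intros H Hh EV [s [x [Hs Hpos]]].
  destruct (Req_dec s 0) as [->|Hs0]. { exists 0, x. split; auto; lra. }
  assert (Hex : exists s', - h < s' <= 0 /\ 0 < u s' x).
  { destruct (Req_dec s (- h)) as [->|Hsh]; [|exists s; split; auto; lra].
    set (sn := fun n : nat => - h + h / (INR n + 1)).
    assert (Hsn : forall n, - h < sn n <= 0).
    { intros n. unfold sn. assert (Hn := pos_INR n). assert (0 < h / (INR n + 1)) by (apply Rdiv_lt_0_compat; lra).
      assert (h / (INR n + 1) * (INR n + 1) = h) by (field; lra). nra. }
    assert (Hl : is_lim_seq sn (- h)).
    { apply is_lim_seq_of_near. intros e Hepos.
      destruct (nfloor_ex (h / e)) as [n0 Hn0]. { left; apply Rdiv_lt_0_compat; lra. }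
      exists n0. intros n Hnn. unfold sn. replace (- h + h / (INR n + 1) - - h) with (h / (INR n + 1)) by ring.
      apply le_INR in Hnn. assert (Hn := pos_INR n).
      rewrite Rabs_pos_eq. 2:{ left; apply Rdiv_lt_0_compat; lra. }
      apply Rmult_le_reg_r with (INR n + 1). lra. replace (h / (INR n + 1) * (INR n + 1)) with h by (field; lra).
      apply Rle_trans with (e * (h / e)). right; field; lra. apply Rmult_le_compat_l; lra. }
    assert (Hu := ev_cont EV sn (fun _ => x) (- h) x (fun n => Rlt_le _ _ (proj1 (Hsn n))) (Rle_refl _) Hl (is_lim_seq_const x)).
    destruct (eventually_of_lim_gt _ _ 0 Hu Hpos) as [n Hn]. exists (sn n). auto. }
  destruct Hex as [s' [Hs' Hpos']].
  exists (s' + h), x. split. lra.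
  destruct (Rle_lt_or_eq_dec _ _ (proj1 (ev_rng EV (s' + h) x ltac:(lra)))) as [|E]; auto. exfalso. symmetry in E.
  destruct (ev_pde EV (s' + h) x ltac:(lra)) as [u1 [ut [uxx [D1 [D2 [D3 D4]]]]]].
  replace (s' + h - h) with s' in D4 by ring.
  assert (A1 : 0 <= - ut).
  { apply (left_max_derive (fun s => - u s x) (s' + h) _ (s' + h)). lra. apply is_derive_neg; auto.
    intros r Hr. generalize (ev_rng EV r x ltac:(lra)). lra. }
  assert (A2 : - uxx <= 0).
  { apply (local_max_derive2 (fun y => - u (s' + h) y) (fun y => - u1 y) x _ 1). lra.
    - intros y _. apply is_derive_neg; auto.
    - apply is_derive_neg; auto.
    - intros y _. generalize (ev_rng EV (s' + h) y ltac:(lra)). lra. }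
  assert (A3 : 0 < g (u s' x)).
  { assert (Hr := ev_rng EV s' x ltac:(lra)). destruct (Req_dec (u s' x) kappa) as [->|Hne].
    - rewrite (ms_k H). apply (ms_kappa H).
    - assert (u s' x < g (u s' x)); [|lra]. apply (ms_above H). lra. }
  lra.
Qed.

(** Near 0 the slope is at least [1 + (G0 - 1) / 2]; on the remaining compact part the minimum of
    [g B - B] is positive. The factor 2 leaves one [w] for diffusion and one for growth in time with
    its delay. *)
Lemma linear_growth g kappa L G0 k dk k1 : monostable g kappa L G0 k dk -> 0 < k1 < kappa ->
  exists w, 0 < w /\ forall B, 0 <= B <= k1 -> (1 + 2 * w) * B <= g B.
Proof.
  intros H Hk1. assert (HG := ms_G0 H).
  destruct (ms_near0 H ((G0 - 1) / 2)) as [d [Hd Hs]]. lra.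
  set (d' := Rmin d k1). assert (Hd' : 0 < d') by (apply Rmin_pos; lra).
  assert (D1 : d' <= d) by apply Rmin_l. assert (D2 : d' <= k1) by apply Rmin_r.
  destruct (continuity_ab_min (fun B => g B - B) d' k1) as [zm [Hm1 Hm2]]. auto.
  { intros B _. apply continuity_pt_filterlim. apply (continuous_minus g (fun B => B)).
    apply (ms_continuous H). apply continuous_id. }
  set (m := g zm - zm) in *.
  assert (Hm : 0 < m). { unfold m. generalize (ms_above H zm ltac:(lra)). lra. }
  exists (Rmin ((G0 - 1) / 4) (m / (2 * k1))). split.
  { apply Rmin_pos; apply Rdiv_lt_0_compat; lra. }
  set (w := Rmin ((G0 - 1) / 4) (m / (2 * k1))).
  assert (W1 : w <= (G0 - 1) / 4) by apply Rmin_l. assert (W2 : w <= m / (2 * k1)) by apply Rmin_r.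
  intros B HB. destruct (Rle_lt_dec B d') as [Hle|Hlt].
  - assert (HS := Hs 0 0 B (Rle_refl 0) (proj1 HB) ltac:(lra)). rewrite (ms_0 H) !Rminus_0_r in HS. nra.
  - assert (HS := Hm1 B ltac:(lra)). cbv beta in HS. fold m in HS.
    assert (w * (2 * k1) <= m). { apply Rle_trans with (m / (2 * k1) * (2 * k1)). apply Rmult_le_compat_r; lra. right; field; lra. }
    nra.
Qed.

(* Barrier: a fixed bump with amplitude [min (a0 e^{sig (t - t1)}, k1)]; the radius [Rad = 3 / sqrt w] makes
   [bump'' / Rad^2 + w bump >= 0], so diffusion costs at most a part of the growth rate of [g]. *)
Lemma bump_growth g kappa L G0 k dk h u k1 : monostable g kappa L G0 k dk -> 0 <= h -> 0 < k1 < kappa ->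
  evolution g kappa h u -> exists Rad sig, 0 < Rad /\ 0 < sig /\
  forall y t1 a0, 0 <= t1 -> 0 < a0 -> (forall t x, t1 - h <= t <= t1 -> Rabs (x - y) <= Rad -> a0 <= u t x) ->
  forall t, t1 <= t -> Rmin (a0 * exp (sig * (t - t1))) k1 <= u t y.
Proof.
  intros H Hh Hk1 EV.
  destruct (linear_growth _ _ _ _ _ _ k1 H Hk1) as [w [Hw Hgw]].
  assert (HL := ms_L H).
  set (Rad := 3 / sqrt w).
  assert (Hsq : 0 < sqrt w) by (apply sqrt_lt_R0; auto).
  assert (HRad : 0 < Rad) by (apply Rdiv_lt_0_compat; lra).
  assert (HwR : / (Rad * Rad) = w / 9).
  { unfold Rad. rewrite -{3}(sqrt_sqrt w); [|lra]. field. lra. }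
  assert (Hsig : exists sig, 0 < sig /\ (1 + w + sig) * exp (sig * h) <= 1 + 2 * w).
  { assert (Hc : continuous (fun s => (1 + w + s) * exp (s * h)) 0).
    { apply (ex_derive_continuous (fun s => (1 + w + s) * exp (s * h))). auto_derive; auto. }
    destruct (continuous_near _ 0 w Hc Hw) as [d [Hd Hs]]. exists (d / 2). split. lra.
    specialize (Hs (d / 2)). rewrite Rminus_0_r Rabs_pos_eq in Hs; [|lra]. specialize (Hs ltac:(lra)).
    rewrite Rmult_0_l exp_0 in Hs. apply Rabs_lt_between in Hs. lra. }
  destruct Hsig as [sig [Hsig Hsig']].
  exists Rad, sig. split; [auto|split; auto].
  intros y t1 a0 Ht1 Ha0 Hinit.
  set (A := fun t => Rmin (a0 * exp (sig * (t - t1))) k1).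
  set (xi := fun x => (x - y) / Rad).
  set (v := fun t x => A t * bump (xi x)).
  assert (HA : forall t, 0 < A t <= k1).
  { intros t. split. apply Rmin_pos; [|lra]. apply Rmult_lt_0_compat; auto. apply exp_pos. apply Rmin_r. }
  assert (HxiR : forall x, Rabs (xi x) * Rad = Rabs (x - y)).
  { intros x. unfold xi, Rdiv. rewrite Rabs_mult (Rabs_pos_eq (/ Rad)). field. lra. left; apply Rinv_0_lt_compat; auto. }
  assert (Hmain : forall t x, t1 <= t -> v t x <= u t x).
  { intros t2 x2 Ht2.
    apply (comparison_below u v (fun t x => g (u (t - h) x)) (fun t x => g (v (t - h) x)) (fun _ => True) h L t1 t2 k1); auto; try lra.
    - apply closed_dom_True.
    - apply seq_cont_le with (- h). lra. apply EV.
    - intros tn xn t x _ _ Lt Lx. unfold v. apply is_lim_seq_mult'.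
      + apply is_lim_seq_continuous_at; auto. apply (Rmin_continuous (fun t => a0 * exp (sig * (t - t1))) (fun _ => k1)).
        apply (ex_derive_continuous (fun t => a0 * exp (sig * (t - t1)))). auto_derive; auto. apply continuous_const.
      + apply is_lim_seq_continuous_at. apply bump_continuous.
        apply (is_lim_seq_ex_derive xi); auto. unfold xi. auto_derive; auto.
    - intros t x Ht _. generalize (ev_rng EV t x ltac:(lra)) (HA t) (bump_bounds (xi x)). unfold v. nra.
    - intros t x Ht _. unfold v. destruct (Rle_lt_dec (Rabs (x - y)) Rad) as [Hx|Hx].
      + apply Rle_trans with (2 := Hinit t x Ht Hx).
        assert (A t <= a0).
        { apply Rle_trans with (1 := Rmin_l _ _). rewrite <- (Rmult_1_r a0) at 2. apply Rmult_le_compat_l. lra.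
          rewrite -exp_0. apply exp_le_mono. nra. }
        generalize (HA t) (bump_bounds (xi x)). nra.
      + rewrite bump_out. generalize (ev_rng EV t x ltac:(lra)). lra.
        apply Rmult_le_reg_r with Rad; auto. rewrite HxiR. lra.
    - intros t x Ht _. destruct (Rle_lt_dec 1 (Rabs (xi x))) as [Hx|Hx].
      { left. unfold v. rewrite bump_out; auto. generalize (ev_rng EV t x ltac:(lra)). lra. }
      right. split; [exists 1; split; auto; lra|]. split; [apply (ev_pde EV); lra|]. split.
      + set (tau := 1 - xi x * xi x).
        assert (Hb : bump (xi x) = tau ^ 2) by (apply bump_in; lra).
        (* The amplitude has a kink where it reaches the cap [k1]. It is touched from below, in the
           past, by the exponential until then and by the constant [k1] afterwards. *)
        assert (Htime : exists p dp d, 0 < d /\ p t = A t /\ (forall s, t - d < s <= t -> p s <= A s) /\ is_derive p t dp /\ dp <= sig * A t).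
        { destruct (Rle_lt_dec (a0 * exp (sig * (t - t1))) k1) as [Hc|Hc].
          - exists (fun s => a0 * exp (sig * (s - t1))), (sig * (a0 * exp (sig * (t - t1)))), 1.
            assert (EA : A t = a0 * exp (sig * (t - t1))) by (apply Rmin_left; auto).
            split; [lra|split; [auto|split; [|split; [|rewrite EA; lra]]]].
            + intros s Hs. apply Rmin_glb. lra. apply Rle_trans with (2 := Hc). apply Rmult_le_compat_l. lra.
              apply exp_le_mono. nra.
            + auto_derive; auto. unfold Rminus. ring.
          - assert (Hcc : continuous (fun s => a0 * exp (sig * (s - t1))) t).
            { apply (ex_derive_continuous (fun t => a0 * exp (sig * (t - t1)))). auto_derive; auto. }
            destruct (continuous_near _ t (a0 * exp (sig * (t - t1)) - k1) Hcc) as [d [Hd Hs]]. lra.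
            exists (fun _ => k1), 0, d.
            assert (EA : A t = k1) by (apply Rmin_right; lra).
            split; [auto|split; [auto|split; [|split; [apply (is_derive_const k1 t)|rewrite EA; nra]]]].
            intros s Hss. apply Rmin_glb; [|lra]. specialize (Hs s). rewrite Rabs_left1 in Hs; [|lra].
            specialize (Hs ltac:(lra)). apply Rabs_lt_between in Hs. lra. }
        destruct Htime as [p [dp [d [Hd [Hp1 [Hp2 [Hp3 Hp4]]]]]]].
        set (d2 := Rad * (1 - Rabs (xi x))).
        assert (Hd2 : 0 < d2) by (apply Rmult_lt_0_compat; lra).
        assert (Hin : forall z, Rabs (z - x) < d2 -> Rabs (xi z) <= 1).
        { intros z Hz. apply Rmult_le_reg_r with Rad; auto. rewrite HxiR.
          replace (z - y) with ((z - x) + (x - y)) by ring. apply Rle_trans with (1 := Rabs_triang _ _).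
          rewrite -(HxiR x). unfold d2 in Hz. lra. }
        exists (fun s => bump (xi x) * p s), (fun z => A t * (1 - xi z * xi z) ^ 2),
          (fun z => A t * (2 * (1 - xi z * xi z) * (- 2 * xi z / Rad))),
          (bump (xi x) * dp), (A t * ((8 - 12 * tau) * (w / 9))), (Rmin d d2).
        assert (M1 := Rmin_l d d2). assert (M2 := Rmin_r d d2).
        split; [apply Rmin_pos; auto|]. split. { unfold v. rewrite Hp1. ring. }
        split. { unfold v. rewrite Hb. reflexivity. }
        split. { intros s Hs. unfold v. rewrite Rmult_comm. apply Rmult_le_compat_r. apply bump_bounds. apply Hp2. lra. }
        split. { intros z Hz. unfold v. rewrite bump_in. lra. apply Hin. lra. }
        split. { apply is_derive_cmul; auto. }
        split. { intros z _. unfold xi. auto_derive; auto. unfold Rminus. field. lra. }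
        split. { rewrite -HwR. unfold xi. auto_derive; auto. unfold tau, xi. unfold Rminus. field. lra. }
        assert (Hpast : A t * exp (- sig * h) <= A (t - h)).
        { apply Rmin_glb.
          - apply Rle_trans with (a0 * exp (sig * (t - t1)) * exp (- sig * h)).
            apply Rmult_le_compat_r. left; apply exp_pos. apply Rmin_l.
            right. rewrite Rmult_assoc -exp_plus. do 2 f_equal. ring.
          - rewrite <- (Rmult_1_r k1). apply Rmult_le_compat. left; apply HA. left; apply exp_pos. apply HA.
            rewrite -exp_0. apply exp_le_mono. nra. }
        assert (Hb01 := bump_bounds (xi x)).
        assert (Hgv : (1 + 2 * w) * (A (t - h) * bump (xi x)) <= g (v (t - h) x)).
        { apply Hgw. destruct (HA (t - h)) as [A1 A2]. split. apply Rmult_le_pos; lra.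
          apply Rle_trans with (A (t - h) * 1); [|lra]. apply Rmult_le_compat_l; lra. }
        assert (Hes : (1 + w + sig) <= (1 + 2 * w) * exp (- sig * h)).
        { apply Rmult_le_reg_r with (exp (sig * h)). apply exp_pos.
          rewrite Rmult_assoc -exp_plus. replace (- sig * h + sig * h) with 0 by ring. rewrite exp_0. lra. }
        assert (HAb : 0 <= A t * bump (xi x)). { destruct (HA t) as [A1 A2]. apply Rmult_le_pos; lra. }
        assert (S1 : bump (xi x) * dp <= sig * (A t * bump (xi x))).
        { replace (sig * (A t * bump (xi x))) with (bump (xi x) * (sig * A t)) by ring. apply Rmult_le_compat_l; lra. }
        assert (S2 : (1 + w + sig) * (A t * bump (xi x)) <= g (v (t - h) x)).
        { apply Rle_trans with (2 := Hgv).
          apply Rle_trans with ((1 + 2 * w) * (A t * exp (- sig * h) * bump (xi x))).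
          - replace ((1 + 2 * w) * (A t * exp (- sig * h) * bump (xi x))) with ((1 + 2 * w) * exp (- sig * h) * (A t * bump (xi x))) by ring.
            apply Rmult_le_compat_r; auto.
          - apply Rmult_le_compat_l. lra. apply Rmult_le_compat_r; lra. }
        assert (S3 : 0 <= A t * ((8 - 12 * tau) * (w / 9)) + w * (A t * bump (xi x))).
        { rewrite Hb. replace (A t * ((8 - 12 * tau) * (w / 9)) + w * (A t * tau ^ 2)) with
            (A t * w * ((tau - 2 / 3) ^ 2 + 4 / 9)) by field.
          apply Rmult_le_pos. apply Rmult_le_pos. left; apply HA. lra. generalize (pow2_ge_0 (tau - 2 / 3)). lra. }
        unfold v at 1. lra.
      + intros e He Hue.
        apply Rle_trans with (g (v (t - h) x - e)).
        { assert (HS := ms_slopes H (v (t - h) x - e) (v (t - h) x) (v (t - h) x - e) (v (t - h) x) (Rle_refl _) ltac:(lra) (Rle_refl _)). lra. }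
        apply (ms_mono H); auto. }
  intros t Ht. specialize (Hmain t y Ht). unfold v, xi in Hmain.
  rewrite Rminus_diag in Hmain. unfold Rdiv in Hmain. rewrite Rmult_0_l bump_in in Hmain; [|rewrite Rabs_R0; lra].
  unfold A in Hmain. lra.
Qed.

(** A bump starting near a point of positivity spreads with speed 1 and covers a neighbourhood of
    [y], within time [D = D0 + |y|], with amplitude at least [m e^{- K D}]; [bump_growth] then needs
    at most the time [(l + K D) / sig] to lift it to [k1]. Both times are affine in [|y|], which
    yields the cone. *)
Lemma hair_trigger g kappa L G0 k dk h u k1 : monostable g kappa L G0 k dk -> 0 <= h -> 0 < k1 < kappa ->
  evolution g kappa h u -> (exists s x, - h <= s <= 0 /\ 0 < u s x) ->
  exists T C, 0 <= T /\ 0 < C /\ forall t x, T + C * Rabs x <= t -> k1 <= u t x.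
Proof.
  intros H Hh Hk1 EV Hex.
  destruct (positive_somewhere _ _ _ _ _ _ h u H Hh EV Hex) as [T1 [x1 [HT1 Hpos]]].
  destruct (bump_growth _ _ _ _ _ _ h u k1 H Hh Hk1 EV) as [Rad [sig [HRad [Hsig Hgrow]]]].
  assert (Hc := evolution_continuous_x g kappa h u T1 x1 EV ltac:(lra)).
  set (m := u T1 x1 / 2). assert (Hm : 0 < m) by (unfold m; lra).
  destruct (continuous_near _ _ m Hc Hm) as [r0 [Hr0 Hnear]].
  set (r := r0 / 2).
  destruct (spread r 1) as [K [HK Hsp]]. unfold r; lra. lra.
  assert (Hlow : forall t x, T1 < t -> Rabs (x - x1) <= t - T1 -> m * exp (- K * (t - T1)) <= u t x).
  { intros t x Ht Hx. rewrite -(Rminus_0_r (m * _)).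
    apply (Hsp u (fun t x => g (u (t - h) x)) T1 t x1 m 0); auto; try lra.
    - apply seq_cont_le with (- h). lra. apply EV.
    - intros s y Hs _. generalize (ev_rng EV s y ltac:(lra)). lra.
    - intros s y Hs _. split. apply (ev_pde EV). lra. rewrite Ropp_0.
      apply (ms_range H). apply (ev_rng EV). lra.
    - intros y Hy. specialize (Hnear y). assert (HH : Rabs (u T1 y - u T1 x1) < m) by (apply Hnear; unfold r in Hy; lra).
      apply Rabs_lt_between in HH. unfold m in *. lra. }
  set (l := Rabs (ln (k1 / m))).
  set (D0 := h + 1 + Rad + Rabs x1).
  exists (T1 + D0 + (l + K * D0) / sig), (1 + K / sig).
  assert (Hl : 0 <= l) by apply Rabs_pos. assert (Hx1 := Rabs_pos x1).
  assert (HD0 : 0 < D0) by (unfold D0; lra).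
  assert (Hq1 : 0 <= (l + K * D0) / sig).
  { apply Rmult_le_pos. assert (0 <= K * D0) by (apply Rmult_le_pos; lra). lra. left; apply Rinv_0_lt_compat; auto. }
  assert (Hq2 : 0 <= K / sig). { apply Rmult_le_pos; auto. left; apply Rinv_0_lt_compat; auto. }
  split; [lra|split; [lra|]].
  intros t y Ht. assert (Hy := Rabs_pos y).
  set (D := D0 + Rabs y).
  assert (HD : 0 < D) by (unfold D; lra).
  set (t1 := T1 + D).
  assert (Ht1 : t1 + (l + K * D) / sig <= t).
  { unfold t1, D. apply Rle_trans with (2 := Ht). right. field. lra. }
  assert (Hq3 : 0 <= (l + K * D) / sig).
  { apply Rmult_le_pos. assert (0 <= K * D) by (apply Rmult_le_pos; lra). lra. left; apply Rinv_0_lt_compat; auto. }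
  set (a0 := m * exp (- K * D)).
  assert (Ha0 : 0 < a0) by (apply Rmult_lt_0_compat; auto; apply exp_pos).
  assert (HG := Hgrow y t1 a0 ltac:(unfold t1; lra) Ha0).
  apply Rle_trans with (Rmin (a0 * exp (sig * (t - t1))) k1).
  - apply Rmin_glb; [|lra]. unfold a0. rewrite Rmult_assoc -exp_plus.
    apply Rle_trans with (m * exp (ln (k1 / m))).
    + rewrite exp_ln. right; field; lra. apply Rdiv_lt_0_compat; lra.
    + apply Rmult_le_compat_l. lra. apply exp_le_mono.
      apply Rle_trans with l. apply Rle_abs.
      assert (sig * ((l + K * D) / sig) <= sig * (t - t1)) by (apply Rmult_le_compat_l; lra).
      replace (sig * ((l + K * D) / sig)) with (l + K * D) in H0 by (field; lra). lra.
  - apply HG; [|lra]. intros s x Hs Hx.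
    apply Rle_trans with (m * exp (- K * (s - T1))).
    + apply Rmult_le_compat_l. lra. apply exp_le_mono. unfold t1 in Hs. nra.
    + apply Hlow. unfold t1, D, D0 in Hs. lra.
      replace (x - x1) with ((x - y) + (y + - x1)) by ring. apply Rle_trans with (1 := Rabs_triang _ _).
      generalize (Rabs_triang y (- x1)). rewrite Rabs_Ropp. unfold t1, D, D0 in Hs. lra.
Qed.

(* Barrier: [kappa - D e^{- be t} (e^{al x} + e^{- al x})], which is negative outside the cone where
   [hair_trigger] makes [u] close to [kappa]. *)
Lemma exponential_at_origin g kappa L G0 k dk h u : monostable g kappa L G0 k dk -> 0 <= h ->
  evolution g kappa h u -> (exists s x, - h <= s <= 0 /\ 0 < u s x) ->
  exists be D T, 0 < be /\ 0 < D /\ forall t, T <= t -> kappa - D * exp (- be * t) <= u t 0.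
Proof.
  intros H Hh EV Hex.
  assert (Hk := ms_kappa H). assert (HL := ms_L H).
  assert (Hdk := ms_dk H). assert (Hkb := ms_kbd H).
  set (e := Rmin dk (kappa / 2)).
  assert (He : 0 < e) by (apply Rmin_pos; lra).
  assert (He1 : e <= dk) by apply Rmin_l. assert (He2 : e <= kappa / 2) by apply Rmin_r.
  destruct (hair_trigger _ _ _ _ _ _ h u (kappa - e) H Hh ltac:(lra) EV Hex) as [T2 [C2 [HT2 [HC2 Htr]]]].
  set (al := (1 - k) / 2).
  assert (Hal : 0 < al <= / 2) by (unfold al; lra).
  assert (Hal2 : k < 1 - al * al) by (unfold al in *; nra).
  clearbody al.
  destruct (exp_room k (1 - al * al) h Hal2) as [g1 [Hg1 Hg1']].
  (* [be <= g1] makes the barrier a subsolution inside the cone; [be C2 <= al] makes it nonpositive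
     outside, where [e^{al |x|}] outweighs the decay in time. *)
  set (be := Rmin g1 (al / C2)).
  assert (Hbe : 0 < be). { apply Rmin_pos; auto. apply Rdiv_lt_0_compat; lra. }
  assert (Hbe1 : be <= g1) by apply Rmin_l.
  assert (Hbe2 : be * C2 <= al). { apply Rle_trans with (al / C2 * C2). apply Rmult_le_compat_r. lra. apply Rmin_r. right; field; lra. }
  specialize (Hg1' be ltac:(lra)).
  set (D := kappa * exp (be * (h + T2))).
  assert (HD : 0 < D) by (apply Rmult_lt_0_compat; auto; apply exp_pos).
  exists be, (2 * D), (T2 + h). split; [auto|split; [lra|]].
  set (ch := fun x => exp (al * x) + exp (- al * x)).
  assert (Hch : forall x, exp (al * Rabs x) <= ch x).
  { intros x. unfold ch. generalize (exp_pos (al * x)) (exp_pos (- al * x)). intros.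
    unfold Rabs; destruct Rcase_abs; [replace (al * - x) with (- al * x) by ring|]; lra. }
  set (E := fun t x => D * exp (- be * t) * ch x).
  assert (HEpos : forall t x, 0 < E t x).
  { intros t x. apply Rmult_lt_0_compat. apply Rmult_lt_0_compat; auto. apply exp_pos.
    apply Rlt_le_trans with (2 := Hch x). apply exp_pos. }
  assert (Hfar : forall t x, t - h - T2 <= C2 * Rabs x -> kappa <= E t x).
  { intros t x Hx. unfold E, D. apply Rle_trans with (kappa * exp (be * (h + T2)) * exp (- be * t) * exp (al * Rabs x)).
    - rewrite !Rmult_assoc -!exp_plus. rewrite <- (Rmult_1_r kappa) at 1. apply Rmult_le_compat_l. lra.
      rewrite -exp_0. apply exp_le_mono.
      assert (be * (t - h - T2) <= be * (C2 * Rabs x)) by (apply Rmult_le_compat_l; lra).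
      assert (be * C2 * Rabs x <= al * Rabs x) by (apply Rmult_le_compat_r; [apply Rabs_pos|auto]). lra.
    - apply Rmult_le_compat_l; auto. left. apply Rmult_lt_0_compat; [|apply exp_pos]. apply Rmult_lt_0_compat; auto. apply exp_pos. }
  assert (HEh : forall t x, E (t - h) x = exp (be * h) * E t x).
  { intros t x. unfold E. replace (- be * (t - h)) with (be * h + - be * t) by ring. rewrite exp_plus. ring. }
  set (v := fun t x => kappa - E t x).
  intros t Ht.
  assert (Hmain : v t 0 <= u t 0).
  (* The forcing of the barrier is the linear one, [kappa - k E (t - h) x]: inside the cone
     [u (t - h) x >= kappa - dk] permits the slope [k], whereas the barrier itself may lie far below
     that range. *)
  { apply (comparison_below u v (fun t x => g (u (t - h) x)) (fun t x => kappa - k * E (t - h) x) (fun _ => True) h L (T2 + h) t kappa); auto; try lra.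
    - apply closed_dom_True.
    - apply seq_cont_le with (- h). lra. apply EV.
    - intros tn xn s x _ _ Lt Lx. unfold v, E. apply is_lim_seq_minus'. apply is_lim_seq_const.
      apply is_lim_seq_mult'.
      + apply (is_lim_seq_ex_derive (fun t => D * exp (- be * t))); auto. auto_derive; auto.
      + apply (is_lim_seq_ex_derive ch); auto. unfold ch. auto_derive; auto.
    - intros s x Hs _. generalize (ev_rng EV s x ltac:(lra)) (HEpos s x). unfold v. lra.
    - intros s x Hs _. assert (kappa <= E s x). { apply Hfar. assert (0 <= C2 * Rabs x) by (apply Rmult_le_pos; [lra|apply Rabs_pos]). lra. }
      generalize (ev_rng EV s x ltac:(lra)). unfold v. lra.
    - intros s x Hs _. destruct (Rle_lt_dec (s - h - T2) (C2 * Rabs x)) as [Hf|Hn].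
      { left. specialize (Hfar s x Hf). generalize (ev_rng EV s x ltac:(lra)). unfold v. lra. }
      right. split; [exists 1; split; auto; lra|]. split; [apply (ev_pde EV); lra|]. split.
      + exists (fun r => kappa - ch x * (D * exp (- be * r))), (fun z => kappa - D * exp (- be * s) * ch z),
          (fun z => 0 - D * exp (- be * s) * (al * exp (al * z) - al * exp (- al * z))),
          (0 - - be * E s x), (0 - al * al * E s x), 1.
        split; [lra|]. split. { unfold v, E. ring. } split. { unfold v, E. ring. }
        split. { intros r _. unfold v, E. right; ring. }
        split. { intros z _. unfold v, E. right; ring. }
        split. { unfold E. auto_derive; auto. ring. }
        split. { intros z _. unfold ch. auto_derive; auto. ring. }
        split. { unfold E, ch. auto_derive; auto. ring. }
        unfold v. rewrite HEh. assert (HEs := HEpos s x).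
        assert (k * exp (be * h) * E s x <= (1 - al * al - be) * E s x) by (apply Rmult_le_compat_r; lra). lra.
      + intros e' He' Hue. assert (Hu1 := Htr (s - h) x ltac:(lra)).
        assert (Hu2 := ev_rng EV (s - h) x ltac:(lra)).
        assert (HS := ms_neark H kappa (u (s - h) x) kappa ltac:(lra) (proj2 Hu2) (Rle_refl _)).
        rewrite (ms_k H) in HS. unfold v in Hue.
        assert (k * (kappa - u (s - h) x) <= k * (E (s - h) x + e')) by (apply Rmult_le_compat_l; lra).
        assert (k * e' <= L * e') by (apply Rmult_le_compat_r; lra). lra. }
  unfold v, E, ch in Hmain. rewrite !Rmult_0_r exp_0 in Hmain. lra.
Qed.

(** * Convergence *)

Lemma eta_translate l y b : 0 <= l -> eta l (y + b) <= exp (l * Rabs b) * eta l y.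
Proof.
  intros Hl. assert (Hp := eta_pos l y). destruct (Rle_lt_dec 0 b) as [Hb|Hb].
  - rewrite Rabs_pos_eq; auto. rewrite Rmult_comm. apply eta_shift; auto.
  - assert (H1 : eta l (y + b) <= eta l y).
    { unfold eta. apply Rle_min_compat_r. apply exp_le_mono. nra. }
    assert (1 <= exp (l * Rabs b)). { rewrite -exp_0. apply exp_le_mono. generalize (Rabs_pos b). nra. }
    nra.
Qed.

Lemma heat_at_minus w v f k t x : heat_at w f t x -> heat_at v k t x ->
  heat_at (fun t x => w t x - v t x) (f - k) t x.
Proof.
  intros [w1 [wt [wxx [H1 [H2 [H3 H4]]]]]] [v1 [vt [vxx [K1 [K2 [K3 K4]]]]]].
  exists (fun y => w1 y - v1 y), (wt - vt), (wxx - vxx). split; [|split; [|split]].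
  - apply is_derive_sub; auto.
  - intros y. apply is_derive_sub; auto.
  - apply is_derive_sub; auto.
  - lra.
Qed.

Lemma front_heat_at {g kappa h c lam phi phi1 nu} a t x : fast_front g kappa h c lam phi phi1 nu ->
  heat_at (fun t x => phi (x + c * t + a)) (g (phi (x + c * (t - h) + a))) t x.
Proof.
  intros FF. assert (H1 := ff_d1 FF). assert (H2 := ff_d2 FF).
  set (z := x + c * t + a).
  exists (fun y => phi1 (y + (c * t + a))), (c * phi1 z), (c * phi1 z + phi z - g (phi (z - c * h))).
  split; [|split; [|split]].
  - apply (is_derive_ext (fun s : R => phi (c * s + (x + a)))). { intros s. f_equal. ring. }
    apply is_derive_comp_lin. replace (c * t + (x + a)) with z by (unfold z; ring). auto.
  - intros y. apply (is_derive_ext (fun s : R => phi (s + (c * t + a)))). { intros s. f_equal. ring. }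
    apply is_derive_shift. auto.
  - apply (is_derive_shift phi1). replace (x + (c * t + a)) with z by (unfold z; ring). auto.
  - fold z. replace (x + c * (t - h) + a) with (z - c * h) by (unfold z; ring). ring.
Qed.

Lemma front_lips {g kappa h c lam phi phi1 nu} : fast_front g kappa h c lam phi phi1 nu -> lips (nu * kappa) phi.
Proof.
  intros FF. apply lips_derive with phi1. apply FF. intros z.
  assert (H1 := ff_left FF z). assert (H2 := ff_rng FF z).
  assert (H3 := ff_pos FF z). assert (H4 := ff_nu FF).
  rewrite Rabs_pos_eq; [|lra]. apply Rle_trans with (1 := H1). apply Rmult_le_compat_l; lra.
Qed.

Lemma front_strict {g kappa h c lam phi phi1 nu} : fast_front g kappa h c lam phi phi1 nu ->
  forall x y, x < y -> phi x < phi y.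
Proof.
  intros FF x y Hxy. destruct (MVT_cor2 phi phi1 x y Hxy) as [z [Hz _]].
  - intros z _. apply is_derive_Reals. apply FF.
  - generalize (ff_pos FF z). nra.
Qed.

Lemma front_seq_cont {g kappa h c lam phi phi1 nu} a t0 : fast_front g kappa h c lam phi phi1 nu ->
  seq_cont t0 (fun t x => phi (x + c * t + a)).
Proof.
  intros FF tn xn t x _ _ Lt Lx. apply is_lim_seq_continuous_at.
  - apply (ex_derive_continuous phi). eexists. apply FF.
  - apply is_lim_seq_frame; auto.
Qed.

(** Here the decay of the front pays off: [phi1 <= nu phi = o(e^{lam z})] on the left and
    [phi1 <= nu (kappa - phi) -> 0] on the right, so [phi1] is negligible against [eta] at both
    ends. The factor [M] accounts for the translation by [a + s]. *)
Lemma front_tails {g kappa h c lam phi phi1 nu} a k1 : fast_front g kappa h c lam phi phi1 nu -> 0 < k1 ->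
  exists Z, 0 <= Z /\ forall y, Z <= Rabs y -> forall s, Rabs s <= 1 -> phi1 (y + a + s) <= k1 * eta lam y.
Proof.
  intros FF Hk1.
  assert (Hnu := ff_nu FF). assert (Hlam := ff_lam FF).
  set (M := exp (lam * (Rabs a + 1))). assert (HM : 0 < M) by apply exp_pos.
  destruct (ff_m FF (k1 / (nu * M))) as [Z1 HZ1]. { apply Rdiv_lt_0_compat; auto. apply Rmult_lt_0_compat; auto. }
  destruct (ff_p FF (k1 / nu)) as [Z2 HZ2]. { apply Rdiv_lt_0_compat; auto. }
  exists (Rabs Z1 + Rabs Z2 + Rabs a + 1).
  assert (P1 := Rabs_pos Z1). assert (P2 := Rabs_pos Z2). assert (P3 := Rabs_pos a).
  split. lra. intros y Hy s Hs. apply Rabs_le_between in Hs.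
  assert (A1 := Rle_abs a). assert (A2 := Rle_abs (- a)). rewrite Rabs_Ropp in A2.
  assert (A3 := Rle_abs Z2). assert (A4 := Rle_abs (- Z1)). rewrite Rabs_Ropp in A4.
  unfold Rabs in Hy at 4. destruct (Rcase_abs y) as [Hy0|Hy0].
  - rewrite eta_left; try lra. apply Rle_trans with (1 := ff_left FF _).
    assert (HH := HZ1 (y + a + s) ltac:(lra)).
    apply Rle_trans with (nu * (k1 / (nu * M) * (M * exp (lam * y)))).
    + apply Rmult_le_compat_l. lra. apply Rle_trans with (1 := HH). apply Rmult_le_compat_l.
      left. apply Rdiv_lt_0_compat; auto. apply Rmult_lt_0_compat; auto.
      unfold M. rewrite -exp_plus. apply exp_le_mono. nra.
    + right. field. split; lra.
  - rewrite eta_right; try lra. apply Rle_trans with (1 := ff_right FF _).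
    assert (HH := HZ2 (y + a + s) ltac:(lra)).
    apply Rle_trans with (nu * (k1 / nu)); [|right; field; lra]. apply Rmult_le_compat_l; lra.
Qed.

Lemma front_eta {g kappa h c lam phi phi1 nu} : fast_front g kappa h c lam phi phi1 nu ->
  exists K, 0 < K /\ forall y, phi1 y <= K * eta lam y.
Proof.
  intros FF. destruct (front_tails 0 1 FF Rlt_0_1) as [Z [HZ0 HZ]].
  assert (Hnu := ff_nu FF). assert (Hlam := ff_lam FF).
  assert (Hr := ff_rng FF).
  assert (HM : 0 < exp (lam * Z)) by apply exp_pos.
  assert (Hk : 0 < nu * kappa). { apply Rmult_lt_0_compat; auto. specialize (Hr 0). lra. }
  assert (HK : 0 < nu * kappa * exp (lam * Z)) by (apply Rmult_lt_0_compat; auto).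
  exists (1 + nu * kappa * exp (lam * Z)). split. lra. intros y.
  assert (He := eta_pos lam y).
  destruct (Rle_lt_dec Z (Rabs y)) as [Hy|Hy].
  - specialize (HZ y Hy 0 ltac:(rewrite Rabs_R0; lra)). replace (y + 0 + 0) with y in HZ by ring.
    assert (0 < nu * kappa * exp (lam * Z) * eta lam y) by (apply Rmult_lt_0_compat; auto). lra.
  - assert (H1 : phi1 y <= nu * kappa).
    { apply Rle_trans with (1 := ff_left FF y). apply Rmult_le_compat_l. lra. specialize (Hr y). lra. }
    assert (H2 : 1 <= exp (lam * Z) * eta lam y).
    { apply Rabs_lt_between in Hy. unfold eta, Rmin. destruct (Rle_dec (exp (lam * y)) 1).
      - rewrite -exp_plus -exp_0. apply exp_le_mono. nra.
      - rewrite Rmult_1_r -exp_0. apply exp_le_mono. nra. }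
    assert (nu * kappa * 1 <= nu * kappa * (exp (lam * Z) * eta lam y)) by (apply Rmult_le_compat_l; lra). lra.
Qed.

(** In the weighted norm the translates depend on the shift in a Lipschitz way, because
    [phi1 <= K eta]; this makes the sets of admissible translates closed. *)
Lemma front_shift {g kappa h c lam phi phi1 nu} Rb : fast_front g kappa h c lam phi phi1 nu ->
  exists K, 0 < K /\ forall y b b', Rabs b <= Rb -> Rabs b' <= Rb -> phi (y + b) <= phi (y + b') + K * Rabs (b - b') * eta lam y.
Proof.
  intros FF. destruct (front_eta FF) as [K [HK HKe]].
  assert (Hlam := ff_lam FF).
  exists (K * exp (lam * Rb)). split. apply Rmult_lt_0_compat; auto. apply exp_pos.
  intros y b b' Hb Hb'. assert (He := eta_pos lam y).
  assert (HKe2 : 0 < K * exp (lam * Rb)) by (apply Rmult_lt_0_compat; auto; apply exp_pos).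
  destruct (Rle_lt_dec b b') as [Hle|Hlt].
  - assert (phi (y + b) <= phi (y + b')) by (apply (ff_mono FF); lra).
    assert (0 <= K * exp (lam * Rb) * Rabs (b - b') * eta lam y); [|lra].
    apply Rmult_le_pos; [|lra]. apply Rmult_le_pos. lra. apply Rabs_pos.
  - destruct (MVT_cor2 phi phi1 (y + b') (y + b)) as [z [Hz1 Hz2]]. lra.
    { intros z _. apply is_derive_Reals. apply FF. }
    rewrite (Rabs_pos_eq (b - b')); [|lra].
    assert (Hz : phi1 z <= K * exp (lam * Rb) * eta lam y).
    { apply Rle_trans with (1 := HKe z). rewrite Rmult_assoc. apply Rmult_le_compat_l. lra.
      replace z with (y + (z - y)) by ring. apply Rle_trans with (1 := eta_translate lam y (z - y) (Rlt_le _ _ Hlam)).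
      apply Rmult_le_compat_r. lra. apply exp_le_mono. apply Rmult_le_compat_l. lra.
      apply Rabs_le. apply Rabs_le_between in Hb. apply Rabs_le_between in Hb'. lra. }
    replace (phi (y + b)) with (phi (y + b') + phi1 z * (b - b')) by lra.
    apply Rplus_le_compat_l. replace (K * exp (lam * Rb) * (b - b') * eta lam y) with (K * exp (lam * Rb) * eta lam y * (b - b')) by ring.
    apply Rmult_le_compat_r; lra.
Qed.

(* The bump of [spread], moving with speed at most [Z + c], carries the bound at [x = - c T] to every point
   of [|x + c t| <= Z]. *)
Lemma local_lift c h Z del Lw : 0 < c -> 0 <= h -> 0 <= Z -> 0 < del -> 0 < Lw -> exists m Rr, 0 < m /\
  forall (w F : R -> R -> R) T N, 0 <= N -> seq_cont T w ->
   (forall x y, Rabs (x - y) <= 1 -> Rabs (w T x - w T y) <= Lw * Rabs (x - y)) ->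
   (forall t x, T <= t -> x <= - c * T + Rr -> - N <= w t x) ->
   (forall t x, T < t -> x <= - c * T + Rr -> heat_at w (F t x) t x /\ - N <= F t x) ->
   del <= w T (- c * T) ->
   forall t x, T + 1 <= t <= T + 1 + h -> Rabs (x + c * t) <= Z -> m - N <= w t x.
Proof.
  intros Hc Hh HZ Hdel HLw.
  set (r := Rmin 1 (del / (2 * Lw))).
  assert (Hr : 0 < r). { apply Rmin_pos. lra. apply Rdiv_lt_0_compat; lra. }
  assert (Hr1 : r <= 1) by apply Rmin_l.
  assert (Hr2 : Lw * r <= del / 2).
  { apply Rle_trans with (Lw * (del / (2 * Lw))). apply Rmult_le_compat_l. lra. apply Rmin_r. right; field; lra. }
  set (S := Z + c).
  destruct (spread r S Hr) as [K [HK Hsp]]. unfold S; lra.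
  exists (del / 2 * exp (- K * (1 + h))), (r + S * (1 + h)).
  split. { apply Rmult_lt_0_compat. lra. apply exp_pos. }
  intros w F T N HN Hcw Hlip Hlow Hheat Hpt t x Ht Hx.
  assert (HS : 0 < S) by (unfold S; lra).
  assert (Hregion : forall y, Rabs (y - - c * T) <= r + S * (t - T) -> y <= - c * T + (r + S * (1 + h))).
  { intros y Hy. apply Rabs_le_between in Hy. assert (S * (t - T) <= S * (1 + h)) by (apply Rmult_le_compat_l; lra). lra. }
  apply Rle_trans with (del / 2 * exp (- K * (t - T)) - N).
  - apply Rplus_le_compat_r. apply Rmult_le_compat_l. lra. apply exp_le_mono. nra.
  - apply (Hsp w F T t (- c * T)); auto; try lra.
    + intros s y Hs Hy. apply Hlow. lra. auto.
    + intros s y Hs Hy. apply Hheat. lra. auto.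
    + intros y Hy. assert (HH := Hlip y (- c * T) ltac:(lra)). apply Rabs_le_between in HH.
      assert (Lw * Rabs (y - - c * T) <= Lw * r) by (apply Rmult_le_compat_l; lra). lra.
    + replace (x - - c * T) with ((x + c * t) + (- (c * (t - T)))) by ring.
      apply Rle_trans with (1 := Rabs_triang _ _). rewrite Rabs_Ropp (Rabs_pos_eq (c * (t - T))).
      2:{ apply Rmult_le_pos; lra. }
      unfold S. rewrite Rmult_plus_distr_r. apply Rplus_le_compat_r.
      apply Rle_trans with (Z * 1). lra. apply Rmult_le_compat_l; lra.
Qed.

(** * Asymptotic translates from below and from above *)

(** Restricted to [x <= 0] because to the right the second front, moving in the other direction,
    takes over; the upper counterpart is required on the whole line. *)
Definition eventually_below c lam (phi : R -> R) (u : R -> R -> R) (a : R) : Prop :=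
  forall eps, 0 < eps -> exists T, forall t x, T <= t -> x <= 0 ->
    phi (x + c * t + a) - eps * eta lam (x + c * t) <= u t x.

Definition eventually_above c lam (phi : R -> R) (u : R -> R -> R) (b : R) : Prop :=
  forall eps, 0 < eps -> exists T, forall t x, T <= t -> u t x <= phi (x + c * t + b) + eps * eta lam (x + c * t).

Lemma decay_time ga q eps : 0 < ga -> 0 < eps -> exists T, 0 <= T /\ forall t, T <= t -> q * exp (- ga * t) <= eps.
Proof.
  intros Hga He. destruct (exp_small ga (eps / (Rabs q + 1)) 0 Hga) as [w [Hw1 Hw2]].
  { apply Rdiv_lt_0_compat; auto. generalize (Rabs_pos q); lra. }
  exists (- w). split. lra. intros t Ht. assert (Hq := Rabs_pos q).
  apply Rle_trans with ((Rabs q + 1) * exp (- ga * t)).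
  - apply Rmult_le_compat_r. left; apply exp_pos. generalize (Rle_abs q); lra.
  - apply Rle_trans with ((Rabs q + 1) * (eps / (Rabs q + 1))); [|right; field; lra].
    apply Rmult_le_compat_l. lra. apply Rle_trans with (2 := Rlt_le _ _ Hw2). apply exp_le_mono. nra.
Qed.

Lemma stable_above_eventually g kappa h c lam phi u ga qb C t0 b q : 0 < lam -> 0 < ga ->
  stable_above g kappa h c lam phi u ga qb C -> 0 <= t0 -> 0 < q <= qb ->
  (forall t x, t0 - h <= t <= t0 -> u t x <= phi (x + c * t + b) + q * eta lam (x + c * t + b)) ->
  eventually_above c lam phi u (b + C * q).
Proof.
  intros Hlam Hga Hst Ht0 Hq Hinit eps Heps. assert (HH := Hst t0 b q Ht0 Hq Hinit).
  destruct (decay_time ga (q * exp (ga * t0) * exp (lam * Rabs b)) eps Hga Heps) as [T [HT0 HT]].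
  exists (Rmax t0 T). intros t x Ht.
  assert (T1 : t0 <= t) by (apply Rle_trans with (1 := Rmax_l _ _) in Ht; auto).
  assert (T2 : T <= t) by (apply Rle_trans with (1 := Rmax_r _ _) in Ht; auto).
  apply Rle_trans with (1 := HH t x T1). replace (x + c * t + b + C * q) with (x + c * t + (b + C * q)) by ring.
  apply Rplus_le_compat_l.
  apply Rle_trans with (q * exp (- ga * (t - t0)) * (exp (lam * Rabs b) * eta lam (x + c * t))).
  - apply Rmult_le_compat_l. left; apply Rmult_lt_0_compat. lra. apply exp_pos. apply eta_translate. lra.
  - rewrite -Rmult_assoc. apply Rmult_le_compat_r. left; apply eta_pos.
    apply Rle_trans with (2 := HT t T2). replace (- ga * (t - t0)) with (ga * t0 + - ga * t) by ring.
    rewrite exp_plus. right; ring.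
Qed.

Lemma stable_below_eventually g kappa h c lam phi u ga qb C t0 b q : 0 < lam -> 0 < ga ->
  stable_below g kappa h c lam phi u ga qb C -> 0 <= t0 -> 0 < q <= qb ->
  (forall t x, t0 - h <= t <= t0 -> x <= 0 -> phi (x + c * t + b) - q * eta lam (x + c * t + b) <= u t x) ->
  (forall t, t0 <= t -> kappa - q * exp (- ga * (t - t0)) <= u t 0 /\ phi 0 <= u t 0) ->
  eventually_below c lam phi u (b - C * q).
Proof.
  intros Hlam Hga Hst Ht0 Hq Hinit Hbd eps Heps. assert (HH := Hst t0 b q Ht0 Hq Hinit Hbd).
  destruct (decay_time ga (q * exp (ga * t0) * exp (lam * Rabs b)) eps Hga Heps) as [T [HT0 HT]].
  exists (Rmax t0 T). intros t x Ht Hx.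
  assert (T1 : t0 <= t) by (apply Rle_trans with (1 := Rmax_l _ _) in Ht; auto).
  assert (T2 : T <= t) by (apply Rle_trans with (1 := Rmax_r _ _) in Ht; auto).
  apply Rle_trans with (2 := HH t x T1 Hx). replace (x + c * t + b - C * q) with (x + c * t + (b - C * q)) by ring.
  apply Rplus_le_compat_l, Ropp_le_contravar.
  apply Rle_trans with (q * exp (- ga * (t - t0)) * (exp (lam * Rabs b) * eta lam (x + c * t))).
  - apply Rmult_le_compat_l. left; apply Rmult_lt_0_compat. lra. apply exp_pos. apply eta_translate. lra.
  - rewrite -Rmult_assoc. apply Rmult_le_compat_r. left; apply eta_pos.
    apply Rle_trans with (2 := HT t T2). replace (- ga * (t - t0)) with (ga * t0 + - ga * t) by ring.
    rewrite exp_plus. right; ring.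
Qed.

Lemma evolution_lips g kappa L G0 k dk h u T : monostable g kappa L G0 k dk -> 0 <= h -> evolution g kappa h u ->
  1 <= T -> forall x y, Rabs (x - y) <= 1 -> Rabs (u T x - u T y) <= 2 * kappa * Rabs (x - y).
Proof.
  intros H Hh EV HT x y Hxy. replace T with ((T - 1) + 1) by ring.
  apply lipschitz_in_space; auto.
  - apply (ms_kappa H).
  - apply seq_cont_le with (- h). lra. apply EV.
  - intros t z Ht. apply (ev_rng EV). lra.
  - intros t z Ht. exists (g (u (t - h) z)). split.
    + apply (ms_range H). apply (ev_rng EV). lra.
    + apply (ev_pde EV). lra.
Qed.

(* [local_lift] turns the gap into a gain on a compact part of the moving frame; in the tails a shift of
   the front by [e0] costs only [e0 * k1 * eta], which [stable_below] converts into a shift [C q = e0 / 2]. *)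
Lemma improve_below g kappa L G0 k dk h c lam phi phi1 nu u ga qb C a del : monostable g kappa L G0 k dk ->
  0 <= h -> fast_front g kappa h c lam phi phi1 nu -> evolution g kappa h u ->
  0 < ga -> 0 < qb -> 0 < C -> stable_below g kappa h c lam phi u ga qb C ->
  (forall q, 0 < q -> exists T, forall t0 t, T <= t0 <= t -> kappa - q * exp (- ga * (t - t0)) <= u t 0 /\ phi 0 <= u t 0) ->
  eventually_below c lam phi u a -> 0 < del ->
  (forall T, exists t, T <= t /\ phi a + del <= u t (- c * t)) ->
  exists a', a < a' /\ eventually_below c lam phi u a'.
Proof.
  intros H Hh FF EV Hga Hqb HC Hst Hbd Ha Hdel Hgap.
  assert (Hk := ms_kappa H). assert (HL := ms_L H).
  assert (Hc := ff_c FF). assert (Hlam := ff_lam FF).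
  assert (Hnu := ff_nu FF).
  assert (Hnk : 0 < nu * kappa) by (apply Rmult_lt_0_compat; auto).
  assert (Hlip := front_lips FF).
  assert (Hmono := ff_mono FF).
  set (M := exp (lam * (Rabs a + 1))). assert (HM : 0 < M) by apply exp_pos.
  assert (HCM : 0 < 4 * C * M) by (repeat apply Rmult_lt_0_compat; lra).
  (* With [q = 2 M e0 k1] this choice gives [C q = e0 / 2]: the stability estimate costs half of the
     gained shift [e0]. The factor [M] compares the weight at [y] with the weight at the shifted
     point. *)
  set (k1 := / (4 * C * M)). assert (Hk1 : 0 < k1) by (apply Rinv_0_lt_compat; auto).
  destruct (front_tails a k1 FF Hk1) as [Z [HZ0 HZ]].
  set (Lw := 2 * kappa + nu * kappa). assert (HLw : 0 < Lw) by (unfold Lw; lra).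
  destruct (local_lift c h Z del Lw Hc Hh HZ0 Hdel HLw) as [m [Rr [Hm Hlift]]].
  (* At most 1 for [front_tails], at most [2 C qb] so that [q <= qb], and so small that on the core
     the shifted front rises by at most half of the gain [m]. *)
  set (e0 := Rmin 1 (Rmin (2 * C * qb) (m / (2 * (nu * kappa))))).
  assert (He0 : 0 < e0).
  { repeat apply Rmin_pos. lra. apply Rmult_lt_0_compat; lra. apply Rdiv_lt_0_compat; lra. }
  assert (He1 : e0 <= 1) by apply Rmin_l.
  assert (He2 : e0 <= 2 * C * qb). { apply Rle_trans with (1 := Rmin_r _ _). apply Rmin_l. }
  assert (He3 : nu * kappa * e0 <= m / 2).
  { apply Rle_trans with (nu * kappa * (m / (2 * (nu * kappa)))); [|right; field; lra].
    apply Rmult_le_compat_l. lra. apply Rle_trans with (1 := Rmin_r _ _). apply Rmin_r. }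
  set (e1 := Rmin (e0 * k1) (m / (2 * L))).
  assert (He1pos : 0 < e1). { apply Rmin_pos. apply Rmult_lt_0_compat; auto. apply Rdiv_lt_0_compat; lra. }
  assert (He4 : e1 <= e0 * k1) by apply Rmin_l.
  assert (He5 : L * e1 <= m / 2).
  { apply Rle_trans with (L * (m / (2 * L))). apply Rmult_le_compat_l. lra. apply Rmin_r. right; field; lra. }
  set (q := 2 * M * (e0 * k1)).
  assert (Hqe : C * q = e0 / 2). { unfold q, k1. field. split; lra. }
  assert (Hq : 0 < q <= qb).
  { split. unfold q. repeat apply Rmult_lt_0_compat; lra.
    apply Rmult_le_reg_l with C; auto. lra. }
  destruct (Ha e1 He1pos) as [Te HTe]. destruct (Hbd q (proj1 Hq)) as [Tq HTq].
  (* The bound [Rr <= c T] makes the region used by [local_lift] part of [x <= 0], where the lower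
     bound on [u] is available. *)
  set (Tmin := Rmax (Rmax (Te + h) 1) (Rmax Tq (Rr / c))).
  destruct (Hgap Tmin) as [T [HTmin HT]].
  assert (B1 : Te + h <= T). { apply Rle_trans with (2 := HTmin). apply Rle_trans with (2 := Rmax_l _ _). apply Rmax_l. }
  assert (B2 : 1 <= T). { apply Rle_trans with (2 := HTmin). apply Rle_trans with (2 := Rmax_l _ _). apply Rmax_r. }
  assert (B3 : Tq <= T). { apply Rle_trans with (2 := HTmin). apply Rle_trans with (2 := Rmax_r _ _). apply Rmax_l. }
  assert (B4 : Rr / c <= T). { apply Rle_trans with (2 := HTmin). apply Rle_trans with (2 := Rmax_r _ _). apply Rmax_r. }
  assert (B5 : Rr <= c * T). { apply Rle_trans with (c * (Rr / c)). right; field; lra. apply Rmult_le_compat_l; lra. }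
  exists (a + e0 - C * q). split. lra.
  apply (stable_below_eventually g kappa h c lam phi u ga qb C (T + 1 + h) (a + e0) q); auto; try lra.
  2:{ intros t Ht. apply HTq. lra. }
  assert (Hlow : forall t x, Te <= t -> x <= 0 -> - e1 <= u t x - phi (x + c * t + a)).
  { intros t x Ht Hx. specialize (HTe t x Ht Hx). generalize (eta_le_1 lam (x + c * t)) (eta_pos lam (x + c * t)). intros.
    assert (e1 * eta lam (x + c * t) <= e1) by nra. lra. }
  assert (Hw := Hlift (fun t x => u t x - phi (x + c * t + a))
     (fun t x => g (u (t - h) x) - g (phi (x + c * (t - h) + a))) T (L * e1)).
  assert (Hcenter : forall t x, T + 1 <= t <= T + 1 + h -> Rabs (x + c * t) <= Z ->
     m - L * e1 <= u t x - phi (x + c * t + a)).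
  { apply Hw.
    - apply Rmult_le_pos; lra.
    - apply seq_cont_minus. apply seq_cont_le with (- h). lra. apply EV. apply (front_seq_cont a T FF).
    - intros x y Hxy. assert (U1 := evolution_lips _ _ _ _ _ _ h u T H Hh EV B2 x y Hxy).
      assert (U2 := Hlip (x + c * T + a) (y + c * T + a)).
      replace (x + c * T + a - (y + c * T + a)) with (x - y) in U2 by ring.
      replace (u T x - phi (x + c * T + a) - (u T y - phi (y + c * T + a))) with
        ((u T x - u T y) + - (phi (x + c * T + a) - phi (y + c * T + a))) by ring.
      apply Rle_trans with (1 := Rabs_triang _ _). rewrite Rabs_Ropp. unfold Lw. lra.
    - intros t x Ht Hx. specialize (Hlow t x ltac:(lra) ltac:(lra)). nra.
    - intros t x Ht Hx. split.
      + apply heat_at_minus. apply (ev_pde EV). lra. apply (front_heat_at a t x FF).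
      + specialize (Hlow (t - h) x ltac:(lra) ltac:(lra)).
        assert (G1 : g (phi (x + c * (t - h) + a) - e1) <= g (u (t - h) x)) by (apply (ms_mono H); lra).
        set (P := phi (x + c * (t - h) + a)) in *.
        assert (G2 := ms_slopes H (P - e1) P (P - e1) P (Rle_refl _) ltac:(lra) (Rle_refl _)). lra.
    - replace (- c * T + c * T + a) with a by ring. lra. }
  intros t x Ht Hx. set (y := x + c * t).
  assert (Heta := eta_pos lam y).
  assert (Hkey : phi (y + (a + e0)) - (e0 * k1 + e1) * eta lam y <= u t x).
  { destruct (Rle_lt_dec (Rabs y) Z) as [Hy|Hy].
    - assert (HC1 := Hcenter t x ltac:(lra) Hy). fold y in HC1.
      assert (U2 := Hlip (y + (a + e0)) (y + a)). replace (y + (a + e0) - (y + a)) with e0 in U2 by ring.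
      rewrite (Rabs_pos_eq e0) in U2; [|lra]. apply Rabs_le_between in U2.
      assert (0 < (e0 * k1 + e1) * eta lam y).
      { apply Rmult_lt_0_compat; auto. assert (0 < e0 * k1) by (apply Rmult_lt_0_compat; auto). lra. }
      lra.
    - assert (HT1 := HTe t x ltac:(lra) Hx). fold y in HT1.
      destruct (MVT_cor2 phi phi1 (y + a) (y + (a + e0))) as [z [Hz1 Hz2]]. lra.
      { intros z _. apply is_derive_Reals. apply FF. }
      assert (HZ1 := HZ y (Rlt_le _ _ Hy) (z - y - a) ltac:(rewrite Rabs_pos_eq; lra)).
      replace (y + a + (z - y - a)) with z in HZ1 by ring.
      replace (y + (a + e0) - (y + a)) with e0 in Hz1 by ring.
      assert (phi1 z * e0 <= k1 * eta lam y * e0) by (apply Rmult_le_compat_r; lra). lra. }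
  replace (x + c * t + (a + e0)) with (y + (a + e0)) by (unfold y; ring).
  apply Rle_trans with (2 := Hkey). apply Rplus_le_compat_l, Ropp_le_contravar.
  apply Rle_trans with (2 * (e0 * k1) * eta lam y). apply Rmult_le_compat_r; lra.
  unfold q. replace (2 * M * (e0 * k1) * eta lam (y + (a + e0))) with (2 * (e0 * k1) * (M * eta lam (y + (a + e0)))) by ring.
  apply Rmult_le_compat_l. { assert (0 < e0 * k1) by (apply Rmult_lt_0_compat; auto). lra. }
  replace y with (y + (a + e0) + - (a + e0)) at 1 by ring.
  apply Rle_trans with (1 := eta_translate lam _ _ (Rlt_le _ _ Hlam)). apply Rmult_le_compat_r. left; apply eta_pos.
  apply exp_le_mono. apply Rmult_le_compat_l. lra. rewrite Rabs_Ropp.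
  apply Rle_trans with (1 := Rabs_triang _ _). rewrite (Rabs_pos_eq e0); lra.
Qed.

(** Mirror image of [improve_below], with the front and [u] exchanged in the lifted difference. The
    upper bound holds on the whole line, so [T] only has to be at least [Te + h] and 1. *)
Lemma improve_above g kappa L G0 k dk h c lam phi phi1 nu u ga qb C b del : monostable g kappa L G0 k dk ->
  0 <= h -> fast_front g kappa h c lam phi phi1 nu -> evolution g kappa h u ->
  0 < ga -> 0 < qb -> 0 < C -> stable_above g kappa h c lam phi u ga qb C ->
  eventually_above c lam phi u b -> 0 < del ->
  (forall T, exists t, T <= t /\ u t (- c * t) <= phi b - del) ->
  exists b', b' < b /\ eventually_above c lam phi u b'.
Proof.
  intros H Hh FF EV Hga Hqb HC Hst Hb Hdel Hgap.
  assert (Hk := ms_kappa H). assert (HL := ms_L H).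
  assert (Hc := ff_c FF). assert (Hlam := ff_lam FF).
  assert (Hnu := ff_nu FF).
  assert (Hnk : 0 < nu * kappa) by (apply Rmult_lt_0_compat; auto).
  assert (Hlip := front_lips FF).
  assert (Hmono := ff_mono FF).
  set (M := exp (lam * (Rabs b + 1))). assert (HM : 0 < M) by apply exp_pos.
  assert (HCM : 0 < 4 * C * M) by (repeat apply Rmult_lt_0_compat; lra).
  set (k1 := / (4 * C * M)). assert (Hk1 : 0 < k1) by (apply Rinv_0_lt_compat; auto).
  destruct (front_tails b k1 FF Hk1) as [Z [HZ0 HZ]].
  set (Lw := 2 * kappa + nu * kappa). assert (HLw : 0 < Lw) by (unfold Lw; lra).
  destruct (local_lift c h Z del Lw Hc Hh HZ0 Hdel HLw) as [m [Rr [Hm Hlift]]].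
  set (e0 := Rmin 1 (Rmin (2 * C * qb) (m / (2 * (nu * kappa))))).
  assert (He0 : 0 < e0).
  { repeat apply Rmin_pos. lra. apply Rmult_lt_0_compat; lra. apply Rdiv_lt_0_compat; lra. }
  assert (He1 : e0 <= 1) by apply Rmin_l.
  assert (He2 : e0 <= 2 * C * qb). { apply Rle_trans with (1 := Rmin_r _ _). apply Rmin_l. }
  assert (He3 : nu * kappa * e0 <= m / 2).
  { apply Rle_trans with (nu * kappa * (m / (2 * (nu * kappa)))); [|right; field; lra].
    apply Rmult_le_compat_l. lra. apply Rle_trans with (1 := Rmin_r _ _). apply Rmin_r. }
  set (e1 := Rmin (e0 * k1) (m / (2 * L))).
  assert (He1pos : 0 < e1). { apply Rmin_pos. apply Rmult_lt_0_compat; auto. apply Rdiv_lt_0_compat; lra. }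
  assert (He4 : e1 <= e0 * k1) by apply Rmin_l.
  assert (He5 : L * e1 <= m / 2).
  { apply Rle_trans with (L * (m / (2 * L))). apply Rmult_le_compat_l. lra. apply Rmin_r. right; field; lra. }
  set (q := 2 * M * (e0 * k1)).
  assert (Hqe : C * q = e0 / 2). { unfold q, k1. field. split; lra. }
  assert (Hq : 0 < q <= qb).
  { split. unfold q. repeat apply Rmult_lt_0_compat; lra.
    apply Rmult_le_reg_l with C; auto. lra. }
  destruct (Hb e1 He1pos) as [Te HTe].
  destruct (Hgap (Rmax (Te + h) 1)) as [T [HTmin HT]].
  assert (B1 : Te + h <= T). { apply Rle_trans with (2 := HTmin). apply Rmax_l. }
  assert (B2 : 1 <= T). { apply Rle_trans with (2 := HTmin). apply Rmax_r. }
  exists (b - e0 + C * q). split. lra.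
  apply (stable_above_eventually g kappa h c lam phi u ga qb C (T + 1 + h) (b - e0) q); auto; try lra.
  assert (Hlow : forall t x, Te <= t -> - e1 <= phi (x + c * t + b) - u t x).
  { intros t x Ht. specialize (HTe t x Ht). generalize (eta_le_1 lam (x + c * t)) (eta_pos lam (x + c * t)). intros.
    assert (e1 * eta lam (x + c * t) <= e1) by nra. lra. }
  assert (Hw := Hlift (fun t x => phi (x + c * t + b) - u t x)
     (fun t x => g (phi (x + c * (t - h) + b)) - g (u (t - h) x)) T (L * e1)).
  assert (Hcenter : forall t x, T + 1 <= t <= T + 1 + h -> Rabs (x + c * t) <= Z ->
     m - L * e1 <= phi (x + c * t + b) - u t x).
  { apply Hw.
    - apply Rmult_le_pos; lra.
    - apply seq_cont_minus. apply (front_seq_cont b T FF). apply seq_cont_le with (- h). lra. apply EV.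
    - intros x y Hxy. assert (U1 := evolution_lips _ _ _ _ _ _ h u T H Hh EV B2 x y Hxy).
      assert (U2 := Hlip (x + c * T + b) (y + c * T + b)).
      replace (x + c * T + b - (y + c * T + b)) with (x - y) in U2 by ring.
      replace (phi (x + c * T + b) - u T x - (phi (y + c * T + b) - u T y)) with
        ((phi (x + c * T + b) - phi (y + c * T + b)) + - (u T x - u T y)) by ring.
      apply Rle_trans with (1 := Rabs_triang _ _). rewrite Rabs_Ropp. unfold Lw. lra.
    - intros t x Ht Hx. specialize (Hlow t x ltac:(lra)). nra.
    - intros t x Ht Hx. split.
      + apply heat_at_minus. apply (front_heat_at b t x FF). apply (ev_pde EV). lra.
      + specialize (Hlow (t - h) x ltac:(lra)).
        assert (G1 : g (u (t - h) x) <= g (phi (x + c * (t - h) + b) + e1)) by (apply (ms_mono H); lra).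
        set (P := phi (x + c * (t - h) + b)) in *.
        assert (G2 := ms_slopes H P (P + e1) P (P + e1) (Rle_refl _) ltac:(lra) (Rle_refl _)). lra.
    - replace (- c * T + c * T + b) with b by ring. lra. }
  intros t x Ht. set (y := x + c * t).
  assert (Heta := eta_pos lam y).
  assert (Hkey : u t x <= phi (y + (b - e0)) + (e0 * k1 + e1) * eta lam y).
  { destruct (Rle_lt_dec (Rabs y) Z) as [Hy|Hy].
    - assert (HC1 := Hcenter t x ltac:(lra) Hy). fold y in HC1.
      assert (U2 := Hlip (y + b) (y + (b - e0))). replace (y + b - (y + (b - e0))) with e0 in U2 by ring.
      rewrite (Rabs_pos_eq e0) in U2; [|lra]. apply Rabs_le_between in U2.
      assert (0 < (e0 * k1 + e1) * eta lam y).
      { apply Rmult_lt_0_compat; auto. assert (0 < e0 * k1) by (apply Rmult_lt_0_compat; auto). lra. }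
      lra.
    - assert (HT1 := HTe t x ltac:(lra)). fold y in HT1.
      destruct (MVT_cor2 phi phi1 (y + (b - e0)) (y + b)) as [z [Hz1 Hz2]]. lra.
      { intros z _. apply is_derive_Reals. apply FF. }
      assert (HZ1 := HZ y (Rlt_le _ _ Hy) (z - y - b) ltac:(rewrite Rabs_left1; lra)).
      replace (y + b + (z - y - b)) with z in HZ1 by ring.
      replace (y + b - (y + (b - e0))) with e0 in Hz1 by ring.
      assert (phi1 z * e0 <= k1 * eta lam y * e0) by (apply Rmult_le_compat_r; lra). lra. }
  replace (x + c * t + (b - e0)) with (y + (b - e0)) by (unfold y; ring).
  apply Rle_trans with (1 := Hkey). apply Rplus_le_compat_l.
  apply Rle_trans with (2 * (e0 * k1) * eta lam y). apply Rmult_le_compat_r; lra.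
  unfold q. replace (2 * M * (e0 * k1) * eta lam (y + (b - e0))) with (2 * (e0 * k1) * (M * eta lam (y + (b - e0)))) by ring.
  apply Rmult_le_compat_l. { assert (0 < e0 * k1) by (apply Rmult_lt_0_compat; auto). lra. }
  replace y with (y + (b - e0) + - (b - e0)) at 1 by ring.
  apply Rle_trans with (1 := eta_translate lam _ _ (Rlt_le _ _ Hlam)). apply Rmult_le_compat_r. left; apply eta_pos.
  apply exp_le_mono. apply Rmult_le_compat_l. lra. rewrite Rabs_Ropp.
  apply Rle_trans with (1 := Rabs_triang _ _). rewrite Rabs_Ropp (Rabs_pos_eq e0); lra.
Qed.

(** Both bounds are read at [x = - c t], where the weight is 1 and the two translates take the
    values [phi a] and [phi b]. *)
Lemma below_le_above g kappa h c lam phi phi1 nu u a b : fast_front g kappa h c lam phi phi1 nu ->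
  eventually_below c lam phi u a -> eventually_above c lam phi u b -> a <= b.
Proof.
  intros FF Ha Hb. apply Rnot_lt_le. intros Hlt.
  assert (Hs := front_strict FF b a Hlt).
  assert (Hc := ff_c FF). assert (Hlam := ff_lam FF).
  destruct (Ha ((phi a - phi b) / 3)) as [T1 HT1]. lra.
  destruct (Hb ((phi a - phi b) / 3)) as [T2 HT2]. lra.
  set (t := Rmax 0 (Rmax T1 T2)).
  assert (A0 : 0 <= t) by apply Rmax_l.
  assert (A1 : T1 <= t). { apply Rle_trans with (2 := Rmax_r _ _). apply Rmax_l. }
  assert (A2 : T2 <= t). { apply Rle_trans with (2 := Rmax_r _ _). apply Rmax_r. }
  specialize (HT1 t (- c * t) A1 ltac:(nra)). specialize (HT2 t (- c * t) A2).
  replace (- c * t + c * t) with 0 in HT1, HT2 by ring.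
  rewrite eta_right in HT1; try lra. rewrite eta_right in HT2; try lra.
  rewrite Rplus_0_l in HT1. rewrite Rplus_0_l in HT2. lra.
Qed.

Lemma below_closed g kappa h c lam phi phi1 nu u a : fast_front g kappa h c lam phi phi1 nu ->
  (forall e, 0 < e -> exists a', Rabs (a - a') <= e /\ eventually_below c lam phi u a') ->
  eventually_below c lam phi u a.
Proof.
  intros FF Ha eps Heps.
  destruct (front_shift (Rabs a + 1) FF) as [K [HK Hsh]].
  destruct (Ha (Rmin 1 (eps / (2 * K)))) as [a' [Haa Hbe]].
  { apply Rmin_pos. lra. apply Rdiv_lt_0_compat; lra. }
  assert (A1 : Rabs (a - a') <= 1) by (apply Rle_trans with (1 := Haa); apply Rmin_l).
  assert (A2 : K * Rabs (a - a') <= eps / 2).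
  { apply Rle_trans with (K * (eps / (2 * K))); [|right; field; lra]. apply Rmult_le_compat_l. lra.
    apply Rle_trans with (1 := Haa). apply Rmin_r. }
  destruct (Hbe (eps / 2)) as [T HT]. lra.
  exists T. intros t x Ht Hx. specialize (HT t x Ht Hx).
  assert (A3 : Rabs a' <= Rabs a + 1).
  { replace a' with (a + - (a - a')) by ring. apply Rle_trans with (1 := Rabs_triang _ _). rewrite Rabs_Ropp. lra. }
  assert (HS := Hsh (x + c * t) a a' ltac:(lra) A3). assert (He := eta_pos lam (x + c * t)).
  assert (K * Rabs (a - a') * eta lam (x + c * t) <= eps / 2 * eta lam (x + c * t)) by (apply Rmult_le_compat_r; lra). lra.
Qed.

Lemma above_closed g kappa h c lam phi phi1 nu u b : fast_front g kappa h c lam phi phi1 nu ->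
  (forall e, 0 < e -> exists b', Rabs (b' - b) <= e /\ eventually_above c lam phi u b') ->
  eventually_above c lam phi u b.
Proof.
  intros FF Hb eps Heps.
  destruct (front_shift (Rabs b + 1) FF) as [K [HK Hsh]].
  destruct (Hb (Rmin 1 (eps / (2 * K)))) as [b' [Hbb Hab]].
  { apply Rmin_pos. lra. apply Rdiv_lt_0_compat; lra. }
  assert (A1 : Rabs (b' - b) <= 1) by (apply Rle_trans with (1 := Hbb); apply Rmin_l).
  assert (A2 : K * Rabs (b' - b) <= eps / 2).
  { apply Rle_trans with (K * (eps / (2 * K))); [|right; field; lra]. apply Rmult_le_compat_l. lra.
    apply Rle_trans with (1 := Hbb). apply Rmin_r. }
  destruct (Hab (eps / 2)) as [T HT]. lra.
  exists T. intros t x Ht. specialize (HT t x Ht).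
  assert (A3 : Rabs b' <= Rabs b + 1).
  { replace b' with (b + (b' - b)) by ring. apply Rle_trans with (1 := Rabs_triang _ _). lra. }
  assert (HS := Hsh (x + c * t) b' b A3 ltac:(lra)). assert (He := eta_pos lam (x + c * t)).
  assert (K * Rabs (b' - b) * eta lam (x + c * t) <= eps / 2 * eta lam (x + c * t)) by (apply Rmult_le_compat_r; lra). lra.
Qed.

(** For [y >= Y] the front alone is within [q] of [kappa]. For [y < Y] the choice of the shift
    forces [x <= w], and then [mu > lam] makes [A e^{mu x}] at most [q e^{lam (y - Y)}], which is at
    most [q eta]. *)
Lemma initial_above g kappa h c lam phi phi1 nu u mu A q : 0 <= h -> fast_front g kappa h c lam phi phi1 nu ->
  evolution g kappa h u -> lam < mu -> 0 < A -> 0 < q ->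
  (forall s x, - h <= s <= 0 -> u s x <= A * exp (mu * x)) ->
  exists b, forall t x, 0 - h <= t <= 0 -> u t x <= phi (x + c * t + b) + q * eta lam (x + c * t + b).
Proof.
  intros Hh FF EV Hmu HA Hq Hinit.
  assert (Hc := ff_c FF). assert (Hlam := ff_lam FF).
  destruct (ff_p FF q Hq) as [Y0 HY0].
  set (Y := Rmax 0 Y0). assert (HY1 : 0 <= Y) by apply Rmax_l. assert (HY2 : Y0 <= Y) by apply Rmax_r.
  assert (HE : 0 < exp (lam * (c * h + Y))) by apply exp_pos.
  destruct (exp_small (mu - lam) (q / (A * exp (lam * (c * h + Y)))) 0) as [w [Hw1 Hw2]]. lra.
  { apply Rdiv_lt_0_compat; auto. apply Rmult_lt_0_compat; auto. }
  exists (Y + c * h - w). intros t x Ht. set (y := x + c * t + (Y + c * h - w)).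
  assert (Hct : - (c * h) <= c * t <= 0) by nra.
  assert (Hrng := ev_rng EV t x ltac:(lra)).
  destruct (Rle_lt_dec Y y) as [Hy|Hy].
  - rewrite eta_right; try lra. specialize (HY0 y ltac:(lra)). lra.
  - apply Rle_trans with (1 := Hinit t x ltac:(lra)).
    assert (Heta : exp (lam * (y - Y)) <= eta lam y).
    { apply Rmin_glb. apply exp_le_mono. nra. rewrite -exp_0. apply exp_le_mono. nra. }
    assert (Hphi := ff_rng FF y).
    apply Rle_trans with (q * eta lam y); [|lra].
    apply Rle_trans with (q * exp (lam * (y - Y))); [|apply Rmult_le_compat_l; lra].
    assert (Hx : x <= w) by (unfold y in Hy; lra).
    replace (mu * x) with ((mu - lam) * x + lam * x) by ring. rewrite exp_plus.
    apply Rle_trans with (A * (exp ((mu - lam) * w) * (exp (lam * (y - Y)) * exp (lam * (c * h + Y))))).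
    + apply Rmult_le_compat_l. lra. apply Rmult_le_compat; try (left; apply exp_pos).
      apply exp_le_mono. apply Rmult_le_compat_l; lra.
      rewrite -exp_plus. apply exp_le_mono. rewrite -Rmult_plus_distr_l. apply Rmult_le_compat_l. lra. unfold y. 
      assert (0 <= c * h) by (apply Rmult_le_pos; lra). lra.
    + replace (A * (exp ((mu - lam) * w) * (exp (lam * (y - Y)) * exp (lam * (c * h + Y))))) with
        (A * exp (lam * (c * h + Y)) * exp ((mu - lam) * w) * exp (lam * (y - Y))) by ring.
      apply Rmult_le_compat_r. left; apply exp_pos.
      apply Rle_trans with (A * exp (lam * (c * h + Y)) * (q / (A * exp (lam * (c * h + Y))))).
      apply Rmult_le_compat_l. left; apply Rmult_lt_0_compat; auto. lra. right; field. split; lra.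
Qed.

Lemma half_convergence g kappa L G0 k dk h c lam phi phi1 nu eps u mu A : monostable g kappa L G0 k dk ->
  0 <= h -> 0 < eps -> lam ^ 2 - c * lam - 1 + (G0 + eps) * exp (- (lam * (c * h))) < 0 ->
  fast_front g kappa h c lam phi phi1 nu -> evolution g kappa h u -> lam < mu -> 0 < A ->
  (forall s x, - h <= s <= 0 -> u s x <= A * exp (mu * x)) ->
  (exists s x, - h <= s <= 0 /\ 0 < u s x) ->
  exists s1, forall e, 0 < e -> exists T, forall t x, T <= t -> x <= 0 ->
    Rabs (u t x - phi (x + c * t + s1)) <= e * eta lam (x + c * t).
Proof.
  intros H Hh Heps Hchi FF EV Hmu HA Hup Hex.
  assert (Hk := ms_kappa H).
  assert (Hc := ff_c FF). assert (Hlam := ff_lam FF).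
  assert (Hrng := ff_rng FF).
  destruct (stability g kappa L G0 k dk h c lam phi phi1 nu eps u H Hh Heps Hchi FF EV) as [gb [Hgb Hstab]].
  destruct (exponential_at_origin g kappa L G0 k dk h u H Hh EV Hex) as [be [D [T3 [Hbe [HD Hor]]]]].
  (* The barrier may not decay faster than [u t 0] approaches [kappa], since otherwise the boundary
     condition of [stable_below] could fail at late times. *)
  set (ga := Rmin gb be).
  assert (Hga : 0 < ga) by (apply Rmin_pos; auto).
  assert (Hga1 : ga <= gb) by apply Rmin_l. assert (Hga2 : ga <= be) by apply Rmin_r.
  destruct (Hstab ga (conj Hga Hga1)) as [qb [C [Hqb [HC [_ [Hsa Hsb]]]]]].
  assert (Hbd : forall q, 0 < q -> exists T, forall t0 t, T <= t0 <= t ->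
            kappa - q * exp (- ga * (t - t0)) <= u t 0 /\ phi 0 <= u t 0).
  { intros q Hq. destruct (decay_time be D (Rmin q (kappa - phi 0)) Hbe) as [T4 [_ HT4]].
    { apply Rmin_pos; auto. specialize (Hrng 0). lra. }
    exists (Rmax T3 T4). intros t0 t Ht.
    assert (A1 : T3 <= t0) by (apply Rle_trans with (2 := proj1 Ht); apply Rmax_l).
    assert (A2 : T4 <= t0) by (apply Rle_trans with (2 := proj1 Ht); apply Rmax_r).
    assert (B1 := HT4 t0 A2). assert (B2 := HT4 t ltac:(lra)). assert (B3 := Hor t ltac:(lra)).
    assert (M1 := Rmin_l q (kappa - phi 0)). assert (M2 := Rmin_r q (kappa - phi 0)).
    split; [|lra].
    assert (D * exp (- be * t) <= q * exp (- ga * (t - t0))); [|lra].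
    replace (- be * t) with (- be * t0 + - be * (t - t0)) by ring. rewrite exp_plus -Rmult_assoc.
    apply Rmult_le_compat; try (left; apply exp_pos); try lra.
    - left. apply Rmult_lt_0_compat; auto. apply exp_pos.
    - apply exp_le_mono. nra. }
  destruct (initial_above g kappa h c lam phi phi1 nu u mu A qb Hh FF EV Hmu HA Hqb Hup) as [b0 Hb0].
  assert (Hab0 := stable_above_eventually g kappa h c lam phi u ga qb C 0 b0 qb Hlam Hga Hsa (Rle_refl 0) (conj Hqb (Rle_refl qb)) Hb0).
  assert (Hbe0 : exists a0, eventually_below c lam phi u a0).
  { destruct (Hbd qb Hqb) as [T4 HT4]. set (t0 := Rmax T4 0).
    destruct (ff_m FF qb Hqb) as [Zm HZm].
    (* The front is moved so far to the right that on [x <= 0] and up to time [t0] it lies below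
       [qb eta]; the barrier is then nonpositive on the initial window. *)
    set (a := Rmin Zm 0 - c * t0). exists (a - C * qb).
    apply (stable_below_eventually g kappa h c lam phi u ga qb C t0 a qb); auto.
    - apply Rmax_r.
    - lra.
    - intros t x Ht Hx.
      assert (Hy : x + c * t + a <= Rmin Zm 0).
      { unfold a. assert (c * t <= c * t0) by (apply Rmult_le_compat_l; lra). lra. }
      assert (M1 := Rmin_l Zm 0). assert (M2 := Rmin_r Zm 0).
      rewrite eta_left; try lra. specialize (HZm (x + c * t + a) ltac:(lra)).
      assert (0 <= t0) by apply Rmax_r.
      generalize (ev_rng EV t x ltac:(lra)). lra.
    - intros t Ht. apply HT4. split; auto. apply Rmax_l. }
  destruct Hbe0 as [a0 Hbe0].
  assert (Hord := fun a b => below_le_above g kappa h c lam phi phi1 nu u a b FF).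
  destruct (completeness (eventually_below c lam phi u)) as [al [Hal1 Hal2]].
  { exists (b0 + C * qb). intros a Ha. apply Hord; auto. }
  { exists a0; auto. }
  destruct (completeness (fun b => eventually_above c lam phi u (- b))) as [bl [Hbl1 Hbl2]].
  { exists (- a0). intros b Hb. assert (a0 <= - b) by (apply Hord; auto). lra. }
  { exists (- (b0 + C * qb)). rewrite Ropp_involutive. auto. }
  assert (Ha : eventually_below c lam phi u al).
  { apply (below_closed g kappa h c lam phi phi1 nu u al FF). intros e He. apply NNPP. intros Hno.
    assert (al <= al - e); [|lra]. apply Hal2. intros a Haa. apply Rnot_lt_le. intros Hlt. apply Hno.
    exists a. split; auto. assert (a <= al) by (apply Hal1; auto). rewrite Rabs_pos_eq; lra. }
  assert (Hb : eventually_above c lam phi u (- bl)).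
  { apply (above_closed g kappa h c lam phi phi1 nu u (- bl) FF). intros e He. apply NNPP. intros Hno.
    assert (bl <= bl - e); [|lra]. apply Hbl2. intros b Hbb. apply Rnot_lt_le. intros Hlt. apply Hno.
    exists (- b). split; auto. assert (b <= bl) by (apply Hbl1; auto). rewrite Rabs_pos_eq; lra. }
  set (bb := - bl) in *.
  assert (Heq : al = bb).
  { apply Rle_antisym. apply Hord; auto. apply Rnot_lt_le. intros Hlt.
    assert (Hst := front_strict FF al bb Hlt).
    (* Half of the gap at [z = 0], so [phi al + del = phi bb - del]: either [u] is at least this
       value at arbitrarily late times, or it is below it from some time on, and one of the two
       improvements applies. *)
    set (del := (phi bb - phi al) / 2). assert (Hdel : 0 < del) by (unfold del; lra).
    destruct (classic (forall T, exists t, T <= t /\ phi al + del <= u t (- c * t))) as [Hg|Hg].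
    - destruct (improve_below g kappa L G0 k dk h c lam phi phi1 nu u ga qb C al del H Hh FF EV Hga Hqb HC Hsb Hbd Ha Hdel Hg) as [a' [Ha1 Ha2]].
      assert (a' <= al) by (apply Hal1; auto). lra.
    - destruct (improve_above g kappa L G0 k dk h c lam phi phi1 nu u ga qb C bb del H Hh FF EV Hga Hqb HC Hsa Hb Hdel) as [b' [Hb1 Hb2]].
      + apply not_all_ex_not in Hg. destruct Hg as [T HT]. intros T'. exists (Rmax T T'). split. apply Rmax_r.
        apply Rnot_lt_le. intros Hlt2. apply HT. exists (Rmax T T'). split. apply Rmax_l. unfold del in *. lra.
      + assert (- b' <= bl). { apply Hbl1. rewrite Ropp_involutive. auto. } unfold bb in Hb1. lra. }
  exists al. intros e He. destruct (Ha e He) as [T1 HT1]. destruct (Hb e He) as [T2 HT2].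
  exists (Rmax T1 T2). intros t x Ht Hx.
  assert (A1 : T1 <= t) by (apply Rle_trans with (2 := Ht); apply Rmax_l).
  assert (A2 : T2 <= t) by (apply Rle_trans with (2 := Ht); apply Rmax_r).
  specialize (HT1 t x A1 Hx). specialize (HT2 t x A2). rewrite -Heq in HT2. apply Rabs_le. lra.
Qed.

Lemma evolution_reflect g kappa h u : evolution g kappa h u -> evolution g kappa h (fun t x => u t (- x)).
Proof.
  intros EV. constructor.
  - intros tn xn t x Hn Ht Lt Lx. apply (ev_cont EV tn (fun n => - xn n) t (- x)); auto.
    apply (is_lim_seq_opp _ x). auto.
  - intros t x Ht. apply (ev_rng EV); auto.
  - intros t x Ht. destruct (ev_pde EV t (- x) Ht) as [u1 [ut [uxx [H1 [H2 [H3 H4]]]]]].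
    assert (Hrefl : forall (f : R -> R) (y l : R), is_derive f (- y) l -> is_derive (fun z => f (- z)) y (- l)).
    { intros f y l Hf. apply is_derive_eq with (-1 * l); [|ring].
      apply (is_derive_ext (fun z : R => f (-1 * z + 0))). { intros z. f_equal. ring. }
      apply is_derive_comp_lin. replace (-1 * y + 0) with (- y) by ring. auto. }
    exists (fun y => - u1 (- y)), ut, uxx. split; [auto|split; [|split; [|auto]]].
    + intros y. apply Hrefl. auto.
    + apply is_derive_eq with (- - uxx); [|ring]. apply is_derive_neg. apply Hrefl. auto.
Qed.

(** At a double zero [2 z = c + Derive g 0 (c h) e^{- z c h}] with [z > 0], and the right side has
    the sign of [c]. Through [csharp < cstar] this makes the speed of the front positive. *)
Lemma double_zero_speed_pos g h c : 0 <= h -> 0 < Derive g 0 -> has_pos_double_zero g h c -> 0 < c.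
Proof.
  intros Hh HG [z [Hz [_ HD]]].
  assert (E : is_derive (fun w => chi g h w c) z (2 * z - c - Derive g 0 * (c * h) * exp (- (z * c * h)))).
  { unfold chi. auto_derive; auto. ring. }
  rewrite (is_derive_unique _ _ _ E) in HD. apply Rnot_le_lt. intros Hc.
  assert (0 <= Derive g 0 * (- c * h) * exp (- (z * c * h))).
  { apply Rmult_le_pos; [|left; apply exp_pos]. apply Rmult_le_pos. lra. apply Rmult_le_pos; lra. }
  lra.
Qed.

Theorem theorem3 (g : R -> R) (kappa h : R) (phi : R -> R)
  (cstar csharp lam1 lam2 mu A lam : R) (w0 u : R -> R -> R) :
  hypH g kappa ->
  (forall x y, 0 <= x <= y -> g x <= g y) ->
  0 <= h ->
  has_pos_double_zero g h csharp ->
  (forall c, has_pos_double_zero g h c -> c = csharp) ->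
  min_speed g h kappa cstar ->
  wavefront g h kappa phi cstar ->
  csharp < cstar ->
  lambda12 g h cstar lam1 lam2 ->
  lam1 < mu -> 0 < A ->
  lam1 < lam < lam2 -> lam < mu ->
  w0_regular h w0 ->
  (exists s x, -h <= s <= 0 /\ w0 s x <> 0) ->
  (exists s x, -h <= s <= 0 /\ w0 s (- x) <> 0) ->
  (forall s x, -h <= s <= 0 -> 0 <= w0 s x <= kappa) ->
  (forall s x, -h <= s <= 0 -> 0 <= w0 s (- x) <= kappa) ->
  (forall s x, -h <= s <= 0 -> w0 s x <= A * exp (mu * x)) ->
  (forall s x, -h <= s <= 0 -> w0 s (- x) <= A * exp (mu * x)) ->
  ivp_solution g h w0 u ->
  exists s1 s2 : R,
    (forall eps, 0 < eps -> exists T, forall t x, T <= t -> x <= 0 ->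
       Rabs (u t x - phi (x + cstar * t + s1)) / eta lam (x + cstar * t) <= eps) /\
    (forall eps, 0 < eps -> exists T, forall t x, T <= t -> 0 <= x ->
       Rabs (u t x - phi (- x + cstar * t + s2)) / eta lam (- x + cstar * t) <= eps).
Proof.
  intros HH Hmono Hh Hdz _ Hmin Hw Hcs Hl12 Hmu1 HA Hlam Hlammu _ Hex1 Hex2 Hr1 _ Hu1 Hu2 Hivp.
  destruct (hypH_monostable g kappa HH Hmono) as [L [k [dk H]]].
  assert (HG := ms_G0 H).
  assert (Hcpos := double_zero_speed_pos g h csharp Hh ltac:(lra) Hdz).
  assert (Hl0 : 0 < lam1) by apply Hl12.
  assert (Hchi : forall l, lam <= l < lam2 -> chi g h l cstar < 0).
  { intros l Hl. apply (chi_neg g h cstar lam1 lam2); auto; lra. }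
  destruct (minimal_front_is_fast g kappa L k dk h phi cstar lam lam2 H Hh) as [phi1 [nu FF]]; auto; try lra.
  destruct (chi_slack g h cstar lam (Hchi lam ltac:(lra)) HG) as [eps [He1 He2]].
  assert (EV := ivp_evolution g kappa L _ k dk h w0 u H Hh Hr1 Hivp).
  assert (Hini : forall s x, - h <= s <= 0 -> u s x = w0 s x) by apply Hivp.
  destruct (half_convergence g kappa L _ k dk h cstar lam phi phi1 nu eps u mu A H Hh (proj1 He1) He2 FF EV Hlammu HA)
    as [s1 Hs1].
  { intros s x Hs. rewrite Hini; auto. }
  { destruct Hex1 as [s [x [Hs Hx]]]. exists s, x. split; auto. rewrite Hini; auto. specialize (Hr1 s x Hs). lra. }
  destruct (half_convergence g kappa L _ k dk h cstar lam phi phi1 nu eps (fun t x => u t (- x)) mu A H Hh (proj1 He1) He2 FF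
     (evolution_reflect _ _ _ _ EV) Hlammu HA) as [s2 Hs2].
  { intros s x Hs. rewrite Hini; auto. }
  { destruct Hex2 as [s [x [Hs Hx]]]. exists s, x. split; auto. rewrite Hini; auto. specialize (Hr1 s (- x) Hs). lra. }
  exists s1, s2. split.
  - intros e He. destruct (Hs1 e He) as [T HT]. exists T. intros t x Ht Hx.
    apply Rle_div_l. apply eta_pos. auto.
  - intros e He. destruct (Hs2 e He) as [T HT]. exists T. intros t x Ht Hx.
    apply Rle_div_l. apply eta_pos. specialize (HT t (- x) Ht ltac:(lra)). rewrite Ropp_involutive in HT. auto.
Qed.
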